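(* Suppose that $\mathfrak F[f](\xi)$ exists for $\xi\in\mathbb R$, and that $f$ is holomorphic in the horizontal strip $\Xi_0=\{z\in\mathbb C:\ |\Im(z)|<a_0\}$, for some $a_0>a>0$, except for finitely many poles $z_1,\ldots,z_m$, where $a=\min_{1\le k\le m}|\Im(z_k)|$. If the poles $z_k$ with $|\Im(z_k)|=a$ are simple, and both $$\lim_{x\to\pm\infty}\int_{-a_0}^{a_0}|f(x+i\eta)|\,\mathrm d\eta=0\qquad\text{and}\qquad B_0^{\pm}:=\int_{-\infty}^{+\infty}|f(x\pm ia_0)|\,\mathrm dx<+\infty$$ hold, then $|\mathfrak F[f](\xi)|\le Be^{-2\pi a|\xi|}$ for some constant $B$. In addition, for each $h>0$ it holds that $$E(h):=\left|\int_{\mathbb R}f(x)\,\mathrm dx-h\sum_{n=-\infty}^{+\infty}f(nh)\right|\le\sum_{n\ne0}\left|\mathfrak F[f]\left(\frac nh\right)\right|\le\frac{2B}{e^{\frac{2a\pi}{h}}-1}.$$ In particular, if all the poles $z_1,\ldots,z_m$ are simple, the constant $B$ in $|\mathfrak F[f](\xi)|\le Be^{-2\pi a|\xi|}$ and in the bound for $E(h)$ can be replaced by $$B=\max\{B_0^-,B_0^+\}+2\pi\sum_{k=1}^{m}\big|\mathrm{Res}[f(z),z_k]\big|.$$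
   Context: $\Im(z)$ is the imaginary part of $z$. The Fourier transform is $\mathfrak F[f](\xi)=\int_{-\infty}^{+\infty}f(x)e^{-2\pi ix\xi}\,\mathrm dx$, and the validity of the Fourier inversion formula $f(x)=\int_{-\infty}^{+\infty}\mathfrak F[f](\xi)e^{2\pi ix\xi}\,\mathrm d\xi$ is assumed throughout. The quantities $f(x\pm ia_0)$ are the values of $f$ on the boundary lines of the strip $\Xi_0$. $\mathrm{Res}[f(z),z_k]$ is the residue of $f$ at $z_k$. *)

(* Defs.v *)
From Stdlib Require Import Reals ZArith List.
From Coquelicot Require Import Coquelicot.
Open Scope R_scope.

Definition expi (t : R) : C := (cos t, sin t).

(* Improper integrals over the whole line: both end points go to infinity
   independently. *)
Definition ex_RInt_line {V : CompleteNormedModule R_AbsRing} (f : R -> V) : Prop :=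
  ex_RInt_gen f (Rbar_locally m_infty) (Rbar_locally p_infty).

Definition is_RInt_line {V : CompleteNormedModule R_AbsRing} (f : R -> V) (l : V) : Prop :=
  is_RInt_gen f (Rbar_locally m_infty) (Rbar_locally p_infty) l.

Definition RInt_line {V : CompleteNormedModule R_AbsRing} (f : R -> V) : V :=
  RInt_gen f (Rbar_locally m_infty) (Rbar_locally p_infty).

Definition fourier_integrand (f : C -> C) (xi x : R) : C :=
  Cmult (f (RtoC x)) (expi (- (2 * PI * x * xi))).

Definition fourier (f : C -> C) (xi : R) : C :=
  RInt_line (V := C_R_CompleteNormedModule) (fourier_integrand f xi).

Definition fourier_inversion (f : C -> C) : Prop :=
  forall x : R,
    is_RInt_line (V := C_R_CompleteNormedModule)
      (fun xi => Cmult (fourier f xi) (expi (2 * PI * x * xi))) (f (RtoC x)).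

(* A series indexed by Z converges when its two halves do, separately. *)
Definition is_Zseries {V : CompleteNormedModule R_AbsRing} (u : Z -> V) (l : V) : Prop :=
  exists lp ln : V,
    is_series (fun n : nat => u (Z.of_nat n)) lp /\
    is_series (fun n : nat => u (- Z.of_nat (S n))%Z) ln /\
    l = plus lp ln.

Definition ex_Zseries {V : CompleteNormedModule R_AbsRing} (u : Z -> V) : Prop :=
  exists l : V, is_Zseries u l.

Definition Zseries {V : CompleteNormedModule R_AbsRing} (u : Z -> V) : V :=
  iota (is_Zseries u).

Definition holomorphic_at (f : C -> C) (z : C) : Prop :=
  locally (T := C_UniformSpace) z
    (fun w => ex_derive (K := C_AbsRing) (V := C_NormedModule) f w).

(* [sum_(1 <= j <= n) c j / (w - z)^j] is the principal part of the Laurent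
   expansion of [f] at [z]; the value [f z] itself is irrelevant. *)
Definition has_principal_part (f : C -> C) (z : C) (n : nat) (c : nat -> C) : Prop :=
  exists g : C -> C,
    holomorphic_at g z /\
    locally' (T := C_UniformSpace) z (fun w =>
      f w = Cplus (sum_n_m (G := C_AbelianMonoid)
                     (fun j => Cdiv (c j) (Cpow (Cminus w z) j)) 1 n)
                  (g w)).

Definition pole_of_order (f : C -> C) (z : C) (n : nat) : Prop :=
  (1 <= n)%nat /\
  exists c : nat -> C, has_principal_part f z n c /\ c n <> RtoC 0.

Definition is_pole (f : C -> C) (z : C) : Prop :=
  exists n : nat, pole_of_order f z n.

Definition simple_pole (f : C -> C) (z : C) : Prop := pole_of_order f z 1.

(* The residue at a point where the principal part is finite, which covers
   all poles. *)
Definition is_residue (f : C -> C) (z r : C) : Prop :=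
  exists (n : nat) (c : nat -> C),
    (1 <= n)%nat /\ has_principal_part f z n c /\ r = c 1%nat.

Definition sample (f : C -> C) (h : R) (n : Z) : C := f (RtoC (IZR n * h)).

Definition trapezoidal_error (f : C -> C) (h : R) : R :=
  Cmod (Cminus
    (RInt_line (V := C_R_CompleteNormedModule) (fun x => f (RtoC x)))
    (Cmult (RtoC h) (Zseries (V := C_R_CompleteNormedModule) (sample f h)))).

(* The terms |F[f](n/h)| with n <> 0; the term of index 0 is replaced by 0. *)
Definition fourier_sample (f : C -> C) (h : R) (n : Z) : R :=
  if Z.eq_dec n 0 then 0 else Cmod (fourier f (IZR n / h)).

Definition fourier_decay (f : C -> C) (a B : R) : Prop :=
  forall xi : R, Cmod (fourier f xi) <= B * exp (- (2 * PI * a * Rabs xi)).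

(* The convergence of both series is part of the claim, since [Zseries] is a
   total operator. *)
Definition trapezoidal_bound (f : C -> C) (a B : R) : Prop :=
  forall h : R, 0 < h ->
    ex_Zseries (V := C_R_CompleteNormedModule) (sample f h) /\
    ex_Zseries (V := R_CompleteNormedModule) (fourier_sample f h) /\
    trapezoidal_error f h
      <= Zseries (V := R_CompleteNormedModule) (fourier_sample f h) /\
    Zseries (V := R_CompleteNormedModule) (fourier_sample f h)
      <= 2 * B / (exp (2 * a * PI / h) - 1).

Definition sum_list (l : list R) : R := fold_right Rplus 0 l.

(* Main.v *)
Require Import Defs.
From Stdlib Require Import Reals ZArith List Lra Lia.
From Stdlib Require Import ClassicalEpsilon FunctionalExtensionality.
From Coquelicot Require Import Coquelicot.
Open Scope R_scope.

(** Write F for the Fourier transform of [f] and move its line of integration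
    from the real axis to the line Im z = t, with t = -a0 when xi >= 0 and
    t = a0 when xi <= 0.  On that line the exponential exp(-2 pi i z xi) has
    modulus exp(-2 pi a0 |xi|), and between the two lines its modulus is at
    most 1, so the vertical sides of the contour contribute at most the
    integral of |f(x + i eta)| over eta, which tends to 0.  Hence F(xi) is, up
    to B exp(-2 pi a0 |xi|) with B the integral of |f| over the line, the
    signed sum of 2 pi i times the residues of f(z) exp(-2 pi i z xi) at the
    poles crossed ([shift_identity], [fourier_minus_residues]).  A pole z of
    order n contributes exp(-2 pi |Im z| |xi|) times a polynomial of degree
    n - 1 in xi.  At a simple pole this is at most
    2 pi |Res| exp(-2 pi a |xi|) ([simple_residue_bound]); at a pole with
    |Im z| > a the gap |Im z| - a absorbs the polynomial
    ([higher_residue_bound]).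

    The contour integrals rest on Goursat's lemma, because [f] is only known to
    be complex differentiable point by point.  [Cauchy_rectangle] extends it to
    continuous integrands that are differentiable at open heights off a finite
    set: cut along the horizontal lines through the exceptional points, then
    approach the horizontal edges from inside.  Subtracting at each pole the
    principal part times the exponential leaves removable singularities, so
    only the integrals of those models remain ([Rect_residues]); they reduce to
    that of 1/(z - p), which is a sum of arctangents ([Rect_pole_kernel],
    [Rect_inv]).

    For the trapezoidal rule the Poisson formula h sum f(n h) = sum F(k/h) is
    first proved on windows [X, Y] made of whole cells centred at the nodes
    n h.  On such a cell f(x) - f(n h) = (exp(2 pi i x/h) - 1) q(x) with q
    continuous, so the sum of the Fourier coefficients telescopes, and the
    Riemann-Lebesgue lemma removes what is left ([coef_sums_window]).  When a
    coefficient over the window is compared with F(k/h) through the same shift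
    of contour, the residues cancel.  There remain the parts of the boundary
    lines outside the window, weighted by a geometric sequence in k, and the
    two vertical sides.  The ends of a window are half-integer multiples of h,
    where the exponentials are the powers (-r)^k with 0 <= r <= 1, whose
    partial sums are bounded by 1; so the vertical sides, summed over any
    number of k, stay below the integrals of |f| along them
    ([colint_sum_le], [window_sum_le]).  Letting first the number of
    frequencies and then both ends of the window go to infinity gives the
    convergence of the two halves of sum f(n h) and the formula
    ([Poisson_summation]).  The error is therefore the modulus of the sum of
    F(k/h) over k <> 0, and the exponential decay bounds it by two geometric
    series ([trapezoidal_bound_of_decay]). *)

Notation Clocally := (locally (T := C_UniformSpace)).
Notation Clocally' := (locally' (T := C_UniformSpace)).
Notation Csum_n := (sum_n (G := C_AbelianMonoid)).
Notation Ccont := (continuous (T := C_UniformSpace) (U := C_UniformSpace)).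
Notation Cderiv := (is_derive (K := C_AbsRing) (V := C_NormedModule)).
Notation Cdiffable := (ex_derive (K := C_AbsRing) (V := C_NormedModule)).
Notation cint := (RInt (V := C_R_CompleteNormedModule)).
Notation ex_cint := (ex_RInt (V := C_R_NormedModule)).
Notation RCcont := (continuous (T := R_UniformSpace) (U := C_UniformSpace)).

(** * Complex limits and derivatives *)

(** The balls of the product uniform structure are squares; the estimates below
    use discs. *)
Lemma C_locally_Cmod (z : C) (P : C -> Prop) :
  Clocally z P <->
  exists d, 0 < d /\ forall w, Cmod (Cminus w z) < d -> P w.
Proof.
  split.
  - intros [e He]. exists e; split; [apply cond_pos|].
    intros w Hw. apply He. apply C_NormedModule_mixin_compat1. exact Hw.
  - intros [d [Hd H]].
    assert (Hs : 0 < sqrt 2) by (apply sqrt_lt_R0; lra).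
    exists (mkposreal (d / sqrt 2) (Rdiv_lt_0_compat _ _ Hd Hs)).
    intros w Hw. apply H.
    replace d with (sqrt 2 * (d / sqrt 2)) by (field; lra).
    exact (C_NormedModule_mixin_compat2 _ _ (mkposreal _ (Rdiv_lt_0_compat _ _ Hd Hs)) Hw).
Qed.

Lemma C_locally'_Cmod (z : C) (P : C -> Prop) :
  Clocally' z P <->
  exists d, 0 < d /\ forall w, Cmod (Cminus w z) < d -> w <> z -> P w.
Proof. unfold locally', within. apply C_locally_Cmod. Qed.

Lemma C_filterlim {T} (h : T -> C) (F : (T -> Prop) -> Prop) {FF : Filter F} (l : C) :
  filterlim h F (Clocally l) <->
  forall e, 0 < e -> F (fun t => Cmod (Cminus (h t) l) < e).
Proof.
  split.
  - intros H e He. apply (H (fun w => Cmod (Cminus w l) < e)).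
    apply C_locally_Cmod. exists e; split; auto.
  - intros H P HP. apply C_locally_Cmod in HP. destruct HP as [d [Hd HP]].
    unfold filtermap. generalize (H d Hd). apply filter_imp. auto.
Qed.

Lemma Ccont_eps (H : C -> C) (z : C) :
  Ccont H z <-> forall e, 0 < e -> exists d, 0 < d /\
    forall w, Cmod (Cminus w z) < d -> Cmod (Cminus (H w) (H z)) < e.
Proof.
  unfold continuous. split.
  - intros K e He. apply C_locally_Cmod. exact (proj1 (C_filterlim H (Clocally z) (H z)) K e He).
  - intros K. apply (C_filterlim H (Clocally z) (H z)). intros e He. apply C_locally_Cmod. exact (K e He).
Qed.

(** The neighbourhoods in [is_derive] over [C_AbsRing] are those of the absolute
    value; [locally_C] identifies them with those of [C_UniformSpace]. *)
Lemma Cderiv_eps (H : C -> C) (z l : C) :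
  Cderiv H z l <-> forall e, 0 < e -> exists d, 0 < d /\
    forall w, Cmod (Cminus w z) < d ->
      Cmod (Cminus (Cminus (H w) (H z)) (Cmult l (Cminus w z))) <= e * Cmod (Cminus w z).
Proof.
  split.
  - intros [_ D] e He.
    destruct (proj1 (C_locally_Cmod z _) (proj2 (locally_C z _) (D z (fun P x => x) (mkposreal e He)))) as [d [Hd K]].
    exists d; split; [exact Hd|]. intros w Hw. specialize (K w Hw).
    rewrite (Cmult_comm l). exact K.
  - intros K. split; [apply (is_linear_scal_l (K := C_AbsRing) (V := C_NormedModule))|].
    intros x Hx.
    assert (x = z) by (symmetry; apply is_filter_lim_locally_unique; exact Hx). subst x.
    intros e. apply locally_C. apply C_locally_Cmod.
    destruct (K e (cond_pos e)) as [d [Hd K']]. exists d; split; [exact Hd|].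
    intros w Hw. specialize (K' w Hw). rewrite (Cmult_comm l) in K'. exact K'.
Qed.

Lemma Cmod_triangle3 (a b c : C) : Cmod (Cplus (Cplus a b) c) <= Cmod a + Cmod b + Cmod c.
Proof.
  eapply Rle_trans; [apply Cmod_triangle|]. apply Rplus_le_compat_r, Cmod_triangle.
Qed.

Lemma Cmod_sub_comm (a b : C) : Cmod (Cminus a b) = Cmod (Cminus b a).
Proof. rewrite <- Cmod_opp. f_equal. ring. Qed.

Lemma filterlim_Cplus {T} (F : (T -> Prop) -> Prop) {FF : Filter F} (g h : T -> C) (a b : C) :
  filterlim g F (Clocally a) ->
  filterlim h F (Clocally b) ->
  filterlim (fun t => Cplus (g t) (h t)) F (Clocally (Cplus a b)).
Proof.
  intros Hg Hh.
  exact (filterlim_comp_2 g h Cplus Hg Hh (filterlim_plus (V := C_R_NormedModule) a b)).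
Qed.

Lemma filterlim_Cmult {T} (F : (T -> Prop) -> Prop) {FF : Filter F} (g h : T -> C) (a b : C) :
  filterlim g F (Clocally a) ->
  filterlim h F (Clocally b) ->
  filterlim (fun t => Cmult (g t) (h t)) F (Clocally (Cmult a b)).
Proof.
  intros Hg Hh. apply (C_filterlim (fun t => Cmult (g t) (h t)) F). intros e He.
  pose proof (Cmod_ge_0 a) as Ha. pose proof (Cmod_ge_0 b) as Hb.
  set (M := 1 + Cmod a + Cmod b).
  assert (HM : 0 < M) by (unfold M; lra).
  set (d := Rmin 1 (e / (2 * M))).
  assert (Hd2 : 0 < e / (2 * M)) by (apply Rdiv_lt_0_compat; lra).
  assert (Hd : 0 < d) by (apply Rmin_pos; lra).
  generalize (filter_and _ _ (proj1 (C_filterlim g F a) Hg d Hd) (proj1 (C_filterlim h F b) Hh d Hd)).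
  apply filter_imp. intros t [H1 H2].
  assert (E1 : d <= 1) by apply Rmin_l.
  assert (E2 : d <= e / (2 * M)) by apply Rmin_r.
  replace (Cminus (Cmult (g t) (h t)) (Cmult a b)) with
    (Cplus (Cplus (Cmult (Cminus (g t) a) (Cminus (h t) b)) (Cmult a (Cminus (h t) b)))
       (Cmult (Cminus (g t) a) b)) by ring.
  eapply Rle_lt_trans; [apply Cmod_triangle3|]. rewrite !Cmod_mult.
  assert (e / (2 * M) * (2 * M) = e) by (field; lra).
  pose proof (Cmod_ge_0 (Cminus (g t) a)). pose proof (Cmod_ge_0 (Cminus (h t) b)).
  apply Rle_lt_trans with (d * M); [|nra].
  unfold M. nra.
Qed.

Lemma filterlim_Cinv {T} (F : (T -> Prop) -> Prop) {FF : Filter F} (g : T -> C) (a : C) :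
  a <> RtoC 0 ->
  filterlim g F (Clocally a) ->
  filterlim (fun t => Cinv (g t)) F (Clocally (Cinv a)).
Proof.
  intros Ha Hg. apply (C_filterlim (fun t => Cinv (g t)) F). intros e He.
  assert (Hm : 0 < Cmod a) by (apply Cmod_gt_0; exact Ha).
  set (m := Cmod a) in *.
  set (d := Rmin (m / 2) (e * m * m / 4)).
  assert (Hd2 : 0 < e * m * m / 4) by (apply Rdiv_lt_0_compat; [|lra]; repeat apply Rmult_lt_0_compat; lra).
  assert (Hd : 0 < d) by (apply Rmin_pos; lra).
  generalize (proj1 (C_filterlim g F a) Hg d Hd).
  apply filter_imp. intros t H1.
  assert (E1 : d <= m / 2) by apply Rmin_l.
  assert (E2 : d <= e * m * m / 4) by apply Rmin_r.
  assert (Hgt : m / 2 <= Cmod (g t)).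
  { assert (m <= Cmod (g t) + Cmod (Cminus (g t) a)).
    { unfold m. rewrite (Cmod_sub_comm (g t)).
      replace a with (Cplus (g t) (Cminus a (g t))) at 1 by ring. apply Cmod_triangle. }
    lra. }
  assert (Hg0 : g t <> RtoC 0) by (apply Cmod_gt_0; lra).
  replace (Cminus (Cinv (g t)) (Cinv a)) with (Cdiv (Cminus a (g t)) (Cmult (g t) a)) by (field; auto).
  rewrite Cmod_div by (apply Cmult_neq_0; auto). rewrite Cmod_mult, Cmod_sub_comm.
  fold m. apply Rlt_le_trans with ((e * m * m / 4) / (m / 2 * m)).
  - apply Rle_lt_trans with (Cmod (Cminus (g t) a) / (m / 2 * m)).
    + unfold Rdiv at 1 3. apply Rmult_le_compat_l; [apply Cmod_ge_0|].
      apply Rinv_le_contravar; nra.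
    + apply Rmult_lt_compat_r; [|lra]. apply Rinv_0_lt_compat. nra.
  - replace (e * m * m / 4 / (m / 2 * m)) with (e / 2) by (field; lra). lra.
Qed.

Lemma Ccont_const (c z : C) : Ccont (fun _ => c) z.
Proof. apply filterlim_const. Qed.

Lemma Ccont_id (z : C) : Ccont (fun w => w) z.
Proof. apply filterlim_id. Qed.

Lemma Ccont_plus (G H : C -> C) (z : C) : Ccont G z -> Ccont H z -> Ccont (fun w => Cplus (G w) (H w)) z.
Proof. exact (filterlim_Cplus (Clocally z) G H (G z) (H z)). Qed.

Lemma Ccont_mult (G H : C -> C) (z : C) : Ccont G z -> Ccont H z -> Ccont (fun w => Cmult (G w) (H w)) z.
Proof. exact (filterlim_Cmult (Clocally z) G H (G z) (H z)). Qed.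

Lemma Ccont_opp (H : C -> C) (z : C) : Ccont H z -> Ccont (fun w => Copp (H w)) z.
Proof. exact (continuous_opp (V := C_R_NormedModule) H z). Qed.

Lemma Ccont_minus (G H : C -> C) (z : C) : Ccont G z -> Ccont H z -> Ccont (fun w => Cminus (G w) (H w)) z.
Proof. intros KG KH. apply Ccont_plus; [exact KG|exact (Ccont_opp H z KH)]. Qed.

Lemma Cderiv_cont (H : C -> C) (z l : C) : Cderiv H z l -> Ccont H z.
Proof.
  intros D. apply Ccont_eps. intros e He.
  destruct (proj1 (Cderiv_eps H z l) D 1 Rlt_0_1) as [d [Hd K]].
  pose proof (Cmod_ge_0 l) as Hl.
  assert (Hq : 0 < e / (Cmod l + 2)) by (apply Rdiv_lt_0_compat; lra).
  exists (Rmin d (e / (Cmod l + 2))). split; [apply Rmin_pos; lra|].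
  intros w Hw.
  assert (Hw1 : Cmod (Cminus w z) < d) by (eapply Rlt_le_trans; [exact Hw|apply Rmin_l]).
  assert (Hw2 : Cmod (Cminus w z) < e / (Cmod l + 2)) by (eapply Rlt_le_trans; [exact Hw|apply Rmin_r]).
  specialize (K w Hw1).
  replace (Cminus (H w) (H z)) with
    (Cplus (Cminus (Cminus (H w) (H z)) (Cmult l (Cminus w z))) (Cmult l (Cminus w z))) by ring.
  eapply Rle_lt_trans; [apply Cmod_triangle|]. rewrite Cmod_mult.
  assert (e / (Cmod l + 2) * (Cmod l + 2) = e) by (field; lra).
  pose proof (Cmod_ge_0 (Cminus w z)). nra.
Qed.

Lemma ex_Cderiv_cont (H : C -> C) (z : C) :
  ex_derive (K := C_AbsRing) (V := C_NormedModule) H z -> Ccont H z.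
Proof. intros [l D]. exact (Cderiv_cont H z l D). Qed.

Lemma Cderiv_ext_loc (G H : C -> C) (z l : C) :
  Clocally z (fun w => G w = H w) -> Cderiv G z l -> Cderiv H z l.
Proof.
  intros L D. apply Cderiv_eps. intros e He.
  apply C_locally_Cmod in L. destruct L as [d1 [Hd1 L]].
  destruct (proj1 (Cderiv_eps G z l) D e He) as [d2 [Hd2 K]].
  exists (Rmin d1 d2). split; [apply Rmin_pos; lra|]. intros w Hw.
  rewrite <- (L w), <- (L z).
  - apply K. eapply Rlt_le_trans; [exact Hw|apply Rmin_r].
  - replace (Cminus z z) with (RtoC 0) by ring. rewrite Cmod_0. exact Hd1.
  - eapply Rlt_le_trans; [exact Hw|apply Rmin_l].
Qed.

Lemma Cderiv_const (a z : C) : Cderiv (fun _ => a) z (RtoC 0).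
Proof.
  apply Cderiv_eps. intros e He. exists 1; split; [lra|]. intros w _.
  replace (Cminus (Cminus a a) _) with (RtoC 0) by ring. rewrite Cmod_0.
  pose proof (Cmod_ge_0 (Cminus w z)). nra.
Qed.

Lemma Cderiv_id (z : C) : Cderiv (fun w => w) z (RtoC 1).
Proof.
  apply Cderiv_eps. intros e He. exists 1; split; [lra|]. intros w _.
  replace (Cminus (Cminus w z) _) with (RtoC 0) by ring. rewrite Cmod_0.
  pose proof (Cmod_ge_0 (Cminus w z)). nra.
Qed.

Lemma Cderiv_plus (G H : C -> C) (z l m : C) :
  Cderiv G z l -> Cderiv H z m -> Cderiv (fun w => Cplus (G w) (H w)) z (Cplus l m).
Proof. exact (is_derive_plus (K := C_AbsRing) (V := C_NormedModule) G H z l m). Qed.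

Lemma Cderiv_mult (G H : C -> C) (z l m : C) :
  Cderiv G z l -> Cderiv H z m ->
  Cderiv (fun w => Cmult (G w) (H w)) z (Cplus (Cmult l (H z)) (Cmult (G z) m)).
Proof.
  intros DG DH. apply Cderiv_eps. intros e He.
  pose proof (Cderiv_cont H z m DH) as CH.
  pose proof (Cmod_ge_0 l) as Hl. pose proof (Cmod_ge_0 (G z)) as HG. pose proof (Cmod_ge_0 (H z)) as HH.
  set (M := Cmod l + Cmod (G z) + Cmod (H z) + 1).
  assert (HM : 0 < M) by (unfold M; lra).
  set (q := Rmin 1 (e / (2 * M))).
  assert (0 < e / (2 * M)) by (apply Rdiv_lt_0_compat; lra).
  assert (Hq : 0 < q) by (apply Rmin_pos; lra).
  assert (q1 : q <= 1) by apply Rmin_l.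
  assert (q2 : q * (2 * M) <= e).
  { assert (q <= e / (2 * M)) by apply Rmin_r.
    assert (e / (2 * M) * (2 * M) = e) by (field; lra). nra. }
  destruct (proj1 (Cderiv_eps G z l) DG q Hq) as [d1 [Hd1 K1]].
  destruct (proj1 (Cderiv_eps H z m) DH q Hq) as [d2 [Hd2 K2]].
  destruct (proj1 (Ccont_eps H z) CH q Hq) as [d3 [Hd3 K3]].
  exists (Rmin d1 (Rmin d2 d3)). split; [repeat apply Rmin_pos; lra|]. intros w Hw.
  assert (W1 : Cmod (Cminus w z) < d1) by (eapply Rlt_le_trans; [exact Hw|apply Rmin_l]).
  assert (W23 : Cmod (Cminus w z) < Rmin d2 d3) by (eapply Rlt_le_trans; [exact Hw|apply Rmin_r]).
  assert (W2 : Cmod (Cminus w z) < d2) by (eapply Rlt_le_trans; [exact W23|apply Rmin_l]).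
  assert (W3 : Cmod (Cminus w z) < d3) by (eapply Rlt_le_trans; [exact W23|apply Rmin_r]).
  specialize (K1 w W1). specialize (K2 w W2). specialize (K3 w W3).
  set (u := Cmod (Cminus w z)) in *.
  assert (Hu : 0 <= u) by apply Cmod_ge_0.
  assert (HHw : Cmod (H w) <= Cmod (H z) + 1).
  { replace (H w) with (Cplus (H z) (Cminus (H w) (H z))) by ring.
    eapply Rle_trans; [apply Cmod_triangle|]. lra. }
  replace (Cminus _ _) with
   (Cplus (Cplus (Cmult (Cminus (Cminus (G w) (G z)) (Cmult l (Cminus w z))) (H w))
     (Cmult (G z) (Cminus (Cminus (H w) (H z)) (Cmult m (Cminus w z)))))
     (Cmult (Cmult l (Cminus w z)) (Cminus (H w) (H z)))) by ring.
  eapply Rle_trans; [apply Cmod_triangle3|]. rewrite !Cmod_mult. fold u.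
  pose proof (Cmod_ge_0 (Cminus (H w) (H z))). pose proof (Cmod_ge_0 (H w)).
  apply Rle_trans with (q * u * (Cmod (H z) + 1) + Cmod (G z) * (q * u) + Cmod l * u * q).
  - apply Rplus_le_compat; [apply Rplus_le_compat|].
    + apply Rmult_le_compat; auto. apply Cmod_ge_0.
    + apply Rmult_le_compat_l; auto.
    + apply Rmult_le_compat_l; [nra|lra].
  - replace (_ + _ + _) with (q * M * u) by (unfold M; ring).
    apply Rmult_le_compat_r; nra.
Qed.

Lemma Cderiv_inv (G : C -> C) (z l : C) :
  G z <> RtoC 0 -> Cderiv G z l ->
  Cderiv (fun w => Cinv (G w)) z (Copp (Cdiv l (Cmult (G z) (G z)))).
Proof.
  intros Hz DG. apply Cderiv_eps. intros e He.
  pose proof (Cderiv_cont G z l DG) as CG.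
  pose proof (filterlim_Cinv _ G (G z) Hz CG) as CI.
  pose proof (Cmod_ge_0 l) as Hl.
  set (n := Cinv (G z)) in *.
  pose proof (Cmod_ge_0 n) as Hn.
  set (M := (Cmod n + Cmod l * Cmod n + 1) * (Cmod n + 1)).
  assert (HM : 0 < M) by (unfold M; apply Rmult_lt_0_compat; nra).
  set (q := Rmin 1 (e / M)).
  assert (0 < e / M) by (apply Rdiv_lt_0_compat; lra).
  assert (Hq : 0 < q) by (apply Rmin_pos; lra).
  assert (q1 : q <= 1) by apply Rmin_l.
  assert (q2 : q * M <= e).
  { assert (q <= e / M) by apply Rmin_r.
    assert (e / M * M = e) by (field; lra). nra. }
  destruct (proj1 (Cderiv_eps G z l) DG q Hq) as [d1 [Hd1 K1]].
  destruct (proj1 (Ccont_eps (fun w => Cinv (G w)) z) CI q Hq) as [d2 [Hd2 K2]].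
  destruct (proj1 (Ccont_eps G z) CG (Cmod (G z)) (proj1 (Cmod_gt_0 _) Hz)) as [d3 [Hd3 K3]].
  exists (Rmin d1 (Rmin d2 d3)). split; [repeat apply Rmin_pos; lra|]. intros w Hw.
  assert (W1 : Cmod (Cminus w z) < d1) by (eapply Rlt_le_trans; [exact Hw|apply Rmin_l]).
  assert (W23 : Cmod (Cminus w z) < Rmin d2 d3) by (eapply Rlt_le_trans; [exact Hw|apply Rmin_r]).
  assert (W2 : Cmod (Cminus w z) < d2) by (eapply Rlt_le_trans; [exact W23|apply Rmin_l]).
  assert (W3 : Cmod (Cminus w z) < d3) by (eapply Rlt_le_trans; [exact W23|apply Rmin_r]).
  specialize (K1 w W1). specialize (K2 w W2). specialize (K3 w W3). fold n in K2.
  assert (Hw0 : G w <> RtoC 0).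
  { intros E. rewrite E in K3. replace (Cminus 0 (G z)) with (Copp (G z)) in K3 by ring.
    rewrite Cmod_opp in K3. lra. }
  set (u := Cmod (Cminus w z)) in *.
  assert (Hu : 0 <= u) by apply Cmod_ge_0.
  assert (Hni : Cmod (Cinv (G w)) <= Cmod n + 1).
  { replace (Cinv (G w)) with (Cplus n (Cminus (Cinv (G w)) n)) by ring.
    eapply Rle_trans; [apply Cmod_triangle|]. lra. }
  replace (Cminus _ _) with
   (Copp (Cplus (Cmult (Cminus (Cminus (G w) (G z)) (Cmult l (Cminus w z))) (Cmult n (Cinv (G w))))
     (Cmult (Cmult l n) (Cmult (Cminus w z) (Cminus (Cinv (G w)) n))))) by (unfold n; field; auto).
  rewrite Cmod_opp.
  eapply Rle_trans; [apply Cmod_triangle|]. rewrite !Cmod_mult. fold u.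
  pose proof (Cmod_ge_0 (Cminus (Cinv (G w)) n)). pose proof (Cmod_ge_0 (Cinv (G w))).
  apply Rle_trans with (q * u * (Cmod n * (Cmod n + 1)) + Cmod l * Cmod n * (u * q)).
  - apply Rplus_le_compat.
    + apply Rmult_le_compat; auto. apply Cmod_ge_0. nra. apply Rmult_le_compat_l; auto.
    + apply Rmult_le_compat_l; [nra|]. apply Rmult_le_compat_l; lra.
  - apply Rle_trans with (q * M * u); [|apply Rmult_le_compat_r; nra].
    replace (q * M * u) with (q * u * M) by ring.
    replace (q * u * _ + _) with (q * u * (Cmod n * (Cmod n + 1) + Cmod l * Cmod n)) by ring.
    apply Rmult_le_compat_l; [nra|]. unfold M.
    assert (0 <= Cmod l * Cmod n) by nra. nra.
Qed.

(** * The complex exponential *)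

Definition cexp (z : C) : C := Cmult (RtoC (exp (Re z))) (expi (Im z)).

Lemma cexp_plus (z w : C) : cexp (Cplus z w) = Cmult (cexp z) (cexp w).
Proof.
  destruct z as [x y], w as [u v]. unfold cexp, expi, Cmult, Cplus, RtoC; simpl.
  rewrite exp_plus, cos_plus, sin_plus. f_equal; ring.
Qed.

Lemma expi_mod (t : R) : Cmod (expi t) = 1.
Proof.
  unfold Cmod, expi; simpl. transitivity (sqrt 1); [f_equal|apply sqrt_1].
  pose proof (sin2_cos2 t) as E. unfold Rsqr in E. lra.
Qed.

Lemma cexp_mod (z : C) : Cmod (cexp z) = exp (Re z).
Proof.
  unfold cexp. rewrite Cmod_mult, expi_mod, Cmod_R, Rabs_pos_eq; [ring|]. left; apply exp_pos.
Qed.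

Lemma cexp_0 : cexp (RtoC 0) = RtoC 1.
Proof.
  unfold cexp, expi, RtoC, Cmult; simpl. rewrite exp_0, cos_0, sin_0. f_equal; ring.
Qed.

Lemma Cmod_le_Rabs (x y : R) : Cmod (x, y) <= Rabs x + Rabs y.
Proof.
  replace ((x, y) : C) with (Cplus (RtoC x) (Cmult Ci (RtoC y))).
  - eapply Rle_trans; [apply Cmod_triangle|]. rewrite Cmod_mult, !Cmod_R, Cmod_Ci. lra.
  - unfold Cplus, Cmult, RtoC, Ci; simpl; f_equal; ring.
Qed.

(** The functional equation transports this derivative at 0 to every point. *)
Lemma cexp_slope_0 (e : R) : 0 < e -> exists d : R, 0 < d /\
  forall w : C, Cmod w < d -> Cmod (Cminus (Cminus (cexp w) (RtoC 1)) w) <= e * Cmod w.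
Proof.
  intros He.
  set (q := Rmin (1 / 2) (e / 8)).
  assert (Hq : 0 < q) by (apply Rmin_pos; lra).
  assert (q1 : q <= 1 / 2) by apply Rmin_l.
  assert (q2 : q <= e / 8) by apply Rmin_r.
  destruct (derivable_pt_lim_exp 0 q Hq) as [d1 K1].
  destruct (derivable_pt_lim_cos 0 q Hq) as [d2 K2].
  destruct (derivable_pt_lim_sin 0 q Hq) as [d3 K3].
  assert (S : forall (f : R -> R) l (d : posreal) h,
     (forall h : R, h <> 0 -> Rabs h < d -> Rabs ((f (0 + h) - f 0) / h - l) < q) ->
     Rabs h < d -> Rabs (f h - f 0 - l * h) <= q * Rabs h).
  { intros f l d h K Hh. destruct (Req_dec h 0) as [->|N].
    - replace (_ - _ - _) with 0 by ring. rewrite Rabs_R0. lra.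
    - specialize (K h N Hh). rewrite Rplus_0_l in K.
      replace (f h - f 0 - l * h) with (((f h - f 0) / h - l) * h) by (field; exact N).
      rewrite Rabs_mult. apply Rmult_le_compat_r; [apply Rabs_pos|lra]. }
  exists (Rmin q (Rmin d1 (Rmin d2 d3))).
  split. { pose proof (cond_pos d1). pose proof (cond_pos d2). pose proof (cond_pos d3).
    repeat apply Rmin_pos; lra. }
  intros [x y] Hw.
  assert (Wq : Cmod (x, y) < q) by (eapply Rlt_le_trans; [exact Hw|apply Rmin_l]).
  assert (W' : Cmod (x, y) < Rmin d1 (Rmin d2 d3)) by (eapply Rlt_le_trans; [exact Hw|apply Rmin_r]).
  assert (W1 : Cmod (x, y) < d1) by (eapply Rlt_le_trans; [exact W'|apply Rmin_l]).
  assert (W'' : Cmod (x, y) < Rmin d2 d3) by (eapply Rlt_le_trans; [exact W'|apply Rmin_r]).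
  assert (W2 : Cmod (x, y) < d2) by (eapply Rlt_le_trans; [exact W''|apply Rmin_l]).
  assert (W3 : Cmod (x, y) < d3) by (eapply Rlt_le_trans; [exact W''|apply Rmin_r]).
  pose proof (re_le_Cmod (x, y)) as Hx. simpl in Hx.
  assert (Hy : Rabs y <= Cmod (x, y)).
  { replace y with (snd (x, y)) by reflexivity. pose proof (Rmax_Cmod (x, y)).
    eapply Rle_trans; [apply Rmax_r|exact H]. }
  pose proof (S exp _ _ x K1 (Rle_lt_trans _ _ _ Hx W1)) as E1.
  pose proof (S cos _ _ y K2 (Rle_lt_trans _ _ _ Hy W2)) as E2.
  pose proof (S sin _ _ y K3 (Rle_lt_trans _ _ _ Hy W3)) as E3.
  rewrite exp_0 in E1. rewrite cos_0, sin_0 in E2. rewrite cos_0, sin_0 in E3.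
  set (m := Cmod (x, y)) in *.
  pose proof (Rabs_pos x). pose proof (Rabs_pos y).
  replace (Cminus (Cminus (cexp (x, y)) 1) (x, y)) with
    ((exp x * (cos y - 1 - (- 0) * y) + (exp x - 1 - 1 * x),
      exp x * (sin y - 0 - 1 * y) + y * (exp x - 1 - 1 * x) + y * x) : C)
   by (unfold cexp, expi, Cminus, Cplus, Copp, Cmult, RtoC; simpl; f_equal; ring).
  eapply Rle_trans; [apply Cmod_le_Rabs|].
  assert (Hexp : 0 < exp x <= 2).
  { split; [apply exp_pos|]. apply Rabs_le_between in E1. pose proof (Rle_abs x). nra. }
  apply Rle_trans with ((2 * (q * Rabs y) + q * Rabs x) + ((2 * (q * Rabs y) + Rabs y * (q * Rabs x)) + Rabs y * Rabs x)).
  - generalize dependent (exp x - 1 - 1 * x). intros p E1.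
    generalize dependent (cos y - 1 - - 0 * y). intros r E2.
    generalize dependent (sin y - 0 - 1 * y). intros t E3.
    assert (T : forall a b : R, 0 < exp x <= 2 -> Rabs b <= a -> Rabs (exp x * b) <= 2 * a).
    { intros a b [He1 He2] Hb. rewrite Rabs_mult, (Rabs_pos_eq (exp x)) by lra.
      pose proof (Rabs_pos b). nra. }
    apply Rplus_le_compat.
    + eapply Rle_trans; [apply Rabs_triang|]. apply Rplus_le_compat; [apply T; assumption|exact E1].
    + eapply Rle_trans; [apply Rabs_triang|].
      apply Rplus_le_compat; [|rewrite Rabs_mult; lra].
      eapply Rle_trans; [apply Rabs_triang|].
      apply Rplus_le_compat; [apply T; assumption|].
      rewrite Rabs_mult. apply Rmult_le_compat_l; [lra|exact E1].
  - assert (Pyx : Rabs y * Rabs x <= q * m).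
    { rewrite (Rmult_comm q). apply Rmult_le_compat; lra. }
    assert (Py : q * Rabs y <= q * m) by (apply Rmult_le_compat_l; lra).
    assert (Px : q * Rabs x <= q * m) by (apply Rmult_le_compat_l; lra).
    assert (Pyqx : Rabs y * (q * Rabs x) <= q * m) by nra.
    assert (q * m <= e / 8 * m) by (apply Rmult_le_compat_r; lra).
    assert (0 <= q * m) by (apply Rmult_le_pos; lra).
    lra.
Qed.

Lemma Cderiv_cexp (al z : C) : Cderiv (fun w => cexp (Cmult al w)) z (Cmult al (cexp (Cmult al z))).
Proof.
  apply Cderiv_eps. intros e He.
  set (M := (Cmod (cexp (Cmult al z)) * Cmod al) + 1).
  pose proof (Cmod_ge_0 (cexp (Cmult al z))). pose proof (Cmod_ge_0 al) as Ha.
  assert (HM : 0 < M) by (unfold M; nra).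
  destruct (cexp_slope_0 (e / M)) as [d [Hd K]]; [apply Rdiv_lt_0_compat; lra|].
  exists (d / (Cmod al + 1)). split; [apply Rdiv_lt_0_compat; lra|]. intros w Hw.
  set (u := Cminus w z) in *.
  replace (Cmult al w) with (Cplus (Cmult al z) (Cmult al u)) by (unfold u; ring).
  rewrite cexp_plus.
  replace (Cminus _ _) with (Cmult (cexp (Cmult al z)) (Cminus (Cminus (cexp (Cmult al u)) 1) (Cmult al u))) by ring.
  rewrite Cmod_mult. pose proof (Cmod_ge_0 u) as Hu.
  assert (Ku : Cmod (Cmult al u) < d).
  { rewrite Cmod_mult. assert (d / (Cmod al + 1) * (Cmod al + 1) = d) by (field; lra). nra. }
  specialize (K _ Ku). rewrite Cmod_mult in K.
  eapply Rle_trans; [apply Rmult_le_compat_l; [apply Cmod_ge_0|exact K]|].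
  assert (0 < e / M) by (apply Rdiv_lt_0_compat; lra).
  assert (E : e / M * M = e) by (field; lra).
  rewrite <- E at 2. unfold M at 3.
  replace (_ * (e / M * _)) with (e / M * (Cmod (cexp (Cmult al z)) * Cmod al) * Cmod u) by ring.
  apply Rmult_le_compat_r; auto. apply Rmult_le_compat_l; lra.
Qed.

(** * Contour integrals over rectangles *)

Lemma RCcont_row (H : C -> C) (x y : R) : Ccont H (x, y) -> RCcont (fun t => H (t, y)) x.
Proof.
  intros K. apply (filterlim_comp _ _ _ (fun t : R => (t, y) : C) H _ _ _) with (2 := K).
  intros P [e He]. exists e. intros t Ht. apply He. split; [exact Ht|apply ball_center].
Qed.

Lemma RCcont_col (H : C -> C) (x y : R) : Ccont H (x, y) -> RCcont (fun t => H (x, t)) y.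
Proof.
  intros K. apply (filterlim_comp _ _ _ (fun t : R => (x, t) : C) H _ _ _) with (2 := K).
  intros P [e He]. exists e. intros t Ht. apply He. split; [apply ball_center|exact Ht].
Qed.

Lemma ex_cint_cont (h : R -> C) (a b : R) :
  a <= b -> (forall x, a <= x <= b -> RCcont h x) -> ex_cint h a b.
Proof.
  intros L K. apply (ex_RInt_continuous (V := C_R_CompleteNormedModule)).
  intros x Hx. rewrite Rmin_left, Rmax_right in Hx by exact L. exact (K x Hx).
Qed.

Lemma cint_plus (g h : R -> C) (a b : R) : ex_cint g a b -> ex_cint h a b ->
  cint (fun t => Cplus (g t) (h t)) a b = Cplus (cint g a b) (cint h a b).
Proof. exact (RInt_plus (V := C_R_CompleteNormedModule) g h a b). Qed.

Lemma ex_cint_plus (g h : R -> C) (a b : R) : ex_cint g a b -> ex_cint h a b ->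
  ex_cint (fun t => Cplus (g t) (h t)) a b.
Proof. exact (ex_RInt_plus (V := C_R_NormedModule) g h a b). Qed.

Lemma ex_cint_minus (g h : R -> C) (a b : R) : ex_cint g a b -> ex_cint h a b ->
  ex_cint (fun t => Cminus (g t) (h t)) a b.
Proof. exact (ex_RInt_minus (V := C_R_NormedModule) g h a b). Qed.

Lemma cint_minus (g h : R -> C) (a b : R) : ex_cint g a b -> ex_cint h a b ->
  cint (fun t => Cminus (g t) (h t)) a b = Cminus (cint g a b) (cint h a b).
Proof. exact (RInt_minus (V := C_R_CompleteNormedModule) g h a b). Qed.

Lemma is_cint_pair (h : R -> C) (a b : R) (l : C) :
  is_RInt (V := C_R_NormedModule) h a b l <->
  is_RInt (fun t => Re (h t)) a b (Re l) /\ is_RInt (fun t => Im (h t)) a b (Im l).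
Proof.
  split.
  - intros K. split.
    + exact (is_RInt_fct_extend_fst (U := R_NormedModule) (V := R_NormedModule) h a b l K).
    + exact (is_RInt_fct_extend_snd (U := R_NormedModule) (V := R_NormedModule) h a b l K).
  - intros [K1 K2]. rewrite (surjective_pairing l).
    exact (is_RInt_fct_extend_pair (U := R_NormedModule) (V := R_NormedModule) h a b _ _ K1 K2).
Qed.

(** The scalars of [C_R_NormedModule] are real, so a complex factor has to pass
    through the real and imaginary parts. *)
Lemma is_cint_mult_l (h : R -> C) (c : C) (a b : R) (l : C) :
  is_RInt (V := C_R_NormedModule) h a b l ->
  is_RInt (V := C_R_NormedModule) (fun t => Cmult c (h t)) a b (Cmult c l).
Proof.
  rewrite !is_cint_pair. intros [K1 K2]. destruct c as [u v]. split; simpl.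
  - apply (is_RInt_minus (V := R_NormedModule) (fun t => u * Re (h t)) (fun t => v * Im (h t)));
    apply (is_RInt_scal (V := R_NormedModule)); assumption.
  - apply (is_RInt_plus (V := R_NormedModule) (fun t => u * Im (h t)) (fun t => v * Re (h t)));
    apply (is_RInt_scal (V := R_NormedModule)); assumption.
Qed.

Lemma ex_cint_mult_l (h : R -> C) (c : C) (a b : R) :
  ex_cint h a b -> ex_cint (fun t => Cmult c (h t)) a b.
Proof. intros [l K]. exists (Cmult c l). apply is_cint_mult_l, K. Qed.

Lemma cint_mult_l (h : R -> C) (c : C) (a b : R) :
  ex_cint h a b -> cint (fun t => Cmult c (h t)) a b = Cmult c (cint h a b).
Proof.
  intros K. apply (is_RInt_unique (V := C_R_CompleteNormedModule)). apply is_cint_mult_l.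
  exact (RInt_correct (V := C_R_CompleteNormedModule) h a b K).
Qed.

Lemma cint_Chasles (h : R -> C) (a b c : R) : ex_cint h a b -> ex_cint h b c ->
  Cplus (cint h a b) (cint h b c) = cint h a c.
Proof. exact (RInt_Chasles (V := C_R_CompleteNormedModule) h a b c). Qed.

Lemma cint_ext (g h : R -> C) (a b : R) : a <= b ->
  (forall x, a <= x <= b -> g x = h x) -> cint g a b = cint h a b.
Proof.
  intros L K. apply (RInt_ext (V := C_R_CompleteNormedModule)).
  intros x Hx. rewrite Rmin_left, Rmax_right in Hx by exact L. apply K. lra.
Qed.

Lemma Cmod_cint_le (h : R -> C) (g : R -> R) (a b : R) : a <= b ->
  ex_cint h a b -> ex_RInt g a b -> (forall x, a <= x <= b -> Cmod (h x) <= g x) ->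
  Cmod (cint h a b) <= RInt g a b.
Proof.
  intros L Kh Kg B. rewrite Cmod_norm.
  assert (B' : forall x, a <= x <= b -> norm (V := C_R_NormedModule) (h x) <= g x).
  { intros x Hx. rewrite <- Cmod_norm. exact (B x Hx). }
  exact (norm_RInt_le (V := C_R_NormedModule) h g a b _ _ L B'
    (RInt_correct (V := C_R_CompleteNormedModule) h a b Kh)
    (RInt_correct (V := R_CompleteNormedModule) g a b Kg)).
Qed.

Lemma Cmod_cint_le_const (h : R -> C) (M : R) (a b : R) : a <= b ->
  ex_cint h a b -> (forall x, a <= x <= b -> Cmod (h x) <= M) ->
  Cmod (cint h a b) <= (b - a) * M.
Proof.
  intros L Kh B. eapply Rle_trans.
  - apply (Cmod_cint_le h (fun _ => M)); auto. apply ex_RInt_const.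
  - right. rewrite RInt_const. reflexivity.
Qed.

(** The contour is counterclockwise when [x0 <= x1] and [y0 <= y1]. *)
Definition Rect (H : C -> C) (x0 x1 y0 y1 : R) : C :=
  Cminus
    (Cplus (cint (fun x => H (x, y0)) x0 x1) (Cmult Ci (cint (fun y => H (x1, y)) y0 y1)))
    (Cplus (cint (fun x => H (x, y1)) x0 x1) (Cmult Ci (cint (fun y => H (x0, y)) y0 y1))).

Definition in_rect (x0 x1 y0 y1 : R) (z : C) : Prop :=
  x0 <= Re z <= x1 /\ y0 <= Im z <= y1.

Definition frame (x0 x1 y0 y1 : R) (z : C) : Prop :=
  in_rect x0 x1 y0 y1 z /\ (Re z = x0 \/ Re z = x1 \/ Im z = y0 \/ Im z = y1).

Section Sides.
Variables x0 x1 y0 y1 : R.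
Hypothesis Lx : x0 <= x1.
Hypothesis Ly : y0 <= y1.

Lemma frame_bot x : x0 <= x <= x1 -> frame x0 x1 y0 y1 (x, y0).
Proof. unfold frame, in_rect; simpl; intuition lra. Qed.
Lemma frame_top x : x0 <= x <= x1 -> frame x0 x1 y0 y1 (x, y1).
Proof. unfold frame, in_rect; simpl; intuition lra. Qed.
Lemma frame_left y : y0 <= y <= y1 -> frame x0 x1 y0 y1 (x0, y).
Proof. unfold frame, in_rect; simpl; intuition lra. Qed.
Lemma frame_right y : y0 <= y <= y1 -> frame x0 x1 y0 y1 (x1, y).
Proof. unfold frame, in_rect; simpl; intuition lra. Qed.
Hint Resolve frame_bot frame_top frame_left frame_right : core.

Lemma ex_cint_sides (H : C -> C) :
  (forall z, frame x0 x1 y0 y1 z -> Ccont H z) ->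
  ex_cint (fun x => H (x, y0)) x0 x1 /\ ex_cint (fun y => H (x1, y)) y0 y1 /\
  ex_cint (fun x => H (x, y1)) x0 x1 /\ ex_cint (fun y => H (x0, y)) y0 y1.
Proof.
  intros K. repeat split; apply ex_cint_cont; auto; intros t Ht;
    (apply RCcont_row || apply RCcont_col); apply K; auto.
Qed.

Lemma Rect_ext (G H : C -> C) :
  (forall z, frame x0 x1 y0 y1 z -> G z = H z) -> Rect G x0 x1 y0 y1 = Rect H x0 x1 y0 y1.
Proof.
  intros K. unfold Rect.
  repeat match goal with |- context [cint ?g ?a ?b] =>
    match g with context [G] => idtac end;
    let h := eval pattern G in g in
    match h with ?k G => rewrite (cint_ext g (k H) a b) by (auto; intros; cbv beta; auto) end end.
  reflexivity.
Qed.

Lemma Rect_plus (G H : C -> C) :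
  (forall z, frame x0 x1 y0 y1 z -> Ccont G z) ->
  (forall z, frame x0 x1 y0 y1 z -> Ccont H z) ->
  Rect (fun w => Cplus (G w) (H w)) x0 x1 y0 y1 = Cplus (Rect G x0 x1 y0 y1) (Rect H x0 x1 y0 y1).
Proof.
  intros KG KH. apply ex_cint_sides in KG. apply ex_cint_sides in KH.
  destruct KG as (? & ? & ? & ?), KH as (? & ? & ? & ?).
  unfold Rect. rewrite !cint_plus by assumption. ring.
Qed.

Lemma Rect_minus (G H : C -> C) :
  (forall z, frame x0 x1 y0 y1 z -> Ccont G z) ->
  (forall z, frame x0 x1 y0 y1 z -> Ccont H z) ->
  Rect (fun w => Cminus (G w) (H w)) x0 x1 y0 y1 = Cminus (Rect G x0 x1 y0 y1) (Rect H x0 x1 y0 y1).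
Proof.
  intros KG KH. apply ex_cint_sides in KG. apply ex_cint_sides in KH.
  destruct KG as (? & ? & ? & ?), KH as (? & ? & ? & ?).
  unfold Rect. rewrite !cint_minus by assumption. ring.
Qed.

Lemma Rect_mult_l (c : C) (H : C -> C) :
  (forall z, frame x0 x1 y0 y1 z -> Ccont H z) ->
  Rect (fun w => Cmult c (H w)) x0 x1 y0 y1 = Cmult c (Rect H x0 x1 y0 y1).
Proof.
  intros KH. apply ex_cint_sides in KH. destruct KH as (? & ? & ? & ?).
  unfold Rect. rewrite !cint_mult_l by assumption. ring.
Qed.

Lemma Rect_bound (H : C -> C) (M : R) :
  (forall z, frame x0 x1 y0 y1 z -> Ccont H z) ->
  (forall z, frame x0 x1 y0 y1 z -> Cmod (H z) <= M) ->
  Cmod (Rect H x0 x1 y0 y1) <= 2 * ((x1 - x0) + (y1 - y0)) * M.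
Proof.
  intros KH B. apply ex_cint_sides in KH. destruct KH as (K1 & K2 & K3 & K4).
  apply (Cmod_cint_le_const _ M) in K1; auto.
  apply (Cmod_cint_le_const _ M) in K2; auto.
  apply (Cmod_cint_le_const _ M) in K3; auto.
  apply (Cmod_cint_le_const _ M) in K4; auto.
  unfold Rect, Cminus.
  eapply Rle_trans; [apply Cmod_triangle|]. rewrite Cmod_opp.
  assert (T : forall a b, Cmod (Cplus a (Cmult Ci b)) <= Cmod a + Cmod b).
  { intros a b. eapply Rle_trans; [apply Cmod_triangle|]. rewrite Cmod_mult, Cmod_Ci. lra. }
  eapply Rle_trans; [apply Rplus_le_compat; apply T|]. lra.
Qed.

Lemma cint_row_FTC (F H : C -> C) (y : R) :
  (forall x, x0 <= x <= x1 -> Cderiv F (x, y) (H (x, y)) /\ Ccont H (x, y)) ->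
  cint (fun x => H (x, y)) x0 x1 = Cminus (F (x1, y)) (F (x0, y)).
Proof.
  intros K. apply (is_RInt_unique (V := C_R_CompleteNormedModule)).
  apply (is_RInt_derive (V := C_R_CompleteNormedModule) (fun x => F (x, y)) (fun x => H (x, y))).
  - intros x Hx. rewrite Rmin_left, Rmax_right in Hx by exact Lx.
    destruct (K x Hx) as [D _]. split; [apply is_linear_scal_l|].
    intros u Hu. assert (x = u) by (apply is_filter_lim_locally_unique; exact Hu). subst u.
    intros e. destruct (proj1 (Cderiv_eps F (x, y) _) D e (cond_pos e)) as [d [Hd De]].
    exists (mkposreal d Hd). intros t Ht.
    specialize (De (t, y)).
    assert (E : Cminus (t, y) (x, y) = RtoC (t - x)).
    { unfold Cminus, Cplus, Copp, RtoC; simpl; f_equal; ring. }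
    rewrite E, Cmod_R in De. specialize (De Ht).
    eapply Rle_trans; [right; symmetry; apply Cmod_norm|].
    change (Cmod (Cminus (Cminus (F (t, y)) (F (x, y))) (scal (V := C_R_ModuleSpace) (t - x) (H (x, y)))) <= e * Rabs (t - x)).
    rewrite scal_R_Cmult, Cmult_comm. exact De.
  - intros x Hx. rewrite Rmin_left, Rmax_right in Hx by exact Lx.
    apply RCcont_row, K, Hx.
Qed.

Lemma cint_col_FTC (F H : C -> C) (x : R) :
  (forall y, y0 <= y <= y1 -> Cderiv F (x, y) (H (x, y)) /\ Ccont H (x, y)) ->
  Cmult Ci (cint (fun y => H (x, y)) y0 y1) = Cminus (F (x, y1)) (F (x, y0)).
Proof.
  intros K.
  assert (EX : ex_cint (fun y => H (x, y)) y0 y1).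
  { apply ex_cint_cont; auto. intros y Hy. apply RCcont_col, K, Hy. }
  rewrite <- cint_mult_l by exact EX.
  apply (is_RInt_unique (V := C_R_CompleteNormedModule)).
  apply (is_RInt_derive (V := C_R_CompleteNormedModule) (fun y => F (x, y)) (fun y => Cmult Ci (H (x, y)))).
  - intros y Hy. rewrite Rmin_left, Rmax_right in Hy by exact Ly.
    destruct (K y Hy) as [D _]. split; [apply is_linear_scal_l|].
    intros u Hu. assert (y = u) by (apply is_filter_lim_locally_unique; exact Hu). subst u.
    intros e. destruct (proj1 (Cderiv_eps F (x, y) _) D e (cond_pos e)) as [d [Hd De]].
    exists (mkposreal d Hd). intros t Ht.
    specialize (De (x, t)).
    assert (E : Cminus (x, t) (x, y) = Cmult Ci (RtoC (t - y))).
    { unfold Cminus, Cplus, Copp, Cmult, Ci, RtoC; simpl; f_equal; ring. }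
    rewrite E, Cmod_mult, Cmod_Ci, Cmod_R, Rmult_1_l in De. specialize (De Ht).
    eapply Rle_trans; [right; symmetry; apply Cmod_norm|].
    change (Cmod (Cminus (Cminus (F (x, t)) (F (x, y))) (scal (V := C_R_ModuleSpace) (t - y) (Cmult Ci (H (x, y))))) <= e * Rabs (t - y)).
    rewrite scal_R_Cmult.
    replace (Cmult (t - y)%R (Cmult Ci (H (x, y)))) with (Cmult (H (x, y)) (Cmult Ci (t - y)%R)) by ring.
    exact De.
  - intros y Hy. rewrite Rmin_left, Rmax_right in Hy by exact Ly.
    apply (filterlim_Cmult (locally y)); [apply filterlim_const|]. apply RCcont_col, K, Hy.
Qed.

Lemma Rect_FTC (F H : C -> C) :
  (forall z, frame x0 x1 y0 y1 z -> Cderiv F z (H z) /\ Ccont H z) ->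
  Rect H x0 x1 y0 y1 = RtoC 0.
Proof.
  intros K. unfold Rect.
  rewrite !(cint_row_FTC F), !(cint_col_FTC F) by auto. ring.
Qed.

Lemma Rect_split_h (H : C -> C) (m : R) : y0 <= m <= y1 ->
  ex_cint (fun y => H (x0, y)) y0 y1 -> ex_cint (fun y => H (x1, y)) y0 y1 ->
  Rect H x0 x1 y0 y1 = Cplus (Rect H x0 x1 y0 m) (Rect H x0 x1 m y1).
Proof.
  intros Hm E0 E1. unfold Rect.
  rewrite <- (cint_Chasles (fun y => H (x1, y)) y0 m y1), <- (cint_Chasles (fun y => H (x0, y)) y0 m y1).
  - ring.
  - exact (ex_RInt_Chasles_1 (V := C_R_CompleteNormedModule) _ _ _ _ Hm E0).
  - exact (ex_RInt_Chasles_2 (V := C_R_CompleteNormedModule) _ _ _ _ Hm E0).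
  - exact (ex_RInt_Chasles_1 (V := C_R_CompleteNormedModule) _ _ _ _ Hm E1).
  - exact (ex_RInt_Chasles_2 (V := C_R_CompleteNormedModule) _ _ _ _ Hm E1).
Qed.

Lemma Rect_split_v (H : C -> C) (m : R) : x0 <= m <= x1 ->
  ex_cint (fun x => H (x, y0)) x0 x1 -> ex_cint (fun x => H (x, y1)) x0 x1 ->
  Rect H x0 x1 y0 y1 = Cplus (Rect H x0 m y0 y1) (Rect H m x1 y0 y1).
Proof.
  intros Hm E0 E1. unfold Rect.
  rewrite <- (cint_Chasles (fun x => H (x, y0)) x0 m x1), <- (cint_Chasles (fun x => H (x, y1)) x0 m x1).
  - ring.
  - exact (ex_RInt_Chasles_1 (V := C_R_CompleteNormedModule) _ _ _ _ Hm E1).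
  - exact (ex_RInt_Chasles_2 (V := C_R_CompleteNormedModule) _ _ _ _ Hm E1).
  - exact (ex_RInt_Chasles_1 (V := C_R_CompleteNormedModule) _ _ _ _ Hm E0).
  - exact (ex_RInt_Chasles_2 (V := C_R_CompleteNormedModule) _ _ _ _ Hm E0).
Qed.
End Sides.

(** * Goursat's lemma and Cauchy's theorem *)

(** Repeated choice of a quarter: the lower left corners increase, the upper
    right corners decrease, and completeness gives a point common to all
    cells. *)
Lemma nested_cells (a b x0 y0 : R) (Q : R -> R -> nat -> Prop) :
  0 <= a -> 0 <= b -> Q x0 y0 0%nat ->
  (forall x y n, Q x y n -> exists x' y', Q x' y' (S n) /\
     (x' = x \/ x' = x + a / 2 ^ S n) /\ (y' = y \/ y' = y + b / 2 ^ S n)) ->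
  exists p q, forall n, exists x y, Q x y n /\
     x0 <= x <= p /\ p <= x + a / 2 ^ n <= x0 + a /\
     y0 <= y <= q /\ q <= y + b / 2 ^ n <= y0 + b.
Proof.
  intros Ha Hb Q0 Step.
  assert (Half : forall c n, c / 2 ^ n = c / 2 ^ S n + c / 2 ^ S n).
  { intros c n. simpl. field. apply pow_nonzero. lra. }
  assert (Pos : forall c n, 0 <= c -> 0 <= c / 2 ^ n).
  { intros c n Hc. apply Rdiv_le_0_compat; [exact Hc|apply pow_lt; lra]. }
  set (St := fun n => {xy : R * R | Q (fst xy) (snd xy) n}).
  assert (next : forall n (s : St n), {s' : St (S n) |
     (fst (proj1_sig s') = fst (proj1_sig s) \/ fst (proj1_sig s') = fst (proj1_sig s) + a / 2 ^ S n) /\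
     (snd (proj1_sig s') = snd (proj1_sig s) \/ snd (proj1_sig s') = snd (proj1_sig s) + b / 2 ^ S n)}).
  { intros n [[x y] K]. apply constructive_indefinite_description.
    destruct (Step x y n K) as (x' & y' & K' & D). exists (exist _ (x', y') K'). exact D. }
  set (s := nat_rect St (exist _ (x0, y0) Q0) (fun n t => proj1_sig (next n t))).
  set (x := fun n => fst (proj1_sig (s n))). set (y := fun n => snd (proj1_sig (s n))).
  assert (Hs : forall n, (x (S n) = x n \/ x (S n) = x n + a / 2 ^ S n) /\
                         (y (S n) = y n \/ y (S n) = y n + b / 2 ^ S n)).
  { intros n. exact (proj2_sig (next n (s n))). }
  assert (N : forall (c u0 : R) (u : nat -> R), 0 <= c -> u 0%nat = u0 ->
     (forall n, u (S n) = u n \/ u (S n) = u n + c / 2 ^ S n) ->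
     exists p, forall n, u0 <= u n <= p /\ p <= u n + c / 2 ^ n <= u0 + c).
  { intros c u0 u Hc U0 Hu.
    assert (M : forall n k, u n <= u (n + k)%nat /\ u (n + k)%nat + c / 2 ^ (n + k) <= u n + c / 2 ^ n).
    { intros n. induction k; [rewrite Nat.add_0_r; lra|].
      rewrite Nat.add_succ_r. rewrite (Half c (n + k)%nat) in IHk.
      pose proof (Pos c (S (n + k)) Hc). destruct (Hu (n + k)%nat) as [E|E]; rewrite E; lra. }
    assert (NN : forall n m, u n <= u m + c / 2 ^ m).
    { intros n m. pose proof (Pos c n Hc). pose proof (Pos c m Hc).
      destruct (le_lt_dec n m) as [L|L].
      - destruct (M n (m - n)%nat) as [A _]. replace (n + (m - n))%nat with m in A by lia. lra.
      - destruct (M m (n - m)%nat) as [_ A]. replace (m + (n - m))%nat with n in A by lia. lra. }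
    destruct (completeness (fun r => exists n, r = u n)) as [p [Up Lp]].
    - exists (u 0%nat + c / 2 ^ 0). intros r [n ->]. apply NN.
    - exists (u 0%nat), 0%nat. reflexivity.
    - exists p. intros n. destruct (M 0%nat n) as [M1 M2]. simpl in M1, M2.
      rewrite U0 in *. split; split.
      + exact M1.
      + apply Up. exists n; reflexivity.
      + apply Lp. intros r [m ->]. apply NN.
      + lra. }
  destruct (N a x0 x Ha eq_refl (fun n => proj1 (Hs n))) as [p Hp].
  destruct (N b y0 y Hb eq_refl (fun n => proj2 (Hs n))) as [q Hq].
  exists p, q. intros n. exists (x n), (y n). split; [exact (proj2_sig (s n))|].
  specialize (Hp n). specialize (Hq n). tauto.
Qed.

Lemma Cderiv_eq (H : C -> C) (z l m : C) : Cderiv H z l -> l = m -> Cderiv H z m.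
Proof. intros D <-. exact D. Qed.

Lemma Cderiv_affine (c l z : C) : Cderiv (fun w => Cplus c (Cmult l w)) z l.
Proof.
  eapply Cderiv_eq.
  - apply Cderiv_plus; [apply Cderiv_const|]. apply Cderiv_mult; [apply Cderiv_const|apply Cderiv_id].
  - cbv beta. ring.
Qed.

Lemma RtoC_neq_0 (r : R) : r <> 0 -> RtoC r <> RtoC 0.
Proof. intros Hr E. apply Hr. exact (RtoC_inj _ _ E). Qed.

Lemma Rect_affine (c l : C) (x0 x1 y0 y1 : R) : x0 <= x1 -> y0 <= y1 ->
  Rect (fun w => Cplus c (Cmult l w)) x0 x1 y0 y1 = RtoC 0.
Proof.
  intros Lx Ly.
  apply (Rect_FTC _ _ _ _ Lx Ly (fun w => Cplus (Cmult c w) (Cmult (Cdiv l (RtoC 2)) (Cmult w w)))).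
  intros z _. split.
  - eapply Cderiv_eq.
    + apply Cderiv_plus; apply Cderiv_mult; [apply Cderiv_const|apply Cderiv_id|apply Cderiv_const|].
      apply Cderiv_mult; apply Cderiv_id.
    + cbv beta. field.
  - exact (Cderiv_cont _ _ _ (Cderiv_affine c l z)).
Qed.

Lemma Cmod_zero_of_le (z : C) (K : R) : (forall e, 0 < e -> Cmod z <= e * K) -> z = RtoC 0.
Proof.
  intros B. apply Cmod_eq_0.
  destruct (Rle_lt_or_eq_dec 0 (Cmod z) (Cmod_ge_0 z)) as [P|P]; [|auto].
  pose proof (Rabs_pos K). pose proof (Rle_abs K).
  specialize (B (Cmod z / (2 * (Rabs K + 1)))).
  assert (Q : 0 < Cmod z / (2 * (Rabs K + 1))) by (apply Rdiv_lt_0_compat; lra).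
  specialize (B Q).
  assert (Cmod z / (2 * (Rabs K + 1)) * (2 * (Rabs K + 1)) = Cmod z) by (field; lra).
  nra.
Qed.

Lemma Rect_quarter (H : C -> C) (x0 xm x1 y0 ym y1 : R) :
  x0 <= xm <= x1 -> y0 <= ym <= y1 ->
  (forall z, in_rect x0 x1 y0 y1 z -> Ccont H z) ->
  Rect H x0 x1 y0 y1 = Cplus (Cplus (Rect H x0 xm y0 ym) (Rect H xm x1 y0 ym))
     (Cplus (Rect H x0 xm ym y1) (Rect H xm x1 ym y1)).
Proof.
  intros Lx Ly K.
  assert (Row : forall y, y0 <= y <= y1 -> ex_cint (fun x => H (x, y)) x0 x1).
  { intros y Hy. apply ex_cint_cont; [lra|]. intros x Hx. apply RCcont_row, K. split; simpl; lra. }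
  assert (Col : forall x, x0 <= x <= x1 -> ex_cint (fun y => H (x, y)) y0 y1).
  { intros x Hx. apply ex_cint_cont; [lra|]. intros y Hy. apply RCcont_col, K. split; simpl; lra. }
  rewrite (Rect_split_h _ _ _ _ H ym Ly) by (apply Col; lra).
  rewrite (Rect_split_v x0 x1 y0 ym H xm Lx), (Rect_split_v x0 x1 ym y1 H xm Lx) by (apply Row; lra).
  reflexivity.
Qed.

(** The bound [e * (2 * s * s)], with [s] the sum of the side lengths, is
    additive under quartering. If it failed it would fail along nested
    quarters shrinking to a point; near that point [H] is its affine part,
    whose contour integral vanishes, up to [e] times the distance. *)
Theorem Goursat (H : C -> C) (x0 x1 y0 y1 : R) : x0 <= x1 -> y0 <= y1 ->
  (forall z, in_rect x0 x1 y0 y1 z -> Cdiffable H z) ->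
  Rect H x0 x1 y0 y1 = RtoC 0.
Proof.
  intros Lx Ly D.
  assert (K : forall z, in_rect x0 x1 y0 y1 z -> Ccont H z).
  { intros z Hz. apply ex_Cderiv_cont, D, Hz. }
  set (a := x1 - x0). set (b := y1 - y0). set (s := a + b).
  assert (Ha : 0 <= a) by (unfold a; lra). assert (Hb : 0 <= b) by (unfold b; lra).
  apply Cmod_zero_of_le with (2 * s * s). intros e He.
  apply Rnot_lt_le. intros Bad.
  destruct (nested_cells a b x0 y0 (fun x y n =>
    (x0 <= x /\ x + a / 2 ^ n <= x1 /\ y0 <= y /\ y + b / 2 ^ n <= y1) /\
    e * (2 * (s / 2 ^ n) * (s / 2 ^ n)) < Cmod (Rect H x (x + a / 2 ^ n) y (y + b / 2 ^ n))))
   as (p & q & Cell); auto.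
  - simpl. replace (s / 1) with s by field. replace (x0 + a / 1) with x1 by (unfold a; field).
    replace (y0 + b / 1) with y1 by (unfold b; field). split; [lra|exact Bad].
  - intros x y n [In Bxy].
    assert (Half : forall c, c / 2 ^ n = c / 2 ^ S n + c / 2 ^ S n).
    { intros c. simpl. field. apply pow_nonzero. lra. }
    assert (Pos : forall c, 0 <= c -> 0 <= c / 2 ^ S n).
    { intros c Hc. apply Rdiv_le_0_compat; [exact Hc|apply pow_lt; lra]. }
    pose proof (Pos a Ha) as Pa. pose proof (Pos b Hb) as Pb.
    rewrite (Half a), (Half b), (Half s) in *.
    set (a' := a / 2 ^ S n) in *. set (b' := b / 2 ^ S n) in *. set (s' := s / 2 ^ S n) in *.
    rewrite (Rect_quarter H x (x + a') _ y (y + b')) in Bxy; try lra.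
    2: { intros z [Z1 Z2]. apply K. split; lra. }
    replace (x + (a' + a')) with (x + a' + a') in * by ring.
    replace (y + (b' + b')) with (y + b' + b') in * by ring.
    destruct (Rlt_dec (e * (2 * s' * s')) (Cmod (Rect H x (x + a') y (y + b')))) as [B|B1].
    { exists x, y. intuition lra. }
    destruct (Rlt_dec (e * (2 * s' * s')) (Cmod (Rect H (x + a') (x + a' + a') y (y + b')))) as [B|B2].
    { exists (x + a'), y. intuition lra. }
    destruct (Rlt_dec (e * (2 * s' * s')) (Cmod (Rect H x (x + a') (y + b') (y + b' + b')))) as [B|B3].
    { exists x, (y + b'). intuition lra. }
    destruct (Rlt_dec (e * (2 * s' * s')) (Cmod (Rect H (x + a') (x + a' + a') (y + b') (y + b' + b')))) as [B|B4].
    { exists (x + a'), (y + b'). intuition lra. }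
    exfalso. apply (Rlt_not_le _ _ Bxy).
    eapply Rle_trans; [apply Cmod_triangle|].
    eapply Rle_trans; [apply Rplus_le_compat; apply Cmod_triangle|]. lra.
  - assert (Hpq : in_rect x0 x1 y0 y1 (p, q)).
    { destruct (Cell 0%nat) as (x & y & [In _] & B). simpl in *. split; simpl; lra. }
    destruct (D _ Hpq) as [l Dl].
    destruct (proj1 (Cderiv_eps H (p, q) l) Dl e He) as [d [Hd Kd]].
    assert (Hn : exists n, s / 2 ^ n < d).
    { destruct (pow_lt_1_zero (/ 2) ltac:(rewrite Rabs_pos_eq; lra) (d / (s + 1))) as [n Hn].
      - apply Rdiv_lt_0_compat; unfold s; lra.
      - exists n. specialize (Hn n (le_n n)). rewrite pow_inv in Hn.
        assert (P : 0 < / 2 ^ n) by (apply Rinv_0_lt_compat, pow_lt; lra).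
        rewrite Rabs_pos_eq in Hn by lra.
        assert (E : d / (s + 1) * (s + 1) = d) by (field; unfold s; lra).
        unfold Rdiv at 1. assert (0 <= s) by (unfold s; lra). nra. }
    destruct Hn as [n Hn]. destruct (Cell n) as (x & y & [In B] & Px & Px' & Py & Py').
    apply (Rlt_not_le _ _ B). clear B.
    set (A := fun w => Cplus (Cminus (H (p, q)) (Cmult l (p, q))) (Cmult l w)).
    assert (KA : forall z, Ccont A z).
    { intros z. exact (Cderiv_cont _ _ _ (Cderiv_affine _ _ z)). }
    assert (Fr : forall z, frame x (x + a / 2 ^ n) y (y + b / 2 ^ n) z ->
       in_rect x0 x1 y0 y1 z /\ Cmod (Cminus z (p, q)) <= s / 2 ^ n).
    { intros [u v] [[Zx Zy] _]. simpl in Zx, Zy. split; [split; simpl; lra|].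
      change (Cminus (u, v) (p, q)) with ((u - p, v - q) : C).
      eapply Rle_trans; [apply Cmod_le_Rabs|].
      replace (s / 2 ^ n) with (a / 2 ^ n + b / 2 ^ n) by (unfold s; field; apply pow_nonzero; lra).
      apply Rplus_le_compat; apply Rabs_le; lra. }
    assert (E : Rect H x (x + a / 2 ^ n) y (y + b / 2 ^ n) =
       Rect (fun w => Cminus (H w) (A w)) x (x + a / 2 ^ n) y (y + b / 2 ^ n)).
    { rewrite Rect_minus; try lra.
      - unfold A. rewrite Rect_affine by lra. ring.
      - intros z Hz. apply K, Fr, Hz.
      - intros z _. apply KA. }
    rewrite E.
    replace (e * (2 * (s / 2 ^ n) * (s / 2 ^ n))) with
       (2 * ((x + a / 2 ^ n - x) + (y + b / 2 ^ n - y)) * (e * (s / 2 ^ n)))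
      by (unfold s; field; apply pow_nonzero; lra).
    apply Rect_bound; try lra.
    + intros z Hz. apply Ccont_minus; [apply K, Fr, Hz|apply KA].
    + intros z Hz. destruct (Fr z Hz) as [_ Z].
      unfold A. replace (Cminus _ _) with (Cminus (Cminus (H z) (H (p, q))) (Cmult l (Cminus z (p, q)))) by ring.
      eapply Rle_trans; [apply Kd; lra|]. apply Rmult_le_compat_l; lra.
Qed.

Lemma Rect_flat (H : C -> C) (x0 x1 y : R) : Rect H x0 x1 y y = RtoC 0.
Proof.
  unfold Rect. rewrite !(RInt_point (V := C_R_CompleteNormedModule)).
  change (zero (G := C_R_CompleteNormedModule)) with (RtoC 0). ring.
Qed.

Lemma unif_cont_rect (H : C -> C) (x0 x1 y0 y1 e : R) :
  (forall z, in_rect x0 x1 y0 y1 z -> Ccont H z) -> 0 < e ->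
  exists d, 0 < d /\ forall z w, in_rect x0 x1 y0 y1 z -> in_rect x0 x1 y0 y1 w ->
    Rabs (Re w - Re z) < d -> Rabs (Im w - Im z) < d -> Cmod (Cminus (H w) (H z)) < e.
Proof.
  intros K He.
  assert (U : forall part : C -> R, (forall z, Rabs (part z) <= Cmod z) ->
    (forall z w, part (Cminus z w) = part z - part w) ->
    exists d : posreal, forall x y u v, x0 <= x <= x1 -> y0 <= y <= y1 ->
     x0 <= u <= x1 -> y0 <= v <= y1 -> Rabs (u - x) < d -> Rabs (v - y) < d ->
     Rabs (part (H (u, v)) - part (H (x, y))) < e / 2).
  { intros part B L.
    assert (He2 : 0 < e / 2) by lra.
    apply (uniform_continuity_2d (fun x y => part (H (x, y))) x0 x1 y0 y1) with (eps := mkposreal _ He2).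
    intros x y Hx Hy eps.
    destruct (proj1 (Ccont_eps H (x, y)) (K (x, y) (conj Hx Hy)) eps (cond_pos eps)) as [d [Hd Kd]].
    assert (Hd2 : 0 < d / 2) by lra.
    exists (mkposreal _ Hd2). simpl. intros u v Hu Hv. rewrite <- L.
    eapply Rle_lt_trans; [apply B|]. apply Kd.
    change (Cminus (u, v) (x, y)) with ((u - x, v - y) : C).
    eapply Rle_lt_trans; [apply Cmod_le_Rabs|]. lra. }
  destruct (U Re re_le_Cmod) as [d1 K1]; [intros z w; reflexivity|].
  destruct (U Im) as [d2 K2].
  { intros z. eapply Rle_trans; [apply Rmax_r|apply Rmax_Cmod]. }
  { intros z w; reflexivity. }
  exists (Rmin d1 d2). split; [apply Rmin_pos; apply cond_pos|].
  intros [x y] [u v] [Hx Hy] [Hu Hv] Dx Dy. simpl in *.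
  pose proof (Rmin_l d1 d2). pose proof (Rmin_r d1 d2).
  rewrite (surjective_pairing (Cminus _ _)).
  eapply Rle_lt_trans; [apply Cmod_le_Rabs|].
  replace e with (e / 2 + e / 2) by field.
  apply Rplus_lt_compat; [apply (K1 x y u v)|apply (K2 x y u v)]; lra.
Qed.

(** In a thin rectangle the horizontal sides nearly cancel and the vertical ones
    are short. *)
Lemma Rect_thin (H : C -> C) (x0 x1 y0 y1 M e : R) : x0 <= x1 -> y0 <= y1 ->
  (forall z, in_rect x0 x1 y0 y1 z -> Ccont H z) ->
  (forall x, x0 <= x <= x1 -> Cmod (Cminus (H (x, y0)) (H (x, y1))) <= e) ->
  (forall y, y0 <= y <= y1 -> Cmod (H (x0, y)) <= M /\ Cmod (H (x1, y)) <= M) ->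
  Cmod (Rect H x0 x1 y0 y1) <= (x1 - x0) * e + 2 * (y1 - y0) * M.
Proof.
  intros Lx Ly K Brow Bcol.
  destruct (ex_cint_sides x0 x1 y0 y1 Lx Ly H) as (K1 & K2 & K3 & K4).
  { intros z [Hz _]. auto. }
  unfold Rect.
  replace (Cminus _ _) with
    (Cplus (Cplus (cint (fun x => Cminus (H (x, y0)) (H (x, y1))) x0 x1) (Cmult Ci (cint (fun y => H (x1, y)) y0 y1)))
       (Copp (Cmult Ci (cint (fun y => H (x0, y)) y0 y1)))).
  2: { rewrite cint_minus by assumption. ring. }
  eapply Rle_trans; [apply Cmod_triangle3|]. rewrite Cmod_opp, !Cmod_mult, Cmod_Ci.
  assert (B1 : Cmod (cint (fun y => H (x1, y)) y0 y1) <= (y1 - y0) * M).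
  { apply Cmod_cint_le_const; auto. intros; apply Bcol; auto. }
  assert (B0 : Cmod (cint (fun y => H (x0, y)) y0 y1) <= (y1 - y0) * M).
  { apply Cmod_cint_le_const; auto. intros; apply Bcol; auto. }
  assert (Br : Cmod (cint (fun x => Cminus (H (x, y0)) (H (x, y1))) x0 x1) <= (x1 - x0) * e).
  { apply Cmod_cint_le_const; auto.
    exact (ex_RInt_minus (V := C_R_NormedModule) _ _ _ _ K1 K3). }
  lra.
Qed.

(** Thin strips along the two horizontal edges are cut off; uniform continuity
    makes their contribution small. *)
Lemma Cauchy_open_heights (H : C -> C) (x0 x1 y0 y1 : R) : x0 <= x1 -> y0 <= y1 ->
  (forall z, in_rect x0 x1 y0 y1 z -> Ccont H z) ->
  (forall z, x0 <= Re z <= x1 -> y0 < Im z < y1 -> Cdiffable H z) ->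
  Rect H x0 x1 y0 y1 = RtoC 0.
Proof.
  intros Lx [Ly|<-] K D; [|apply Rect_flat].
  (* bounds [H] on the vertical sides of the thin strips, which stay close to the corners *)
  set (M := Cmod (H (x0, y0)) + Cmod (H (x1, y0)) + Cmod (H (x0, y1)) + Cmod (H (x1, y1)) + 1).
  pose proof (Cmod_ge_0 (H (x0, y0))). pose proof (Cmod_ge_0 (H (x1, y0))).
  pose proof (Cmod_ge_0 (H (x0, y1))). pose proof (Cmod_ge_0 (H (x1, y1))).
  apply Cmod_zero_of_le with (2 * (x1 - x0 + 2)). intros e He.
  set (q := Rmin 1 e). assert (Hq : 0 < q) by (apply Rmin_pos; lra).
  assert (q1 : q <= 1) by apply Rmin_l. assert (q2 : q <= e) by apply Rmin_r.
  destruct (unif_cont_rect H x0 x1 y0 y1 q K Hq) as [d [Hd U]].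
  set (t := Rmin (Rmin (d / 2) ((y1 - y0) / 4)) (e / M)).
  assert (HM : 0 < M) by (unfold M; lra).
  assert (HeM : 0 < e / M) by (apply Rdiv_lt_0_compat; lra).
  assert (Ht : 0 < t) by (repeat apply Rmin_pos; lra).
  assert (t1 : t <= d / 2) by (eapply Rle_trans; apply Rmin_l).
  assert (t2 : t <= (y1 - y0) / 4) by (eapply Rle_trans; [apply Rmin_l|apply Rmin_r]).
  assert (t3 : t * M <= e).
  { assert (t <= e / M) by apply Rmin_r. assert (e / M * M = e) by (field; lra). nra. }
  assert (Col : forall x, x0 <= x <= x1 -> ex_cint (fun y => H (x, y)) y0 y1).
  { intros x Hx. apply ex_cint_cont; [lra|]. intros y Hy. apply RCcont_col, K. split; simpl; lra. }
  assert (Col' : forall x, x0 <= x <= x1 -> ex_cint (fun y => H (x, y)) (y0 + t) y1).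
  { intros x Hx. apply ex_cint_cont; [lra|]. intros y Hy. apply RCcont_col, K. split; simpl; lra. }
  rewrite (Rect_split_h x0 x1 y0 y1 H (y0 + t)) by (lra || (apply Col; lra)).
  rewrite (Rect_split_h x0 x1 (y0 + t) y1 H (y1 - t)) by (lra || (apply Col'; lra)).
  rewrite (Goursat H x0 x1 (y0 + t) (y1 - t)); try lra.
  2: { intros z [Z1 Z2]. apply D; lra. }
  assert (Near : forall x y y', x0 <= x <= x1 -> y0 <= y <= y1 -> y0 <= y' <= y1 ->
     Rabs (y - y') <= t -> Cmod (Cminus (H (x, y)) (H (x, y'))) <= q).
  { intros x y y' Hx Hy Hy' A. left. apply U; simpl; try (split; simpl; lra).
    - replace (x - x) with 0 by ring. rewrite Rabs_R0. exact Hd.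
    - lra. }
  assert (Far : forall x y y', x0 <= x <= x1 -> y0 <= y <= y1 -> y0 <= y' <= y1 ->
     Rabs (y - y') <= t -> Cmod (H (x, y')) + 1 <= M -> Cmod (H (x, y)) <= M).
  { intros x y y' Hx Hy Hy' A B.
    replace (H (x, y)) with (Cplus (H (x, y')) (Cminus (H (x, y)) (H (x, y')))) by ring.
    eapply Rle_trans; [apply Cmod_triangle|]. pose proof (Near x y y' Hx Hy Hy' A). lra. }
  replace (Cplus _ _) with (Cplus (Rect H x0 x1 y0 (y0 + t)) (Rect H x0 x1 (y1 - t) y1)) by ring.
  eapply Rle_trans; [apply Cmod_triangle|].
  apply Rle_trans with (((x1 - x0) * q + 2 * (y0 + t - y0) * M) + ((x1 - x0) * q + 2 * (y1 - (y1 - t)) * M)).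
  - apply Rplus_le_compat; apply Rect_thin; try lra.
    + intros z [Z1 Z2]. apply K. split; lra.
    + intros x Hx. apply Near; try lra. apply Rabs_le; lra.
    + intros y Hy. split; apply (Far _ y y0); try lra; try (apply Rabs_le; lra); unfold M; lra.
    + intros z [Z1 Z2]. apply K. split; lra.
    + intros x Hx. apply Near; try lra. apply Rabs_le; lra.
    + intros y Hy. split; apply (Far _ y y1); try lra; try (apply Rabs_le; lra); unfold M; lra.
  - assert ((x1 - x0) * q <= (x1 - x0) * e) by (apply Rmult_le_compat_l; lra). lra.
Qed.

(** Cutting along the horizontal line through an exceptional point moves that
    point to an edge, where only continuity is required. *)
Theorem Cauchy_rectangle (H : C -> C) (x0 x1 : R) (L : list C) : x0 <= x1 ->
  forall y0 y1, y0 <= y1 ->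
  (forall z, in_rect x0 x1 y0 y1 z -> Ccont H z) ->
  (forall z, x0 <= Re z <= x1 -> y0 < Im z < y1 -> ~ In z L -> Cdiffable H z) ->
  Rect H x0 x1 y0 y1 = RtoC 0.
Proof.
  intros Lx. induction L as [|p L IH]; intros y0 y1 Ly K D.
  - apply Cauchy_open_heights; auto.
  - destruct (Rlt_dec y0 (Im p)) as [L0|L0]; [destruct (Rlt_dec (Im p) y1) as [L1|L1]|].
    + assert (Col : forall x, x0 <= x <= x1 -> ex_cint (fun y => H (x, y)) y0 y1).
      { intros x Hx. apply ex_cint_cont; [lra|]. intros y Hy. apply RCcont_col, K. split; simpl; lra. }
      rewrite (Rect_split_h x0 x1 y0 y1 H (Im p)) by (lra || (apply Col; lra)).
      rewrite !IH; try lra; try ring; try (intros z [Z1 Z2]; apply K; split; lra);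
        intros z Z1 Z2 Z3; apply D; try lra; intros [->|I]; try lra; auto.
    + apply IH; auto. intros z Z1 Z2 Z3. apply D; auto. intros [->|I]; [lra|auto].
    + apply IH; auto. intros z Z1 Z2 Z3. apply D; auto. intros [->|I]; [lra|auto].
Qed.

(** * Residues *)

Definition Clim (G : C -> C) (z v : C) : Prop :=
  filterlim G (Clocally' z) (Clocally v).

Lemma C_eq_dec (z w : C) : {z = w} + {z <> w}.
Proof.
  destruct z as [x y], w as [u v].
  destruct (Req_EM_T x u) as [->|N]; [|right; congruence].
  destruct (Req_EM_T y v) as [->|N]; [left; reflexivity|right; congruence].
Qed.

Lemma locally_neq (z w : C) : z <> w -> Clocally z (fun u => u <> w).
Proof.
  intros N. apply C_locally_Cmod. exists (Cmod (Cminus z w)). split.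
  - apply Cmod_gt_0. intros E. apply N. replace z with (Cplus (Cminus z w) w) by ring. rewrite E. ring.
  - intros u Hu ->. rewrite Cmod_sub_comm in Hu. lra.
Qed.

Definition Csum (l : list C) : C := fold_right Cplus (RtoC 0) l.

(** [S z] is any function with the same singularity as [H] at [z]. The poles are
    removed one at a time: subtract [S p] and fill in the limit at [p]. The
    new value makes the difference continuous but perhaps not differentiable
    at [p], so [p] stays in the list [L] of exceptional points. *)
Theorem Rect_residues (S : C -> C -> C) (L : list C) (x0 x1 y0 y1 : R) :
  x0 <= x1 -> y0 <= y1 ->
  (forall z w, w <> z -> Cdiffable (S z) w) ->
  forall (zs : list C) (H : C -> C), NoDup zs ->
  (forall z, In z zs -> x0 < Re z < x1 /\ y0 < Im z < y1) ->
  (forall z, In z zs -> In z L) ->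
  (forall z, in_rect x0 x1 y0 y1 z -> ~ In z zs -> Ccont H z) ->
  (forall z, x0 <= Re z <= x1 -> y0 < Im z < y1 -> ~ In z L -> Cdiffable H z) ->
  (forall z, In z zs -> exists v, Clim (fun w => Cminus (H w) (S z w)) z v) ->
  Rect H x0 x1 y0 y1 = Csum (map (fun z => Rect (S z) x0 x1 y0 y1) zs).
Proof.
  intros Lx Ly DS. induction zs as [|p zs IH]; intros H ND In_ Sub K D V.
  - apply Cauchy_rectangle with L; auto.
  - destruct (V p (or_introl eq_refl)) as [v Hv].
    destruct (In_ p (or_introl eq_refl)) as [Px Py].
    inversion ND as [|p' zs' Np ND']; subst p' zs'.
    set (G := fun w => if C_eq_dec w p then v else Cminus (H w) (S p w)).
    assert (GE : forall w, w <> p -> Clocally w (fun u => Cminus (H u) (S p u) = G u)).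
    { intros w N. generalize (locally_neq w p N). apply filter_imp. intros u Nu.
      unfold G. destruct (C_eq_dec u p); [contradiction|reflexivity]. }
    assert (SC : forall z w, w <> z -> Ccont (S z) w).
    { intros z w N. apply ex_Cderiv_cont, DS, N. }
    assert (FN : forall z, frame x0 x1 y0 y1 z -> forall q, In q (p :: zs) -> z <> q).
    { intros z [_ Hz] q Hq ->. destruct (In_ q Hq). lra. }
    rewrite (Rect_ext x0 x1 y0 y1 Lx Ly H (fun w => Cplus (G w) (S p w))).
    2: { intros z Hz. unfold G. destruct (C_eq_dec z p) as [E|E].
         - exfalso. exact (FN z Hz p (or_introl eq_refl) E).
         - ring. }
    assert (KG : forall z, in_rect x0 x1 y0 y1 z -> ~ In z zs -> Ccont G z).
    { intros z Hz Nz. destruct (C_eq_dec z p) as [->|N].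
      - intros P HP. unfold filtermap.
        assert (EG : G p = v) by (unfold G; destruct (C_eq_dec p p); [reflexivity|congruence]).
        rewrite EG in HP. generalize (Hv P HP). unfold filtermap, locally', within.
        apply filter_imp. intros u Hu. unfold G. destruct (C_eq_dec u p) as [->|Nu].
        + exact (locally_singleton v P HP).
        + exact (Hu Nu).
      - apply (continuous_ext_loc (T := C_UniformSpace) (U := C_UniformSpace) G
                 (fun u => Cminus (H u) (S p u)) z).
        { exact (GE z N). }
        apply Ccont_minus; [|apply SC, N]. apply K; [exact Hz|]. intros [E|I]; [congruence|auto]. }
    rewrite Rect_plus; auto.
    + simpl. rewrite (IH G ND'); auto.
      * unfold Csum. simpl. ring.
      * intros z Hz. apply In_. right; exact Hz.
      * intros z Hz. apply Sub. right; exact Hz.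
      * intros z Z1 Z2 NL.
        assert (N : z <> p) by (intros ->; apply NL, Sub; left; reflexivity).
        destruct (D z Z1 Z2 NL) as [l Dl]. destruct (DS p z N) as [m Dm].
        exists (Cminus l m). apply (Cderiv_ext_loc _ _ _ _ (GE z N)).
        exact (is_derive_minus (K := C_AbsRing) (V := C_NormedModule) H (S p) z l m Dl Dm).
      * intros z Hz. destruct (V z (or_intror Hz)) as [u Hu].
        assert (N : z <> p) by (intros ->; contradiction).
        exists (Cplus u (Copp (S p z))).
        apply (filterlim_ext_loc (fun w => Cplus (Cminus (H w) (S z w)) (Copp (S p w)))).
        { generalize (GE z N). unfold locally', within. apply filter_imp. intros w Ew _. rewrite <- Ew. ring. }
        apply (filterlim_Cplus (Clocally' z)); [exact Hu|].
        apply (filterlim_filter_le_1 (F := Clocally z)); [apply filter_le_within|].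
        exact (Ccont_opp _ _ (SC p z N)).
    + intros z Hz. apply KG; [apply Hz|]. intros I. exact (FN z Hz z (or_intror I) eq_refl).
    + intros z Hz. apply SC, (FN z Hz). left; reflexivity.
Qed.

(** * Integrals of principal parts *)

Lemma atan_complement (p q : R) : 0 < p -> 0 < q -> atan (p / q) + atan (q / p) = PI / 2.
Proof.
  intros Hp Hq. replace (q / p) with (/ (p / q)) by (field; lra).
  rewrite atan_inv by (apply Rdiv_lt_0_compat; lra). ring.
Qed.

Lemma sum_sqr_pos (u v : R) : v <> 0 -> 0 < u * u + v * v.
Proof. intros Hv. assert (0 < v * v) by (apply Rsqr_pos_lt; exact Hv). nra. Qed.

Lemma cint_inv_row (a b v : R) : v <> 0 ->
  cint (fun x => Cinv (x, v)) a b =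
  (/ 2 * ln (b * b + v * v) - / 2 * ln (a * a + v * v), atan (a / v) - atan (b / v)).
Proof.
  intros Hv. apply (is_RInt_unique (V := C_R_CompleteNormedModule)).
  pose proof (fun x => sum_sqr_pos x v Hv) as P.
  assert (C1 : forall g : R -> R, (forall x, ex_derive g x) -> forall x, continuous g x).
  { intros g D x. apply (ex_derive_continuous (V := R_NormedModule)), D. }
  apply is_cint_pair. split; simpl.
  - apply (is_RInt_derive (V := R_CompleteNormedModule) (fun x => / 2 * ln (x * x + v * v))).
    + intros x _. specialize (P x). auto_derive; [lra|]. field. nra.
    + intros x _. apply C1. intros t. specialize (P t). auto_derive. nra.
  - replace (atan (a / v) - atan (b / v)) with (- atan (b / v) - - atan (a / v)) by ring.
    apply (is_RInt_derive (V := R_CompleteNormedModule) (fun x => - atan (x / v))).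
    + intros x _. specialize (P x). auto_derive; [exact I|]. field. nra.
    + intros x _. apply C1. intros t. specialize (P t). auto_derive. nra.
Qed.

Lemma cint_inv_col (a b u : R) : u <> 0 ->
  cint (fun y => Cinv (u, y)) a b =
  (atan (b / u) - atan (a / u), / 2 * ln (a * a + u * u) - / 2 * ln (b * b + u * u)).
Proof.
  intros Hu. apply (is_RInt_unique (V := C_R_CompleteNormedModule)).
  pose proof (fun x => sum_sqr_pos x u Hu) as P.
  assert (C1 : forall g : R -> R, (forall x, ex_derive g x) -> forall x, continuous g x).
  { intros g D x. apply (ex_derive_continuous (V := R_NormedModule)), D. }
  apply is_cint_pair. split; simpl.
  - apply (is_RInt_derive (V := R_CompleteNormedModule) (fun y => atan (y / u))).
    + intros x _. specialize (P x). auto_derive; [exact I|]. field. nra.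
    + intros x _. apply C1. intros t. specialize (P t). auto_derive. nra.
  - replace (/ 2 * _ - _) with (- (/ 2 * ln (b * b + u * u)) - - (/ 2 * ln (a * a + u * u))) by ring.
    apply (is_RInt_derive (V := R_CompleteNormedModule) (fun y => - (/ 2 * ln (y * y + u * u)))).
    + intros x _. specialize (P x). auto_derive; [lra|]. field. nra.
    + intros x _. apply C1. intros t. specialize (P t). auto_derive. nra.
Qed.

Lemma cint_shift (h : R -> C) (a b c : R) : a <= b ->
  (forall x, a + c <= x <= b + c -> RCcont h x) ->
  cint (fun x => h (x + c)) a b = cint h (a + c) (b + c).
Proof.
  intros L K.
  assert (E : ex_cint h (1 * a + c) (1 * b + c)).
  { rewrite !Rmult_1_l. apply ex_cint_cont; auto; lra. }
  pose proof (RInt_comp_lin (V := C_R_CompleteNormedModule) h 1 c a b E) as S.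
  rewrite !Rmult_1_l in S. rewrite <- S.
  apply cint_ext; auto. intros x _.
  rewrite Rmult_1_l. symmetry. apply (scal_one (V := C_R_ModuleSpace)).
Qed.

Lemma Ccont_inv (H : C -> C) (z : C) : H z <> RtoC 0 -> Ccont H z -> Ccont (fun w => Cinv (H w)) z.
Proof. exact (filterlim_Cinv (Clocally z) H (H z)). Qed.

(** The logarithms cancel, and at each corner two arctangents of inverse
    arguments add up to a right angle. *)
Lemma Rect_inv (p : C) (x0 x1 y0 y1 : R) : x0 < Re p < x1 -> y0 < Im p < y1 ->
  Rect (fun w => Cinv (Cminus w p)) x0 x1 y0 y1 = Cmult (RtoC (2 * PI)) Ci.
Proof.
  destruct p as [u v]. simpl. intros Hx Hy. unfold Rect.
  assert (Row : forall y, y <> v -> cint (fun x => Cinv (Cminus (x, y) (u, v))) x0 x1 =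
     cint (fun x => Cinv (x, y - v)) (x0 - u) (x1 - u)).
  { intros y Ny. unfold Rminus. rewrite <- (cint_shift (fun x => Cinv (x, y + - v)) x0 x1 (- u)).
    - reflexivity.
    - lra.
    - intros x _. apply (RCcont_row Cinv). apply (Ccont_inv (fun w => w)); [|apply Ccont_id].
      intros E. apply (f_equal snd) in E. simpl in E. lra. }
  assert (Col : forall x, x <> u -> cint (fun y => Cinv (Cminus (x, y) (u, v))) y0 y1 =
     cint (fun y => Cinv (x - u, y)) (y0 - v) (y1 - v)).
  { intros x Nx. unfold Rminus. rewrite <- (cint_shift (fun y => Cinv (x + - u, y)) y0 y1 (- v)).
    - reflexivity.
    - lra.
    - intros y _. apply (RCcont_col Cinv). apply (Ccont_inv (fun w => w)); [|apply Ccont_id].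
      intros E. apply (f_equal fst) in E. simpl in E. lra. }
  rewrite !Row, !Col by lra. rewrite !cint_inv_row, !cint_inv_col by lra.
  set (a := u - x0). set (b := x1 - u). set (c := v - y0). set (d := y1 - v).
  replace (x0 - u) with (- a) by (unfold a; ring). replace (y0 - v) with (- c) by (unfold c; ring).
  assert (Ha : 0 < a) by (unfold a; lra). assert (Hb : 0 < b) by (unfold b; lra).
  assert (Hc : 0 < c) by (unfold c; lra). assert (Hd : 0 < d) by (unfold d; lra).
  clearbody a b c d.
  pose proof (atan_complement a c Ha Hc). pose proof (atan_complement a d Ha Hd).
  pose proof (atan_complement b c Hb Hc). pose proof (atan_complement b d Hb Hd).
  replace (- a / - c) with (a / c) by (field; lra). replace (- c / - a) with (c / a) by (field; lra).
  replace (b / - c) with (- (b / c)) by (field; lra). replace (d / - a) with (- (d / a)) by (field; lra).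
  replace (- a / d) with (- (a / d)) by (field; lra). replace (- c / b) with (- (c / b)) by (field; lra).
  rewrite !atan_opp.
  replace (- a * - a) with (a * a) by ring. replace (- c * - c) with (c * c) by ring.
  rewrite (Rplus_comm (d * d)), (Rplus_comm (c * c) (b * b)), (Rplus_comm (c * c) (a * a)), (Rplus_comm (d * d) (a * a)).
  unfold Cminus, Cplus, Copp, Cmult, Ci, RtoC; simpl. f_equal; lra.
Qed.

Lemma Cderiv_pow (p z : C) (n : nat) :
  Cderiv (fun w => Cpow (Cminus w p) n) z (Cmult (RtoC (INR n)) (Cpow (Cminus z p) (pred n))).
Proof.
  induction n as [|n IH].
  - apply (Cderiv_eq _ _ (RtoC 0)); [exact (Cderiv_const (RtoC 1) z)|]. simpl. ring.
  - assert (D1 : Cderiv (fun w => Cminus w p) z (RtoC 1)).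
    { eapply Cderiv_eq; [apply Cderiv_plus; [apply Cderiv_id|apply (Cderiv_const (Copp p))]|]. ring. }
    eapply Cderiv_eq; [exact (Cderiv_mult _ _ z _ _ D1 IH)|].
    rewrite S_INR, RtoC_plus. simpl pred. destruct n as [|n].
    + simpl. ring.
    + simpl. ring.
Qed.

Lemma Cmult_div_cancel (a x : C) : a <> RtoC 0 -> Cdiv (Cmult a x) a = x.
Proof. intros Ha. field. exact Ha. Qed.

Lemma Cpow_neq_0 (z : C) (n : nat) : z <> RtoC 0 -> Cpow z n <> RtoC 0.
Proof.
  intros Hz. induction n as [|n IH]; simpl; [apply RtoC_neq_0; lra|apply Cmult_neq_0; auto].
Qed.

Lemma Cminus_neq_0 (z w : C) : z <> w -> Cminus z w <> RtoC 0.
Proof. intros N E. apply N. replace z with (Cplus (Cminus z w) w) by ring. rewrite E. ring. Qed.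

Definition pole_kernel (al p : C) (j : nat) (w : C) : C :=
  Cmult (cexp (Cmult al w)) (Cinv (Cpow (Cminus w p) j)).

Lemma Cderiv_pole_kernel (al p w : C) (j : nat) : w <> p ->
  Cderiv (pole_kernel al p j) w
    (Cminus (Cmult al (pole_kernel al p j w)) (Cmult (RtoC (INR j)) (pole_kernel al p (S j) w))).
Proof.
  intros N. pose proof (Cminus_neq_0 _ _ N) as N'.
  eapply Cderiv_eq.
  - apply Cderiv_mult; [apply Cderiv_cexp|]. apply Cderiv_inv; [apply Cpow_neq_0; exact N'|apply Cderiv_pow].
  - unfold pole_kernel. destruct j as [|j].
    + simpl. field. exact N'.
    + simpl pred. simpl Cpow. field. split; [apply Cpow_neq_0|]; exact N'.
Qed.

Lemma Ccont_pole_kernel (al p w : C) (j : nat) : w <> p -> Ccont (pole_kernel al p j) w.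
Proof. intros N. exact (Cderiv_cont _ _ _ (Cderiv_pole_kernel al p w j N)). Qed.

Section Inside.
Variables (p : C) (x0 x1 y0 y1 : R).
Hypothesis Hx : x0 < Re p < x1.
Hypothesis Hy : y0 < Im p < y1.

Let Lx : x0 <= x1. Proof. lra. Qed.
Let Ly : y0 <= y1. Proof. lra. Qed.

Lemma frame_neq (z : C) : frame x0 x1 y0 y1 z -> z <> p.
Proof. intros [_ Hz] ->. lra. Qed.

(** The difference quotient of the exponential at [p] has a removable
    singularity, which leaves a multiple of [1 / (w - p)]. *)
Lemma Rect_pole_kernel_1 (al : C) :
  Rect (pole_kernel al p 1) x0 x1 y0 y1 = Cmult (Cmult (RtoC (2 * PI)) Ci) (cexp (Cmult al p)).
Proof.
  set (S := fun q w : C => Cmult (cexp (Cmult al q)) (Cinv (Cminus w q))).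
  assert (DS : forall q w, w <> q -> Cdiffable (S q) w).
  { intros q w N. eexists. apply Cderiv_mult; [apply Cderiv_const|].
    apply Cderiv_inv; [apply Cminus_neq_0, N|].
    apply Cderiv_plus; [apply Cderiv_id|apply (Cderiv_const (Copp q))]. }
  rewrite (Rect_residues S (p :: nil) x0 x1 y0 y1 Lx Ly DS (p :: nil)).
  - simpl. unfold S. rewrite Rect_mult_l.
    + rewrite Rect_inv by assumption. unfold Csum; simpl. ring.
    + exact Lx.
    + exact Ly.
    + intros z Hz. apply (Ccont_inv (fun w => Cminus w p)); [apply Cminus_neq_0, frame_neq, Hz|].
      apply Ccont_minus; [apply Ccont_id|apply Ccont_const].
  - constructor; [simpl; tauto|constructor].
  - intros z [<-|[]]. auto.
  - intros z Hz; exact Hz.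
  - intros z _ N. apply Ccont_pole_kernel. intros ->. apply N. left; reflexivity.
  - intros z _ _ N. eexists. apply Cderiv_pole_kernel. intros ->. apply N. left; reflexivity.
  - intros z [<-|[]]. set (l := Cmult al (cexp (Cmult al p))). exists l.
    apply (C_filterlim _ (Clocally' p)). intros e He. apply C_locally'_Cmod.
    assert (He2 : 0 < e / 2) by lra.
    destruct (proj1 (Cderiv_eps _ _ _) (Cderiv_cexp al p) (e / 2) He2) as [d [Hd K]].
    exists d. split; [exact Hd|]. intros w Hw N. specialize (K w Hw).
    pose proof (Cminus_neq_0 _ _ N) as N'.
    replace (Cminus _ l) with (Cdiv (Cminus (Cminus (cexp (Cmult al w)) (cexp (Cmult al p))) (Cmult l (Cminus w p))) (Cminus w p)).
    2: { unfold S, pole_kernel. simpl. field. exact N'. }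
    rewrite Cmod_div by exact N'. unfold l.
    assert (P : 0 < Cmod (Cminus w p)) by (apply Cmod_gt_0; exact N').
    apply Rle_lt_trans with (e / 2); [|lra].
    apply Rle_div_l; [exact P|exact K].
Qed.

(** Write J_j for the integral of the kernel of order j. The derivative of the
    kernel of order j integrates to 0 over the contour, which reads j
    J_(j+1) = al J_j. *)
Lemma Rect_pole_kernel (al : C) (m : nat) :
  Rect (pole_kernel al p (S m)) x0 x1 y0 y1 =
  Cmult (Cmult (Cmult (RtoC (2 * PI)) Ci) (cexp (Cmult al p)))
    (Cdiv (Cpow al m) (RtoC (INR (fact m)))).
Proof.
  induction m as [|m IH].
  - rewrite Rect_pole_kernel_1. simpl. field.
  - set (j := S m) in *.
    assert (Kc : forall i z, frame x0 x1 y0 y1 z -> Ccont (pole_kernel al p i) z).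
    { intros i z Hz. apply Ccont_pole_kernel, frame_neq, Hz. }
    assert (Kcm : forall c i z, frame x0 x1 y0 y1 z -> Ccont (fun w => Cmult c (pole_kernel al p i w)) z).
    { intros c i z Hz. apply Ccont_mult; [apply Ccont_const|apply Kc, Hz]. }
    assert (Z : Rect (fun w => Cminus (Cmult al (pole_kernel al p j w)) (Cmult (RtoC (INR j)) (pole_kernel al p (S j) w)))
       x0 x1 y0 y1 = RtoC 0).
    { apply (Rect_FTC _ _ _ _ Lx Ly (pole_kernel al p j)). intros z Hz. split.
      - apply Cderiv_pole_kernel, frame_neq, Hz.
      - apply Ccont_minus; apply Kcm, Hz. }
    rewrite Rect_minus, !Rect_mult_l, IH in Z by auto.
    assert (Nj : RtoC (INR j) <> RtoC 0) by (apply RtoC_neq_0, not_0_INR; unfold j; lia).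
    assert (Nf : RtoC (INR (fact m)) <> RtoC 0) by (apply RtoC_neq_0, INR_fact_neq_0).
    replace (Rect (pole_kernel al p (S j)) x0 x1 y0 y1) with
      (Cdiv (Cmult (RtoC (INR j)) (Rect (pole_kernel al p (S j)) x0 x1 y0 y1)) (RtoC (INR j))) by (apply Cmult_div_cancel; exact Nj).
    match type of Z with Cminus ?A ?B = _ => replace B with A end.
    2: { match type of Z with Cminus ?A ?B = _ => replace A with (Cplus (Cminus A B) B) by ring end. rewrite Z. ring. }
    unfold j. rewrite fact_simpl, mult_INR, (RtoC_mult (INR (S m))). fold j. simpl Cpow.
    generalize dependent (RtoC (INR j)). generalize dependent (RtoC (INR (fact m))). intros. field. auto.
Qed.
End Inside.

(** The sum that occurs in [has_principal_part]. *)
Definition ppart (z : C) (n : nat) (c : nat -> C) (w : C) : C :=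
  sum_n_m (G := C_AbelianMonoid) (fun j => Cdiv (c j) (Cpow (Cminus w z) j)) 1 n.

Lemma ppart_0 (z : C) (c : nat -> C) (w : C) : ppart z 0 c w = RtoC 0.
Proof. unfold ppart. rewrite sum_n_m_zero by lia. reflexivity. Qed.

Lemma ppart_S (z : C) (n : nat) (c : nat -> C) (w : C) :
  ppart z (S n) c w = Cplus (ppart z n c w) (Cdiv (c (S n)) (Cpow (Cminus w z) (S n))).
Proof. unfold ppart. rewrite sum_n_Sm by lia. reflexivity. Qed.

Definition pole_model (al z : C) (n : nat) (c : nat -> C) (w : C) : C :=
  Cmult (ppart z n c w) (cexp (Cmult al w)).

Lemma ex_Cderiv_pole_model (al z w : C) (n : nat) (c : nat -> C) : w <> z ->
  Cdiffable (pole_model al z n c) w.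
Proof.
  intros N. pose proof (Cminus_neq_0 _ _ N) as N'.
  assert (D : exists l, Cderiv (ppart z n c) w l).
  { induction n as [|n [l IH]].
    - exists (RtoC 0). apply (Cderiv_ext_loc (fun _ => RtoC 0)); [|apply Cderiv_const].
      apply filter_forall. intros u. symmetry; apply ppart_0.
    - eexists. eapply Cderiv_ext_loc.
      + apply filter_forall. intros u. symmetry. apply ppart_S.
      + apply Cderiv_plus; [exact IH|]. apply Cderiv_mult; [apply Cderiv_const|].
        apply Cderiv_inv; [apply Cpow_neq_0, N'|apply Cderiv_pow]. }
  destruct D as [l D]. eexists. apply Cderiv_mult; [exact D|apply Cderiv_cexp].
Qed.

(** This is 2 pi i times the residue at [z]: the coefficient [c j] meets the
    Taylor coefficient of order j - 1 of the exponential at [z]. *)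
Definition model_residue (al z : C) (n : nat) (c : nat -> C) : C :=
  sum_n_m (G := C_AbelianMonoid) (fun j => Cmult (c j)
    (Cmult (Cmult (Cmult (RtoC (2 * PI)) Ci) (cexp (Cmult al z)))
    (Cdiv (Cpow al (pred j)) (RtoC (INR (fact (pred j))))))) 1 n.

Lemma Rect_pole_model (al p : C) (n : nat) (c : nat -> C) (x0 x1 y0 y1 : R) :
  x0 < Re p < x1 -> y0 < Im p < y1 ->
  Rect (pole_model al p n c) x0 x1 y0 y1 = model_residue al p n c.
Proof.
  intros Hx Hy. assert (Lx : x0 <= x1) by lra. assert (Ly : y0 <= y1) by lra.
  pose proof (frame_neq p x0 x1 y0 y1 Hx Hy) as FN.
  induction n as [|n IH].
  - unfold model_residue. rewrite sum_n_m_zero by lia.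
    rewrite (Rect_ext x0 x1 y0 y1 Lx Ly _ (fun w => Cplus (RtoC 0) (Cmult (RtoC 0) w))).
    + apply Rect_affine; auto.
    + intros w _. unfold pole_model. rewrite ppart_0. ring.
  - unfold model_residue. rewrite sum_n_Sm by lia. fold (model_residue al p n c).
    rewrite (Rect_ext x0 x1 y0 y1 Lx Ly _ (fun w => Cplus (pole_model al p n c w) (Cmult (c (S n)) (pole_kernel al p (S n) w)))).
    2: { intros w _. unfold pole_model, pole_kernel, Cdiv. rewrite ppart_S. unfold Cdiv. ring. }
    rewrite Rect_plus, IH, Rect_mult_l, Rect_pole_kernel; auto.
    + intros z Hz. apply Ccont_pole_kernel; auto.
    + intros z Hz. apply ex_Cderiv_cont, ex_Cderiv_pole_model; auto.
    + intros z Hz. apply Ccont_mult; [apply Ccont_const|apply Ccont_pole_kernel; auto].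
Qed.

Lemma cexp_mult_0 (z : C) : cexp (Cmult (RtoC 0) z) = RtoC 1.
Proof. rewrite Cmult_0_l. apply cexp_0. Qed.

Lemma model_residue_0 (z : C) (n : nat) (c : nat -> C) : (1 <= n)%nat ->
  model_residue (RtoC 0) z n c = Cmult (c 1%nat) (Cmult (RtoC (2 * PI)) Ci).
Proof.
  intros Hn. induction n as [|n IH]; [lia|]. clear Hn.
  unfold model_residue. rewrite sum_n_Sm by lia. fold (model_residue (RtoC 0) z n c).
  destruct n as [|n].
  - unfold model_residue. rewrite sum_n_m_zero by lia. rewrite cexp_mult_0. simpl.
    change (plus (G := C_AbelianMonoid)) with Cplus. change (zero (G := C_AbelianMonoid)) with (RtoC 0).
    field.
  - rewrite IH by lia. simpl pred. simpl Cpow.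
    change (plus (G := C_AbelianMonoid)) with Cplus. unfold Cdiv. ring.
Qed.

(** Frequency 0 makes the exponential factor of [pole_model] equal to 1. *)
Lemma principal_part_residue (f : C -> C) (z : C) (n : nat) (c : nat -> C) :
  (1 <= n)%nat -> has_principal_part f z n c ->
  exists d, 0 < d /\ forall s, 0 < s < d ->
    Rect f (Re z - s) (Re z + s) (Im z - s) (Im z + s) = Cmult (c 1%nat) (Cmult (RtoC (2 * PI)) Ci).
Proof.
  intros Hn (g & Hg & Hf).
  apply C_locally_Cmod in Hg. destruct Hg as [d1 [Hd1 Hg]].
  apply C_locally'_Cmod in Hf. destruct Hf as [d2 [Hd2 Hf]].
  exists (Rmin (d1 / 2) (d2 / 2)). split; [apply Rmin_pos; lra|]. intros s [Hs Hs'].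
  assert (s1 : s < d1 / 2) by (eapply Rlt_le_trans; [exact Hs'|apply Rmin_l]).
  assert (s2 : s < d2 / 2) by (eapply Rlt_le_trans; [exact Hs'|apply Rmin_r]).
  assert (Near : forall w, in_rect (Re z - s) (Re z + s) (Im z - s) (Im z + s) w -> Cmod (Cminus w z) <= 2 * s).
  { intros [x y] [Wx Wy]. destruct z as [u v]. simpl in *.
    change (Cminus (x, y) (u, v)) with ((x - u, y - v) : C).
    eapply Rle_trans; [apply Cmod_le_Rabs|].
    replace (2 * s) with (s + s) by ring. apply Rplus_le_compat; apply Rabs_le; lra. }
  assert (Lx : Re z - s <= Re z + s) by lra. assert (Ly : Im z - s <= Im z + s) by lra.
  assert (FN : forall w, frame (Re z - s) (Re z + s) (Im z - s) (Im z + s) w -> w <> z).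
  { apply frame_neq; lra. }
  rewrite (Rect_ext _ _ _ _ Lx Ly _ (fun w => Cplus (pole_model (RtoC 0) z n c w) (g w))).
  2: { intros w Hw. unfold pole_model. rewrite cexp_mult_0, Cmult_1_r. apply Hf; [|apply FN, Hw].
       pose proof (Near w (proj1 Hw)). lra. }
  rewrite Rect_plus; auto.
  - rewrite Rect_pole_model, model_residue_0 by (auto; lra).
    rewrite (Goursat g); auto.
    + ring.
    + intros w Hw. apply Hg. pose proof (Near w Hw). lra.
  - intros w Hw. apply ex_Cderiv_cont, ex_Cderiv_pole_model, FN, Hw.
  - intros w Hw. apply ex_Cderiv_cont, Hg. pose proof (Near w (proj1 Hw)). lra.
Qed.

(** Both coefficients are read off from the integral of [f] over one small
    square. *)
Lemma principal_part_residue_unique (f : C -> C) (z : C) (n m : nat) (c c' : nat -> C) :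
  (1 <= n)%nat -> (1 <= m)%nat -> has_principal_part f z n c -> has_principal_part f z m c' ->
  c 1%nat = c' 1%nat.
Proof.
  intros Hn Hm K K'.
  destruct (principal_part_residue f z n c Hn K) as [d [Hd E]].
  destruct (principal_part_residue f z m c' Hm K') as [d' [Hd' E']].
  set (s := Rmin (d / 2) (d' / 2)).
  assert (Hs : 0 < s) by (apply Rmin_pos; lra).
  assert (s1 : s <= d / 2) by apply Rmin_l. assert (s2 : s <= d' / 2) by apply Rmin_r.
  specialize (E s ltac:(lra)). rewrite E' in E by lra.
  assert (N : Cmult (RtoC (2 * PI)) Ci <> RtoC 0).
  { pose proof PI_RGT_0. intros Z. apply (f_equal Im) in Z. unfold Cmult, RtoC, Ci in Z. simpl in Z. lra. }
  rewrite !(Cmult_comm _ (Cmult (RtoC (2 * PI)) Ci)) in E.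
  rewrite <- (Cmult_div_cancel _ (c 1%nat) N), <- E. apply Cmult_div_cancel, N.
Qed.

(** * Improper integrals and frequencies *)

Lemma RInt_line_lim {V : CompleteNormedModule R_AbsRing} (h : R -> V) (l : V) :
  is_RInt_line h l -> forall e, 0 < e -> exists M, forall X Y, X < M -> - M < Y ->
    ex_RInt h X Y /\ norm (minus (RInt h X Y) l) < e.
Proof.
  intros K e He.
  destruct (K _ (locally_ball_norm l (mkposreal e He))) as [P Q [M1 HP] [M2 HQ] PQ].
  exists (Rmin M1 (- M2)). intros X Y HX HY.
  pose proof (Rmin_l M1 (- M2)). pose proof (Rmin_r M1 (- M2)).
  destruct (PQ X Y (HP X ltac:(lra)) (HQ Y ltac:(lra))) as [y [Hy By]]. simpl in Hy.
  split; [exists y; exact Hy|]. rewrite (is_RInt_unique _ _ _ _ Hy). exact By.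
Qed.

Lemma RInt_line_ge (g : R -> R) (l X Y : R) :
  is_RInt_line (V := R_CompleteNormedModule) g l ->
  (forall x, continuous g x) -> (forall x, 0 <= g x) -> X <= Y -> RInt g X Y <= l.
Proof.
  intros K C P L. apply Rnot_lt_le. intros B.
  destruct (RInt_line_lim _ _ K (RInt g X Y - l)) as [M HM]; [lra|].
  set (X' := Rmin X M - 1). set (Y' := Rmax Y (- M) + 1).
  pose proof (Rmin_l X M). pose proof (Rmin_r X M). pose proof (Rmax_l Y (- M)). pose proof (Rmax_r Y (- M)).
  destruct (HM X' Y') as [_ D]; [unfold X'; lra|unfold Y'; lra|].
  assert (E : forall u v, ex_RInt g u v).
  { intros u v. apply (ex_RInt_continuous (V := R_CompleteNormedModule)). intros x _. apply C. }
  rewrite <- (RInt_Chasles (V := R_CompleteNormedModule) g X' X Y') in D by apply E.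
  rewrite <- (RInt_Chasles (V := R_CompleteNormedModule) g X Y Y') in D by apply E.
  assert (0 <= RInt g X' X) by (apply RInt_ge_0; auto; unfold X'; lra).
  assert (0 <= RInt g Y Y') by (apply RInt_ge_0; auto; unfold Y'; lra).
  change (Rabs (RInt g X' X + (RInt g X Y + RInt g Y Y') - l) < RInt g X Y - l) in D.
  rewrite Rabs_pos_eq in D; lra.
Qed.

Lemma RCcont_Cmod (h : R -> C) (x : R) : RCcont h x -> continuous (fun t => Cmod (h t)) x.
Proof.
  intros K. apply (continuous_ext (fun t => norm (V := C_R_NormedModule) (h t))).
  - intros t. symmetry. apply Cmod_norm.
  - exact (filterlim_comp _ _ _ h (norm (V := C_R_NormedModule)) _ _ _ K (filterlim_norm (V := C_R_NormedModule) (h x))).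
Qed.

Lemma Cmod_Csum_le (l : list C) : Cmod (Csum l) <= sum_list (map Cmod l).
Proof.
  induction l as [|z l IH]; simpl.
  - rewrite Cmod_0. lra.
  - eapply Rle_trans; [apply Cmod_triangle|]. apply Rplus_le_compat_l, IH.
Qed.

(** [cexp (freq xi * z)] is the exponential e^(-2 pi i z xi). *)
Definition freq (xi : R) : C := Cmult (RtoC (- (2 * PI * xi))) Ci.

Lemma cexp_freq (xi x y : R) :
  cexp (Cmult (freq xi) (x, y)) = Cmult (RtoC (exp (2 * PI * xi * y))) (expi (- (2 * PI * x * xi))).
Proof.
  unfold cexp, freq. f_equal; f_equal; [f_equal|]; unfold Cmult, RtoC, Ci; simpl; ring.
Qed.

Lemma Cmod_cexp_freq (xi : R) (z : C) : Cmod (cexp (Cmult (freq xi) z)) = exp (2 * PI * xi * Im z).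
Proof.
  rewrite cexp_mod. f_equal. destruct z. unfold freq, Cmult, RtoC, Ci; simpl. ring.
Qed.

Lemma exp_le_1 (x : R) : x <= 0 -> exp x <= 1.
Proof.
  intros H. rewrite <- exp_0. destruct H as [H| ->]; [left; apply exp_increasing, H|lra].
Qed.

Lemma Re_bounded (zs : list C) : exists M, 0 < M /\ forall z, In z zs -> Rabs (Re z) < M.
Proof.
  induction zs as [|p zs (M & P & HM)]; [exists 1; split; [lra|intros z []]|].
  exists (M + Rabs (Re p)). pose proof (Rabs_pos (Re p)). split; [lra|].
  intros z [<-|I]; [lra|]. specialize (HM z I). lra.
Qed.

Lemma cexp_freq_cont (xi : R) (z : C) : Ccont (fun w => cexp (Cmult (freq xi) w)) z.
Proof. exact (Cderiv_cont _ _ _ (Cderiv_cexp (freq xi) z)). Qed.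

(** * The Riemann-Lebesgue lemma *)

Lemma expi_plus (s t : R) : expi (s + t) = Cmult (expi s) (expi t).
Proof. unfold expi, Cmult; simpl. rewrite cos_plus, sin_plus. f_equal; ring. Qed.

Lemma expi_0 : expi 0 = RtoC 1.
Proof. unfold expi. rewrite cos_0, sin_0. reflexivity. Qed.

Lemma expi_PI : expi PI = RtoC (-1).
Proof. unfold expi. rewrite cos_PI, sin_PI. reflexivity. Qed.

Lemma expi_period (k : Z) : expi (2 * PI * IZR k) = RtoC 1.
Proof.
  assert (P : forall n : nat, expi (2 * PI * INR n) = RtoC 1).
  { induction n as [|n IH]; [simpl; rewrite Rmult_0_r; apply expi_0|].
    rewrite S_INR. replace (2 * PI * (INR n + 1)) with (2 * PI * INR n + (PI + PI)) by ring.
    rewrite !expi_plus, IH, expi_PI. unfold Cmult, RtoC; simpl. f_equal; ring. }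
  destruct (Z_le_gt_dec 0 k) as [H|H].
  - rewrite <- (Z2Nat.id k H), <- INR_IZR_INZ. apply P.
  - specialize (P (Z.to_nat (- k))). rewrite INR_IZR_INZ, Z2Nat.id, opp_IZR in P by lia.
    replace (2 * PI * - IZR k) with (- (2 * PI * IZR k)) in P by ring.
    unfold expi in *. rewrite cos_neg, sin_neg in P.
    pose proof (f_equal fst P) as P1. pose proof (f_equal snd P) as P2. simpl in P1, P2.
    unfold RtoC. f_equal; lra.
Qed.

Lemma RCcont_expi (a x : R) : RCcont (fun t => expi (- (2 * PI * t * a))) x.
Proof.
  apply (continuous_ext (U := C_UniformSpace) (fun t => cexp (Cmult (freq a) (t, 0)))).
  - intros t. rewrite cexp_freq, Rmult_0_r, exp_0, Cmult_1_l. reflexivity.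
  - exact (RCcont_row _ x 0 (cexp_freq_cont a (x, 0))).
Qed.

Lemma RCcont_mult (g h : R -> C) (x : R) : RCcont g x -> RCcont h x -> RCcont (fun t => Cmult (g t) (h t)) x.
Proof. exact (filterlim_Cmult (locally x) g h (g x) (h x)). Qed.

Lemma RCcont_minus (g h : R -> C) (x : R) : RCcont g x -> RCcont h x -> RCcont (fun t => Cminus (g t) (h t)) x.
Proof. exact (continuous_minus (V := C_R_NormedModule) g h x). Qed.

Lemma unif_cont_seg (q : R -> C) (a b e : R) : (forall x, a <= x <= b -> RCcont q x) -> 0 < e ->
  exists d, 0 < d /\ forall x y, a <= x <= b -> a <= y <= b -> Rabs (y - x) < d ->
    Cmod (Cminus (q y) (q x)) < e.
Proof.
  intros K He.
  destruct (unif_cont_rect (fun z => q (Re z)) a b 0 0 e) as [d [Hd U]]; [|exact He|].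
  - intros [x y] [Hx _]. apply (filterlim_comp _ _ _ Re q _ _ _) with (2 := K x Hx).
    apply (continuous_fst (U := R_UniformSpace) (V := R_UniformSpace)).
  - exists d. split; [exact Hd|]. intros x y Hx Hy D.
    apply (U (x, 0) (y, 0)); try (split; simpl; lra); simpl; [exact D|].
    rewrite Rminus_0_r, Rabs_R0. exact Hd.
Qed.

Lemma bounded_seg (q : R -> C) (a b : R) : a <= b -> (forall x, a <= x <= b -> RCcont q x) ->
  exists M, forall x, a <= x <= b -> Cmod (q x) <= M.
Proof.
  intros L K. destruct (continuity_ab_maj (fun x => Cmod (q x)) a b L) as [m [Hm _]].
  - intros x Hx. apply continuity_pt_filterlim. exact (RCcont_Cmod q x (K x Hx)).
  - exists (Cmod (q m)). exact Hm.
Qed.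

(** A shift by half a period [d] changes the sign of the exponential, so twice
    the integral is that of q(x) - q(x + d) against the exponential, up to
    two end pieces of length [d]. *)
Theorem Riemann_Lebesgue (q : R -> C) (a b : R) : a < b ->
  (forall x, a <= x <= b -> RCcont q x) ->
  forall e, 0 < e -> exists M, 0 < M /\ forall xi, M < Rabs xi ->
    Cmod (cint (fun x => Cmult (q x) (expi (- (2 * PI * x * xi)))) a b) <= e.
Proof.
  intros L K e He.
  destruct (bounded_seg q a b (Rlt_le _ _ L) K) as [M HM].
  assert (M0 : 0 <= M) by (eapply Rle_trans; [apply Cmod_ge_0|apply (HM a); lra]).
  assert (He' : 0 < e / (b - a)) by (apply Rdiv_lt_0_compat; lra).
  destruct (unif_cont_seg q a b (e / (b - a)) K He') as [d0 [Hd0 U]].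
  set (d1 := Rmin (Rmin d0 (b - a)) (e / (2 * (M + 1)))).
  assert (0 < e / (2 * (M + 1))) by (apply Rdiv_lt_0_compat; lra).
  assert (Hd1 : 0 < d1) by (repeat apply Rmin_pos; lra).
  assert (D1 : d1 <= d0) by (eapply Rle_trans; apply Rmin_l).
  assert (D2 : d1 <= b - a) by (eapply Rle_trans; [apply Rmin_l|apply Rmin_r]).
  assert (D3 : d1 * (2 * (M + 1)) <= e).
  { assert (d1 <= e / (2 * (M + 1))) by apply Rmin_r.
    assert (e / (2 * (M + 1)) * (2 * (M + 1)) = e) by (field; lra). nra. }
  exists (/ (2 * d1)). split; [apply Rinv_0_lt_compat; lra|]. intros xi Hxi.
  assert (Xp : 0 < Rabs xi) by (eapply Rlt_trans; [|exact Hxi]; apply Rinv_0_lt_compat; lra).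
  (* half a period of the exponential *)
  set (d := / (2 * Rabs xi)).
  assert (Hd : 0 < d) by (apply Rinv_0_lt_compat; lra).
  assert (Dd : d < d1).
  { unfold d. rewrite <- (Rinv_inv d1). apply Rinv_lt_contravar; [|].
    - apply Rmult_lt_0_compat; [apply Rinv_0_lt_compat, Hd1|lra].
    - rewrite Rinv_mult in Hxi. lra. }
  set (E := fun x => expi (- (2 * PI * x * xi))).
  assert (E1 : forall x, Cmod (E x) = 1) by (intros; apply expi_mod).
  assert (Ec : forall x, RCcont E x) by (intros; apply RCcont_expi).
  assert (Eshift : forall x, E (x + d) = Copp (E x)).
  { intros x. unfold E.
    replace (- (2 * PI * (x + d) * xi)) with (- (2 * PI * x * xi) + - (xi / Rabs xi * PI)).
    2: { unfold d. field. lra. }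
    rewrite expi_plus. replace (expi (- (xi / Rabs xi * PI))) with (RtoC (-1)).
    - unfold Cmult, Copp, RtoC; destruct (expi _); simpl. f_equal; ring.
    - destruct (Rle_dec 0 xi) as [P|P].
      + rewrite Rabs_pos_eq in * by lra. replace (- (xi / xi * PI)) with (- PI) by (field; lra).
        unfold expi. rewrite cos_neg, sin_neg, cos_PI, sin_PI. unfold RtoC. f_equal; ring.
      + rewrite Rabs_left in * by lra. replace (- (xi / - xi * PI)) with PI by (field; lra).
        symmetry; apply expi_PI. }
  set (g := fun x => Cmult (q x) (E x)).
  assert (gc : forall x, a <= x <= b -> RCcont g x) by (intros x Hx; apply RCcont_mult; auto).
  assert (gi : forall u v, a <= u -> u <= v -> v <= b -> ex_cint g u v).
  { intros u v Hu Huv Hv. apply ex_cint_cont; auto. intros x Hx. apply gc; lra. }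
  assert (gb : forall u v, a <= u -> u <= v -> v <= b -> Cmod (cint g u v) <= (v - u) * M).
  { intros u v Hu Huv Hv. apply Cmod_cint_le_const; auto. intros x Hx. unfold g.
    rewrite Cmod_mult, E1, Rmult_1_r. apply HM. lra. }
  assert (S1 : Cplus (cint g a (a + d)) (cint g (a + d) b) = cint g a b) by (apply cint_Chasles; apply gi; lra).
  assert (S2 : Cplus (cint g a (b - d)) (cint g (b - d) b) = cint g a b) by (apply cint_Chasles; apply gi; lra).
  assert (S3 : cint g (a + d) b = Copp (cint (fun x => Cmult (q (x + d)) (E x)) a (b - d))).
  { replace b with ((b - d) + d) at 1 by ring.
    rewrite <- (cint_shift g a (b - d) d) by (lra || (intros; apply gc; lra)).
    rewrite <- (Cmult_1_l (cint (fun x => Cmult (q (x + d)) (E x)) a (b - d))).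
    replace (Copp (Cmult 1 _)) with (Cmult (Copp 1) (cint (fun x => Cmult (q (x + d)) (E x)) a (b - d))) by ring.
    rewrite <- cint_mult_l.
    - apply cint_ext; [lra|]. intros x _. unfold g. rewrite Eshift. ring.
    - apply ex_cint_cont; [lra|]. intros x Hx. apply RCcont_mult; [|apply Ec].
      apply (filterlim_comp _ _ _ (fun x => x + d) q _ (locally (x + d)) _); [|apply K; lra].
      apply (continuous_plus (V := R_NormedModule) (fun x => x) (fun _ => d)); [apply continuous_id|apply continuous_const]. }
  assert (S4 : Cminus (cint g a (b - d)) (cint (fun x => Cmult (q (x + d)) (E x)) a (b - d)) =
     cint (fun x => Cmult (Cminus (q x) (q (x + d))) (E x)) a (b - d)).
  { rewrite <- cint_minus.
    - apply cint_ext; [lra|]. intros x _. unfold g. ring.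
    - apply gi; lra.
    - apply ex_cint_cont; [lra|]. intros x Hx. apply RCcont_mult; [|apply Ec].
      apply (filterlim_comp _ _ _ (fun x => x + d) q _ (locally (x + d)) _); [|apply K; lra].
      apply (continuous_plus (V := R_NormedModule) (fun x => x) (fun _ => d)); [apply continuous_id|apply continuous_const]. }
  assert (B4 : Cmod (cint (fun x => Cmult (Cminus (q x) (q (x + d))) (E x)) a (b - d)) <= (b - d - a) * (e / (b - a))).
  { apply Cmod_cint_le_const; [lra| |].
    - apply ex_cint_cont; [lra|]. intros x Hx. apply RCcont_mult; [|apply Ec].
      apply RCcont_minus; [apply K; lra|].
      apply (filterlim_comp _ _ _ (fun x => x + d) q _ (locally (x + d)) _); [|apply K; lra].
      apply (continuous_plus (V := R_NormedModule) (fun x => x) (fun _ => d)); [apply continuous_id|apply continuous_const].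
    - intros x Hx. rewrite Cmod_mult, E1, Rmult_1_r. left. apply U; try lra.
      replace (x - (x + d)) with (- d) by ring. rewrite Rabs_Ropp, Rabs_pos_eq; lra. }
  change (Cmod (cint g a b) <= e).
  assert (T : Cplus (cint g a b) (cint g a b) =
    Cplus (Cplus (cint g a (a + d)) (cint g (b - d) b)) (cint (fun x => Cmult (Cminus (q x) (q (x + d))) (E x)) a (b - d))).
  { rewrite <- S1 at 1. rewrite <- S2, S3, <- S4. ring. }
  assert (T2 : 2 * Cmod (cint g a b) = Cmod (Cplus (cint g a b) (cint g a b))).
  { replace (Cplus (cint g a b) (cint g a b)) with (Cmult (RtoC 2) (cint g a b)) by ring.
    rewrite Cmod_mult, Cmod_R, Rabs_pos_eq; lra. }
  rewrite T in T2. pose proof (Cmod_triangle3 (cint g a (a + d)) (cint g (b - d) b) (cint (fun x => Cmult (Cminus (q x) (q (x + d))) (E x)) a (b - d))) as T3.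
  pose proof (gb a (a + d) ltac:(lra) ltac:(lra) ltac:(lra)).
  pose proof (gb (b - d) b ltac:(lra) ltac:(lra) ltac:(lra)).
  assert ((b - d - a) * (e / (b - a)) <= e).
  { assert ((b - a) * (e / (b - a)) = e) by (field; lra). nra. }
  nra.
Qed.

(** * Fourier coefficients over a window *)

Definition Zpartial (u : Z -> C) (m n : nat) : C :=
  Cplus (Csum_n (fun k => u (Z.of_nat k)) n)
        (Csum_n (fun k => u (- Z.of_nat (S k))%Z) m).

Lemma Csum_n_S (v : nat -> C) (n : nat) :
  Csum_n v (S n) = Cplus (Csum_n v n) (v (S n)) :> C.
Proof. exact (sum_Sn (G := C_AbelianMonoid) v n). Qed.

Lemma Csum_n_0 (v : nat -> C) : Csum_n v 0 = v 0%nat :> C.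
Proof. exact (sum_O (G := C_AbelianMonoid) v). Qed.

Lemma Csum_n_minus (u v : nat -> C) (n : nat) :
  Csum_n (fun k => Cminus (u k) (v k)) n =
  Cminus (Csum_n u n) (Csum_n v n) :> C.
Proof.
  induction n as [|n IH]; [rewrite !Csum_n_0; reflexivity|]. rewrite !Csum_n_S, IH. ring.
Qed.

Lemma Zpartial_ext (u v : Z -> C) (m n : nat) : (forall k, u k = v k) -> Zpartial u m n = Zpartial v m n.
Proof. intros E. unfold Zpartial. f_equal; apply sum_n_ext; intros; apply E. Qed.

Lemma Zpartial_minus (u v : Z -> C) (m n : nat) :
  Zpartial (fun k => Cminus (u k) (v k)) m n = Cminus (Zpartial u m n) (Zpartial v m n).
Proof. unfold Zpartial. rewrite !Csum_n_minus. ring. Qed.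

Lemma Zpartial_plus (u v : Z -> C) (m n : nat) :
  Zpartial (fun k => Cplus (u k) (v k)) m n = Cplus (Zpartial u m n) (Zpartial v m n).
Proof.
  replace (Zpartial u m n) with (Zpartial (fun k => Cminus (Cplus (u k) (v k)) (v k)) m n).
  - rewrite Zpartial_minus. ring.
  - apply Zpartial_ext. intros k. ring.
Qed.

Lemma Zpartial_telescope (r : Z -> C) (n : nat) :
  Zpartial (fun k => Cminus (r (k - 1)%Z) (r k)) n n =
  Cminus (r (- Z.of_nat n - 2)%Z) (r (Z.of_nat n)).
Proof.
  induction n as [|n IH].
  - unfold Zpartial. rewrite !Csum_n_0. simpl. ring.
  - unfold Zpartial in *. rewrite !Csum_n_S.
    match type of IH with Cplus ?A ?B = _ =>
      match goal with |- Cplus (Cplus ?A' ?x) (Cplus ?B' ?y) = _ =>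
        transitivity (Cplus (Cplus A B) (Cplus x y)); [ring|] end end.
    rewrite IH.
    replace (Z.of_nat (S n) - 1)%Z with (Z.of_nat n) by lia.
    replace (- Z.of_nat (S (S n)) - 1)%Z with (- Z.of_nat (S n) - 2)%Z by lia.
    replace (- Z.of_nat (S (S n)))%Z with (- Z.of_nat n - 2)%Z by lia. ring.
Qed.

Lemma Zpartial_delta (a : C) (u : Z -> C) (m n : nat) : u 0%Z = a -> (forall k, k <> 0%Z -> u k = RtoC 0) ->
  Zpartial u m n = a.
Proof.
  intros E Z. unfold Zpartial.
  replace (sum_n _ m) with (RtoC 0).
  - replace (sum_n _ n) with a; [ring|]. induction n as [|n IH].
    + rewrite Csum_n_0. symmetry; exact E.
    + rewrite Csum_n_S, <- IH, Z by lia. ring.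
  - induction m as [|m IH].
    + rewrite Csum_n_0, Z by lia. reflexivity.
    + rewrite Csum_n_S, <- IH, Z by lia. ring.
Qed.

Lemma Cdiv_minus_r (a l d : C) : d <> RtoC 0 -> Cminus (Cdiv a d) l = Cdiv (Cminus a (Cmult l d)) d.
Proof. intros Hd. field. exact Hd. Qed.

Section Cell.
Variables (f : C -> C) (h : R).
Hypothesis h_pos : 0 < h.
Hypothesis f_cont : forall x : R, Ccont f (x, 0).
Hypothesis f_diff : forall x : R, Cdiffable f (x, 0).

Definition coef (k : Z) (X Y : R) : C := cint (fourier_integrand f (IZR k / h)) X Y.

Lemma slope_lim (H : C -> C) (m : R) (l : C) : Cderiv H (m, 0) l ->
  filterlim (fun x => Cdiv (Cminus (H (x, 0)) (H (m, 0))) (RtoC (x - m))) (locally' m)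
    (Clocally l).
Proof.
  intros D. apply (C_filterlim _ (locally' m)). intros e He.
  destruct (proj1 (Cderiv_eps H (m, 0) l) D (e / 2) ltac:(lra)) as [d [Hd K]].
  exists (mkposreal d Hd). intros x Hx Nx.
  assert (E : Cminus (x, 0) (m, 0) = RtoC (x - m)).
  { unfold Cminus, Cplus, Copp, RtoC; simpl; f_equal; ring. }
  specialize (K (x, 0)). rewrite E, Cmod_R in K. specialize (K Hx).
  assert (N : RtoC (x - m) <> RtoC 0) by (apply RtoC_neq_0; lra).
  cbv beta. rewrite (Cdiv_minus_r _ _ _ N).
  rewrite Cmod_div, Cmod_R by exact N.
  assert (0 < Rabs (x - m)) by (apply Rabs_pos_lt; lra).
  apply Rle_lt_trans with (e / 2); [|lra]. apply Rle_div_l; assumption.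
Qed.

Lemma cint_expi (k : Z) (m : R) :
  cint (fun x => expi (- (2 * PI * x * (IZR k / h)))) (m - h / 2) (m + h / 2) =
  (if Z.eq_dec k 0 then RtoC h else RtoC 0) :> C.
Proof.
  destruct (Z.eq_dec k 0) as [->|Nk].
  - rewrite (cint_ext _ (fun _ => RtoC 1)).
    + rewrite (RInt_const (V := C_R_CompleteNormedModule)).
      change (scal (V := C_R_ModuleSpace) (m + h / 2 - (m - h / 2)) (RtoC 1) = RtoC h).
      rewrite scal_R_Cmult, Cmult_1_r. f_equal. field.
    + lra.
    + intros x _. replace (- (2 * PI * x * (0 / h))) with 0 by (field; lra). apply expi_0.
  - set (xi := IZR k / h).
    assert (Nx : freq xi <> RtoC 0).
    { intros E. apply (f_equal Im) in E. unfold freq, Cmult, RtoC, Ci in E. simpl in E.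
      apply Nk, eq_IZR. pose proof PI_RGT_0. assert (xi = 0) by nra.
      unfold xi in *. replace (IZR k) with (IZR k / h * h) by (field; lra). rewrite H0. ring. }
    rewrite (cint_ext _ (fun x => cexp (Cmult (freq xi) (x, 0)))).
    2: lra.
    2: { intros x _. rewrite cexp_freq, Rmult_0_r, exp_0, Cmult_1_l. reflexivity. }
    assert (Lm : m - h / 2 <= m + h / 2) by lra.
    rewrite (cint_row_FTC _ _ Lm (fun w => Cmult (Cinv (freq xi)) (cexp (Cmult (freq xi) w))) (fun w => cexp (Cmult (freq xi) w))).
    + rewrite !cexp_freq, Rmult_0_r.
      replace (- (2 * PI * (m + h / 2) * xi)) with (- (2 * PI * (m - h / 2) * xi) + 2 * PI * IZR (- k)).
      2: { unfold xi. rewrite opp_IZR. field. lra. }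
      rewrite expi_plus, expi_period. ring.
    + intros x _. split; [|apply cexp_freq_cont].
      eapply Cderiv_eq; [apply Cderiv_mult; [apply Cderiv_const|apply Cderiv_cexp]|].
      cbv beta. field. exact Nx.
Qed.

Lemma expi_neq_1 (t : R) : - PI <= t <= PI -> t <> 0 -> expi t <> RtoC 1.
Proof.
  intros Ht Nt E. pose proof (f_equal fst E) as Ec. simpl in Ec.
  assert (P : forall s, 0 < s <= PI -> cos s = 1 -> False).
  { intros s Hs Hc. pose proof PI_RGT_0. rewrite <- cos_0 in Hc.
    pose proof (cos_decreasing_1 0 s ltac:(lra) ltac:(lra) ltac:(lra) ltac:(lra) ltac:(lra)). lra. }
  destruct (Rlt_dec 0 t) as [L|L].
  - apply (P t); [lra|exact Ec].
  - apply (P (- t)); [lra|rewrite cos_neg; exact Ec].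
Qed.

(** On the closed cell the denominator exp(2 pi i x/h) - 1 vanishes only at the
    centre, and simply, so differentiability of [f] there makes the quotient
    continuous. *)
Lemma cell_quotient (n : Z) : exists q : R -> C,
  (forall x, IZR n * h - h / 2 <= x <= IZR n * h + h / 2 ->
     RCcont q x /\
     f (x, 0) = Cplus (f (IZR n * h, 0)) (Cmult (Cminus (expi (2 * PI * x / h)) (RtoC 1)) (q x))).
Proof.
  set (m := IZR n * h). set (psi := fun w => cexp (Cmult (freq (- / h)) w)).
  assert (Epsi : forall x, psi (x, 0) = expi (2 * PI * x / h)).
  { intros x. unfold psi. rewrite cexp_freq, Rmult_0_r, exp_0, Cmult_1_l. f_equal. field. lra. }
  assert (Em : psi (m, 0) = RtoC 1).
  { rewrite Epsi. rewrite <- (expi_period n). f_equal. unfold m. field. lra. }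
  destruct (f_diff m) as [l Dl]. pose proof (Cderiv_cexp (freq (- / h)) (m, 0)) as Dp.
  change (cexp (Cmult (freq (- / h)) (m, 0))) with (psi (m, 0)) in Dp. rewrite Em, Cmult_1_r in Dp.
  change (fun w => cexp (Cmult (freq (- / h)) w)) with psi in Dp.
  assert (Nf : freq (- / h) <> RtoC 0).
  { intros E. apply (f_equal Im) in E. unfold freq, Cmult, RtoC, Ci in E. simpl in E.
    pose proof PI_RGT_0. assert (0 < / h) by (apply Rinv_0_lt_compat, h_pos). nra. }
  assert (Npsi : forall x, m - h / 2 <= x <= m + h / 2 -> x <> m -> psi (x, 0) <> RtoC 1).
  { intros x Hx Nx. rewrite Epsi.
    replace (2 * PI * x / h) with (2 * PI * (x - m) / h + 2 * PI * IZR n) by (unfold m; field; lra).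
    rewrite expi_plus, expi_period, Cmult_1_r. pose proof PI_RGT_0.
    assert (Eh : 2 * PI * (x - m) / h = (x - m) / h * (2 * PI)) by (field; lra).
    assert (Bh : - (1 / 2) <= (x - m) / h <= 1 / 2).
    { split; [apply Rle_div_r|apply Rle_div_l]; lra. }
    apply expi_neq_1; rewrite Eh.
    - nra.
    - intros Z. apply Rmult_integral in Z. destruct Z as [Z|Z]; [|lra].
      apply Nx. replace x with ((x - m) / h * h + m) by (field; lra). rewrite Z. ring. }
  set (q := fun x => if Req_EM_T x m then Cdiv l (freq (- / h)) else
     Cdiv (Cminus (f (x, 0)) (f (m, 0))) (Cminus (psi (x, 0)) (RtoC 1))).
  exists q. intros x Hx. split.
  - destruct (Req_dec x m) as [->|Nx].
    + assert (Q : filterlim q (locally' m) (Clocally (Cdiv l (freq (- / h))))).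
      { apply (filterlim_ext_loc (fun x => Cmult (Cdiv (Cminus (f (x, 0)) (f (m, 0))) (RtoC (x - m)))
          (Cinv (Cdiv (Cminus (psi (x, 0)) (psi (m, 0))) (RtoC (x - m)))))).
        - exists (mkposreal _ (Rdiv_lt_0_compat h 2 h_pos ltac:(lra))). intros y Hy Ny.
          unfold q. destruct (Req_EM_T y m) as [|_]; [contradiction|]. rewrite Em.
          assert (Hy' : Rabs (y - m) < h / 2) by exact Hy. apply Rabs_def2 in Hy'.
          assert (N1 : RtoC (y - m) <> RtoC 0) by (apply RtoC_neq_0; lra).
          pose proof (Cminus_neq_0 _ _ (Npsi y ltac:(lra) Ny)).
          field. auto.
        - apply (filterlim_Cmult (locally' m)); [apply slope_lim, Dl|].
          apply (filterlim_Cinv (locally' m)); [exact Nf|]. apply slope_lim, Dp. }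
      intros P HP. assert (Eq : q m = Cdiv l (freq (- / h))).
      { unfold q. destruct (Req_EM_T m m); [reflexivity|congruence]. }
      rewrite Eq in HP. generalize (Q P HP). unfold filtermap, locally', within. apply filter_imp.
      intros y Hy. destruct (Req_dec y m) as [->|Ny]; [rewrite Eq; exact (locally_singleton _ _ HP)|auto].
    + apply (continuous_ext_loc (U := C_UniformSpace) _ (fun y => Cmult (Cminus (f (y, 0)) (f (m, 0))) (Cinv (Cminus (psi (y, 0)) (RtoC 1))))).
      * assert (A : 0 < Rabs (x - m)) by (apply Rabs_pos_lt; lra).
        exists (mkposreal _ A). intros y Hy. unfold q. destruct (Req_EM_T y m) as [->|_]; [|reflexivity].
        exfalso. assert (Hy' : Rabs (m - x) < Rabs (x - m)) by exact Hy. rewrite Rabs_minus_sym in Hy'. lra.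
      * apply RCcont_mult.
        -- apply RCcont_minus; [apply RCcont_row, f_cont|apply continuous_const].
        -- apply (filterlim_Cinv (locally x) (fun y => Cminus (psi (y, 0)) (RtoC 1)) (Cminus (psi (x, 0)) (RtoC 1))).
           ++ apply Cminus_neq_0, Npsi; auto.
           ++ apply (RCcont_minus (fun y => psi (y, 0)) (fun _ => RtoC 1)); [|apply continuous_const].
              apply RCcont_row, cexp_freq_cont.
  - rewrite <- Epsi. unfold q. destruct (Req_EM_T x m) as [->|Nx].
    + rewrite Em. ring.
    + field. apply Cminus_neq_0, Npsi; auto.
Qed.

Definition coef_sums_to (X Y : R) (T : C) : Prop :=
  filterlim (fun K => Zpartial (fun k => coef k X Y) K K) eventually (Clocally T).

Lemma fourier_integrand_cont (xi x : R) : RCcont (fourier_integrand f xi) x.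
Proof. apply RCcont_mult; [exact (RCcont_row f x 0 (f_cont x))|apply RCcont_expi]. Qed.

Lemma ex_coef (xi X Y : R) : ex_cint (fourier_integrand f xi) X Y.
Proof.
  apply (ex_RInt_continuous (V := C_R_CompleteNormedModule)). intros x _. apply fourier_integrand_cont.
Qed.

Lemma coef_sums_Chasles (X Y Z : R) (S T : C) :
  coef_sums_to X Y S -> coef_sums_to Y Z T -> coef_sums_to X Z (Cplus S T).
Proof.
  intros HS HT.
  apply (filterlim_ext (fun K => Cplus (Zpartial (fun k => coef k X Y) K K) (Zpartial (fun k => coef k Y Z) K K))).
  - intros K. rewrite <- Zpartial_plus. apply Zpartial_ext. intros k. apply cint_Chasles; apply ex_coef.
  - apply (filterlim_Cplus eventually); assumption.
Qed.

(** With the quotient q of [cell_quotient] and [r k] its k-th coefficient, the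
    k-th coefficient of f - f(n h) is r(k - 1) - r(k). The sum telescopes,
    and the two remaining terms tend to 0. *)
Lemma coef_sums_cell (n : Z) :
  coef_sums_to (IZR n * h - h / 2) (IZR n * h + h / 2) (Cmult (RtoC h) (sample f h n)).
Proof.
  destruct (cell_quotient n) as [q Hq].
  set (m := IZR n * h) in *.
  assert (L : m - h / 2 < m + h / 2) by lra.
  set (r := fun k : Z => cint (fun x => Cmult (q x) (expi (- (2 * PI * x * (IZR k / h))))) (m - h / 2) (m + h / 2)).
  assert (Er : forall k, ex_cint (fun x => Cmult (q x) (expi (- (2 * PI * x * (IZR k / h))))) (m - h / 2) (m + h / 2)).
  { intros k. apply ex_cint_cont; [lra|]. intros x Hx. apply RCcont_mult; [apply Hq, Hx|apply RCcont_expi]. }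
  assert (Ee : forall k, ex_cint (fun x => expi (- (2 * PI * x * (IZR k / h)))) (m - h / 2) (m + h / 2)).
  { intros k. apply ex_cint_cont; [lra|]. intros x Hx. apply RCcont_expi. }
  assert (Ec : forall k, coef k (m - h / 2) (m + h / 2) =
    Cplus (Cmult (sample f h n) (if Z.eq_dec k 0 then RtoC h else RtoC 0)) (Cminus (r (k - 1)%Z) (r k))).
  { intros k. unfold coef, r. rewrite <- (cint_expi k m), <- cint_minus, <- cint_mult_l, <- cint_plus by auto using ex_cint_mult_l, ex_cint_minus.
    apply cint_ext; [lra|]. intros x Hx. destruct (Hq x Hx) as [_ E].
    unfold fourier_integrand, sample. change (RtoC x) with ((x, 0) : C). rewrite E.
    change (RtoC (IZR n * h)) with ((m, 0) : C).
    rewrite minus_IZR.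
    replace (- (2 * PI * x * ((IZR k - 1) / h))) with (- (2 * PI * x * (IZR k / h)) + 2 * PI * x / h) by (field; lra).
    rewrite expi_plus. ring. }
  unfold coef_sums_to. apply (C_filterlim _ eventually). intros e He.
  destruct (Riemann_Lebesgue q (m - h / 2) (m + h / 2) L (fun x Hx => proj1 (Hq x Hx)) (e / 3) ltac:(lra)) as (M & HM & RL).
  destruct (nfloor_ex (M * h)) as [K0 HK0]; [nra|].
  exists (S K0). intros K HK.
  rewrite (Zpartial_ext _ _ _ _ Ec), Zpartial_plus, Zpartial_telescope.
  rewrite (Zpartial_delta (Cmult (sample f h n) (RtoC h))).
  2: { destruct (Z.eq_dec 0 0); [reflexivity|congruence]. }
  2: { intros k Nk. destruct (Z.eq_dec k 0); [contradiction|ring]. }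
  assert (RLk : forall k : Z, (Z.of_nat K <= Z.abs k)%Z -> Cmod (r k) <= e / 3).
  { intros k Hk. apply RL. unfold Rdiv. rewrite Rabs_mult, (Rabs_pos_eq (/ h)) by (left; apply Rinv_0_lt_compat, h_pos).
    rewrite <- abs_IZR. apply IZR_le in Hk. rewrite <- INR_IZR_INZ in Hk. apply le_INR in HK. rewrite S_INR in HK.
    change (M < IZR (Z.abs k) / h). apply Rlt_div_r; lra. }
  pose proof (RLk (- Z.of_nat K - 2)%Z ltac:(lia)). pose proof (RLk (Z.of_nat K) ltac:(lia)).
  replace (Cminus _ _) with (Cplus (r (- Z.of_nat K - 2)%Z) (Copp (r (Z.of_nat K)))) by ring.
  eapply Rle_lt_trans; [apply Cmod_triangle|]. rewrite Cmod_opp. lra.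
Qed.

(** Windows consist of whole cells, so their ends lie halfway between two nodes. *)
Definition win_left (m : nat) : R := - (INR m + 1) * h - h / 2.
Definition win_right (n : nat) : R := INR n * h + h / 2.

Theorem coef_sums_window (m n : nat) :
  coef_sums_to (win_left m) (win_right n) (Cmult (RtoC h) (Zpartial (sample f h) m n)).
Proof.
  assert (P : forall n, coef_sums_to (- h / 2) (win_right n)
     (Cmult (RtoC h) (Csum_n (fun k => sample f h (Z.of_nat k)) n))).
  { clear n. induction n as [|n IH].
    - rewrite Csum_n_0. pose proof (coef_sums_cell 0) as K.
      unfold win_right. simpl INR. replace (- h / 2) with (0 * h - h / 2) by field. exact K.
    - rewrite Csum_n_S, Cmult_plus_distr_l. apply (coef_sums_Chasles _ _ _ _ _ IH).
      pose proof (coef_sums_cell (Z.of_nat (S n))) as K. rewrite <- INR_IZR_INZ in K.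
      unfold win_right. replace (INR n * h + h / 2) with (INR (S n) * h - h / 2) by (rewrite S_INR; field). exact K. }
  assert (Q : forall m, coef_sums_to (win_left m) (- h / 2)
     (Cmult (RtoC h) (Csum_n (fun k => sample f h (- Z.of_nat (S k))%Z) m))).
  { clear m. induction m as [|m IH].
    - rewrite Csum_n_0. pose proof (coef_sums_cell (-1)) as K.
      unfold win_left. simpl INR. replace (- h / 2) with (-1 * h + h / 2) by field.
      replace (- (0 + 1) * h - h / 2) with (-1 * h - h / 2) by ring. exact K.
    - rewrite Csum_n_S, Cmult_plus_distr_l, Cplus_comm. refine (coef_sums_Chasles _ _ _ _ _ _ IH).
      pose proof (coef_sums_cell (- Z.of_nat (S (S m)))) as K. rewrite opp_IZR, <- INR_IZR_INZ in K.
      unfold win_left. replace (- (INR (S m) + 1) * h - h / 2) with (- INR (S (S m)) * h - h / 2) by (rewrite !S_INR; ring).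
      replace (- (INR m + 1) * h - h / 2) with (- INR (S (S m)) * h + h / 2) by (rewrite !S_INR; field). exact K. }
  unfold Zpartial. rewrite Cmult_plus_distr_l, Cplus_comm.
  exact (coef_sums_Chasles _ _ _ _ _ (Q m) (P n)).
Qed.
End Cell.

Lemma Zseries_eq {V : CompleteNormedModule R_AbsRing} (u : Z -> V) (l : V) :
  is_Zseries u l -> Zseries u = l.
Proof.
  intros K. apply (iota_unique (V := V) (is_Zseries u) l); [|exact K].
  intros y (lp & ln & Kp & Kn & ->). destruct K as (mp & mn & Mp & Mn & ->).
  assert (E1 : lp = mp) by exact (filterlim_locally_unique (V := V) _ _ _ Kp Mp).
  assert (E2 : ln = mn) by exact (filterlim_locally_unique (V := V) _ _ _ Kn Mn).
  rewrite E1, E2. reflexivity.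
Qed.

(** * Two-sided series *)

Lemma Csub_add (a b : C) : a = Cplus (Cminus a b) b.
Proof. ring. Qed.

Lemma is_series_prepend {V : NormedModule R_AbsRing} (a : nat -> V) (l m : V) :
  is_series (fun n => a (S n)) l -> m = plus l (a 0%nat) -> is_series a m.
Proof.
  intros K ->. apply is_series_decr_1.
  assert (E : forall (G : AbelianGroup) (x y : G), x = plus (plus x y) (opp y)).
  { intros G x y. rewrite <- plus_assoc, plus_opp_r, plus_zero_r. reflexivity. }
  exact (eq_ind l (is_series (fun n => a (S n))) K _ (E V l (a 0%nat))).
Qed.

Lemma Cmod_lim_le (u : nat -> C) (l : C) (b : R) :
  filterlim u eventually (Clocally l) ->
  (forall n, Cmod (u n) <= b) -> Cmod l <= b.
Proof.
  intros K B. apply le_epsilon. intros e He.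
  destruct (proj1 (C_filterlim u eventually l) K e He) as [n Hn].
  specialize (Hn n (le_n n)). rewrite Cmod_sub_comm in Hn.
  replace l with (Cplus (u n) (Cminus l (u n))) by ring.
  eapply Rle_trans; [apply Cmod_triangle|]. specialize (B n). lra.
Qed.

Lemma Zpartial_lim (u : Z -> C) (l : C) : is_Zseries (V := C_R_CompleteNormedModule) u l ->
  filterlim (fun n => Zpartial u n n) eventually (Clocally l).
Proof.
  intros (lp & ln & Kp & Kn & ->). exact (filterlim_Cplus eventually _ _ lp ln Kp Kn).
Qed.

(** Fixing one index in the joint limit makes the partial sums of the other half
    a Cauchy sequence. *)
Lemma is_Zseries_of_joint_limit (u : Z -> C) (l : C) :
  (forall e, 0 < e -> exists N0 : nat, forall m n, (N0 <= m)%nat -> (N0 <= n)%nat ->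
     Cmod (Cminus (Zpartial u m n) l) < e) ->
  is_Zseries (V := C_R_CompleteNormedModule) u l.
Proof.
  intros J.
  set (p := Csum_n (fun k => u (Z.of_nat k))).
  set (q := Csum_n (fun k => u (- Z.of_nat (S k))%Z)).
  assert (Cau : forall (s t : nat -> C),
    (forall e, 0 < e -> exists N0 : nat, forall m n, (N0 <= m)%nat -> (N0 <= n)%nat ->
      Cmod (Cminus (Cplus (s n) (t m)) l) < e) ->
    exists y, filterlim s eventually (Clocally y)).
  { intros s t Jst. apply (filterlim_locally_cauchy (U := C_R_CompleteNormedModule)). intros e.
    destruct (Jst (e / 2)) as [N0 H]; [pose proof (cond_pos e); lra|].
    exists (fun n => (N0 <= n)%nat). split; [exists N0; auto|]. intros m n Hm Hn.
    apply C_NormedModule_mixin_compat1.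
    change (Cmod (Cminus (s n) (s m)) < e).
    pose proof (H N0 n (le_n _) Hn) as H1. pose proof (H N0 m (le_n _) Hm) as H2.
    rewrite Cmod_sub_comm in H2.
    replace (Cminus (s n) (s m)) with (Cplus (Cminus (Cplus (s n) (t N0)) l) (Cminus l (Cplus (s m) (t N0)))) by ring.
    eapply Rle_lt_trans; [apply Cmod_triangle|]. lra. }
  destruct (Cau p q J) as [lp Hp].
  destruct (Cau q p) as [ln Hn].
  { intros e He. destruct (J e He) as [N0 H]. exists N0. intros m n Hm Hn.
    rewrite (Cplus_comm (q n)). apply H; assumption. }
  exists lp, ln. repeat split; [exact Hp|exact Hn|].
  assert (L1 : filterlim (fun n => Zpartial u n n) eventually (Clocally (Cplus lp ln))).
  { exact (filterlim_Cplus eventually _ _ lp ln Hp Hn). }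
  assert (L2 : filterlim (fun n => Zpartial u n n) eventually (Clocally l)).
  { apply (C_filterlim _ eventually). intros e He. destruct (J e He) as [N0 H].
    exists N0. intros n Hn'. apply H; assumption. }
  exact (filterlim_locally_unique (V := C_R_NormedModule) _ _ _ L2 L1).
Qed.

Lemma ex_Cseries_le (v : nat -> C) (b : nat -> R) : (forall n, Cmod (v n) <= b n) -> ex_series b ->
  ex_series (V := C_R_NormedModule) v.
Proof.
  intros B E. apply (ex_series_le (V := C_R_CompleteNormedModule) v b); [|exact E].
  intros n. eapply Rle_trans; [right; symmetry; apply Cmod_norm|apply B].
Qed.

Lemma partial_sum_le_series (b : nat -> R) (l : R) (n : nat) : (forall k, 0 <= b k) ->
  is_series b l -> sum_n b n <= l.
Proof.
  intros P K. apply Rnot_lt_le. intros L.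
  assert (Mono : forall k, sum_n b n <= sum_n b (n + k)).
  { induction k as [|k IH]; [rewrite Nat.add_0_r; lra|].
    rewrite Nat.add_succ_r, sum_Sn. specialize (P (S (n + k))).
    change (sum_n b n <= sum_n b (n + k) + b (S (n + k))). lra. }
  assert (He : 0 < sum_n b n - l) by lra.
  destruct (K _ (locally_ball l (mkposreal _ He))) as [N0 H].
  specialize (H (n + N0)%nat ltac:(lia)). specialize (Mono N0).
  assert (H' : Rabs (sum_n b (n + N0) - l) < sum_n b n - l) by exact H.
  apply Rabs_def2 in H'. lra.
Qed.

Lemma Cmod_sum_n_le (v : nat -> C) (b : nat -> R) (n : nat) : (forall k, Cmod (v k) <= b k) ->
  Cmod (Csum_n v n) <= sum_n b n.
Proof.
  intros B. induction n as [|n IH].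
  - rewrite Csum_n_0, sum_O. apply B.
  - rewrite Csum_n_S, sum_Sn. eapply Rle_trans; [apply Cmod_triangle|].
    apply Rplus_le_compat; [exact IH|apply B].
Qed.

Lemma Cmod_Zseries_le (u : Z -> C) (b : Z -> R) (l : C) (s : R) :
  (forall k, Cmod (u k) <= b k) -> is_Zseries (V := C_R_CompleteNormedModule) u l ->
  is_Zseries (V := R_CompleteNormedModule) b s -> Cmod l <= s.
Proof.
  intros B Ku (sp & sn & Kp & Kn & ->).
  apply (Cmod_lim_le _ _ _ (Zpartial_lim u l Ku)). intros n. unfold Zpartial.
  assert (P : forall k, 0 <= b k) by (intros k; eapply Rle_trans; [apply Cmod_ge_0|apply B]).
  eapply Rle_trans; [apply Cmod_triangle|]. apply Rplus_le_compat.
  - eapply Rle_trans; [apply (Cmod_sum_n_le _ (fun k => b (Z.of_nat k))); intros; apply B|].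
    apply partial_sum_le_series; auto.
  - eapply Rle_trans; [apply (Cmod_sum_n_le _ (fun k => b (- Z.of_nat (S k))%Z)); intros; apply B|].
    apply partial_sum_le_series; auto.
Qed.

Lemma exp_INR_mult (n : nat) (x : R) : exp (x * INR n) = exp x ^ n.
Proof.
  induction n as [|n IH]; [simpl; rewrite Rmult_0_r; apply exp_0|].
  rewrite S_INR, Rmult_plus_distr_l, Rmult_1_r, exp_plus, IH. simpl. ring.
Qed.

Lemma geometric_sum_le (v : nat -> C) (T q : R) (n : nat) : 0 <= T -> 0 <= q < 1 ->
  (forall k, Cmod (v k) <= q ^ k * T) -> Cmod (Csum_n v n) <= T / (1 - q).
Proof.
  intros HT Hq B.
  assert (I : (1 - q) * Cmod (Csum_n v n) <= T * (1 - q ^ S n)).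
  { induction n as [|n IH].
    - rewrite Csum_n_0. specialize (B 0%nat). simpl in *.
      replace (T * (1 - q * 1)) with ((1 - q) * (1 * T)) by ring. apply Rmult_le_compat_l; lra.
    - rewrite Csum_n_S.
      apply Rle_trans with ((1 - q) * (Cmod (Csum_n v n) + Cmod (v (S n)))).
      + apply Rmult_le_compat_l; [lra|apply Cmod_triangle].
      + specialize (B (S n)). change (q ^ S (S n)) with (q * q ^ S n).
        assert ((1 - q) * Cmod (v (S n)) <= (1 - q) * (q ^ S n * T)) by (apply Rmult_le_compat_l; lra).
        lra. }
  apply Rle_div_r; [lra|]. assert (0 <= q ^ S n) by (apply pow_le; lra). nra.
Qed.

Lemma cexp_INR_mult (n : nat) (z : C) : cexp (Cmult (RtoC (INR n)) z) = Cpow (cexp z) n.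
Proof.
  induction n as [|n IH].
  - simpl. rewrite Cmult_0_l. apply cexp_0.
  - rewrite S_INR, RtoC_plus, Cmult_plus_distr_r, Cmult_1_l, cexp_plus, IH. simpl. ring.
Qed.

(** The geometric sum (1 - (-r)^(n+1)) / (1 + r) lies between 0 and 1. *)
Lemma alternating_sum_le (r : R) (m n : nat) : 0 <= r <= 1 ->
  Cmod (Csum_n (fun k => Cpow (RtoC (- r)) (m + k)) n) <= 1.
Proof.
  intros Hr.
  assert (E : Csum_n (fun k => Cpow (RtoC (- r)) (m + k)) n =
    RtoC ((- r) ^ m * ((1 - (- r) ^ S n) / (1 + r))) :> C).
  { induction n as [|n IH].
    - rewrite Csum_n_0, Nat.add_0_r, <- RtoC_pow. f_equal. field. lra.
    - rewrite Csum_n_S, IH, <- RtoC_pow, <- RtoC_plus. f_equal.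
      rewrite pow_add. simpl. field. lra. }
  rewrite E, Cmod_R, Rabs_mult.
  assert (Pm : forall j, Rabs ((- r) ^ j) <= 1).
  { intros j. rewrite <- RPow_abs, Rabs_Ropp, Rabs_pos_eq by lra.
    rewrite <- (pow1 j). apply pow_incr; lra. }
  assert (Ps : Rabs ((- r) ^ S n) <= r).
  { simpl. rewrite Rabs_mult, Rabs_Ropp, (Rabs_pos_eq r) by lra. specialize (Pm n). nra. }
  apply Rabs_le_between in Ps.
  assert (Q : Rabs ((1 - (- r) ^ S n) / (1 + r)) <= 1).
  { rewrite Rabs_pos_eq.
    - apply Rle_div_l; lra.
    - apply Rdiv_le_0_compat; lra. }
  specialize (Pm m). pose proof (Rabs_pos ((- r) ^ m)). pose proof (Rabs_pos ((1 - (- r) ^ S n) / (1 + r))). nra.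
Qed.

(** * Shifting the line of integration *)

Section Shift.

Variables (f : C -> C) (a0 : R) (zs : list C) (N : C -> nat) (c : C -> nat -> C).
Hypothesis a0_pos : 0 < a0.
Hypothesis zs_nodup : NoDup zs.
Hypothesis zs_strip : forall z, In z zs -> Rabs (Im z) < a0.
Hypothesis zs_nonreal : forall z, In z zs -> Im z <> 0.
Hypothesis f_cont : forall z, ~ In z zs -> Ccont f z.
Hypothesis f_diff : forall z, Rabs (Im z) < a0 -> ~ In z zs -> Cdiffable f z.
Hypothesis f_ppart : forall z, In z zs -> has_principal_part f z (N z) (c z).

Definition modulated (xi : R) (w : C) : C := Cmult (f w) (cexp (Cmult (freq xi) w)).

Lemma modulated_cont (xi : R) (z : C) : ~ In z zs -> Ccont (modulated xi) z.
Proof. intros Nz. apply Ccont_mult; [apply f_cont, Nz|apply cexp_freq_cont]. Qed.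

Lemma modulated_real (xi x : R) : modulated xi (x, 0) = fourier_integrand f xi x.
Proof.
  unfold modulated, fourier_integrand. rewrite cexp_freq, Rmult_0_r, exp_0, Cmult_1_l. reflexivity.
Qed.

Definition between (y0 y1 : R) (z : C) : bool :=
  if Rlt_dec y0 (Im z) then if Rlt_dec (Im z) y1 then true else false else false.

Lemma between_spec (y0 y1 : R) (z : C) : between y0 y1 z = true <-> y0 < Im z < y1.
Proof.
  unfold between. destruct (Rlt_dec y0 (Im z)), (Rlt_dec (Im z) y1); split; try discriminate; intuition; lra.
Qed.

Definition residue_sum (xi y0 y1 : R) : C :=
  Csum (map (fun z => model_residue (freq xi) z (N z) (c z)) (filter (between y0 y1) zs)).

Lemma Rect_modulated (xi X Y y0 y1 : R) : X <= Y -> y0 <= y1 -> - a0 <= y0 -> y1 <= a0 ->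
  (forall z, In z zs -> X < Re z < Y /\ Im z <> y0 /\ Im z <> y1) ->
  Rect (modulated xi) X Y y0 y1 = residue_sum xi y0 y1.
Proof.
  intros LX LY Hy0 Hy1 Av.
  rewrite (Rect_residues (fun z => pole_model (freq xi) z (N z) (c z)) zs X Y y0 y1 LX LY) with
    (zs := filter (between y0 y1) zs).
  - unfold residue_sum. f_equal. apply map_ext_in. intros z Hz. apply filter_In in Hz.
    destruct Hz as [I B]. apply between_spec in B. apply Rect_pole_model; [apply Av, I|exact B].
  - intros z w Nw. apply ex_Cderiv_pole_model, Nw.
  - apply NoDup_filter, zs_nodup.
  - intros z Hz. apply filter_In in Hz. destruct Hz as [I B]. apply between_spec in B.
    split; [apply Av, I|exact B].
  - intros z Hz. apply filter_In in Hz. apply Hz.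
  - intros z [Z1 Z2] Nz. apply modulated_cont. intros I. apply Nz. apply filter_In. split; [exact I|].
    apply between_spec. destruct (Av z I) as (_ & E0 & E1). lra.
  - intros z Z1 Z2 Nz. destruct (f_diff z) as [l Dl]; [apply Rabs_def1; lra|exact Nz|].
    eexists. apply Cderiv_mult; [exact Dl|apply Cderiv_cexp].
  - intros z Hz. apply filter_In in Hz. destruct Hz as [I _].
    destruct (f_ppart z I) as (g & Hg & Hf).
    exists (Cmult (g z) (cexp (Cmult (freq xi) z))).
    apply (filterlim_ext_loc (fun w => Cmult (g w) (cexp (Cmult (freq xi) w)))).
    { generalize Hf. apply filter_imp. intros w E. unfold modulated, pole_model.
      fold (ppart z (N z) (c z) w) in E. rewrite E. ring. }
    apply (filterlim_filter_le_1 (F := Clocally z)); [apply filter_le_within|].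
    apply (Ccont_mult g (fun w => cexp (Cmult (freq xi) w))).
    + apply ex_Cderiv_cont. exact (locally_singleton (T := C_UniformSpace) z _ Hg).
    + apply cexp_freq_cont.
Qed.

(** The sign is that of the contour, which leaves the real axis towards height
    [t] and so runs clockwise for [t < 0]. *)
Definition side_residues (t xi : R) : C :=
  if Rlt_dec 0 t then residue_sum xi 0 t else Copp (residue_sum xi t 0).

Definition rowint (xi y X Y : R) : C := cint (fun x => modulated xi (x, y)) X Y.
Definition colint (xi t X : R) : C := cint (fun y => modulated xi (X, y)) 0 t.
Definition ends (xi t X Y : R) : C := Cmult Ci (Cminus (colint xi t Y) (colint xi t X)).

Definition clear_of_poles (X : R) : Prop := forall z, In z zs -> Rabs (Re z) < Rabs X.

(** Only poles between the real axis and the line at height [t] enter; both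
    orientations are treated by reversing the vertical integrals. *)
Lemma shift_identity (xi t X Y : R) : Rabs t = a0 -> X < 0 < Y ->
  clear_of_poles X -> clear_of_poles Y ->
  Cplus (rowint xi 0 X Y) (ends xi t X Y) = Cplus (rowint xi t X Y) (side_residues t xi).
Proof.
  intros Ht HXY CX CY.
  assert (P : forall z, In z zs -> X < Re z < Y /\ Im z <> 0 /\ Im z <> t).
  { intros z I. specialize (CX z I). specialize (CY z I). pose proof (zs_strip z I).
    rewrite (Rabs_pos_eq Y) in CY by lra. rewrite (Rabs_left1 X) in CX by lra.
    apply Rabs_def2 in CX. apply Rabs_def2 in CY. repeat split; try lra.
    - apply zs_nonreal, I.
    - intros E. rewrite E in H. lra. }
  unfold ends, colint, rowint, side_residues.
  destruct (Rlt_dec 0 t) as [T|T].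
  - rewrite Rabs_pos_eq in Ht by lra.
    rewrite <- (Rect_modulated xi X Y 0 t) by (lra || exact P). unfold Rect. ring.
  - assert (T' : t < 0) by (destruct (Req_dec t 0) as [->|]; [rewrite Rabs_R0 in Ht; lra|lra]).
    rewrite Rabs_left in Ht by lra.
    rewrite <- (Rect_modulated xi X Y t 0) by (try lra; intros z I; destruct (P z I) as (? & ? & ?); auto).
    unfold Rect.
    assert (SW : forall h : R -> C, ex_cint h t 0 -> cint h 0 t = Copp (cint h t 0)).
    { intros h E. symmetry. apply (opp_RInt_swap (V := C_R_CompleteNormedModule)). exact E. }
    assert (EC : forall Z, clear_of_poles Z -> ex_cint (fun y => modulated xi (Z, y)) t 0).
    { intros Z CZ. apply ex_cint_cont; [lra|]. intros y _. apply RCcont_col, modulated_cont.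
      intros I. specialize (CZ _ I). simpl in CZ. lra. }
    rewrite !SW by (apply EC; assumption). ring.
Qed.

Definition colmass (X : R) : R := RInt (fun y => Cmod (f (X, y))) (- a0) a0.

Lemma clear_notin (X y : R) : clear_of_poles X -> ~ In (X, y) zs.
Proof. intros CX I. specialize (CX _ I). simpl in CX. lra. Qed.

Lemma Cmod_col_continuous (X : R) : clear_of_poles X -> forall y, continuous (fun y => Cmod (f (X, y))) y.
Proof. intros CX y. apply (RCcont_Cmod (fun y => f (X, y))), RCcont_col, f_cont, clear_notin, CX. Qed.

(** The weight is a single exponential when one frequency is shifted, and a
    partial sum of exponentials when a whole half of the Poisson series is. *)
Lemma weighted_col_le (t X : R) (g : R -> C) : Rabs t = a0 -> clear_of_poles X ->
  (forall y, RCcont g y) ->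
  (forall y, 0 <= y * t -> Rabs y <= a0 -> Cmod (g y) <= 1) ->
  Cmod (cint (fun y => Cmult (f (X, y)) (g y)) 0 t) <= colmass X.
Proof.
  intros Ht CX Cg Bg.
  assert (K : forall y, RCcont (fun y => Cmult (f (X, y)) (g y)) y).
  { intros y. apply (filterlim_Cmult (locally y)); [|apply Cg].
    apply (RCcont_col f), f_cont, clear_notin, CX. }
  assert (E : forall u v, ex_RInt (fun y => Cmod (f (X, y))) u v).
  { intros u v. apply (ex_RInt_continuous (V := R_CompleteNormedModule)). intros y _. apply Cmod_col_continuous, CX. }
  assert (Half : forall u v, - a0 <= u -> u <= v -> v <= a0 -> (forall y, u <= y <= v -> 0 <= y * t) ->
    Cmod (cint (fun y => Cmult (f (X, y)) (g y)) u v) <= colmass X).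
  { intros u v Hu Huv Hv Hyt. apply Rle_trans with (RInt (fun y => Cmod (f (X, y))) u v).
    - apply Cmod_cint_le; auto.
      + apply ex_cint_cont; auto.
      + intros y Hy. rewrite Cmod_mult. pose proof (Cmod_ge_0 (f (X, y))).
        assert (Cmod (g y) <= 1) by (apply Bg; [auto|apply Rabs_le; lra]). nra.
    - unfold colmass. rewrite <- (RInt_Chasles (V := R_CompleteNormedModule) _ (- a0) u a0) by auto.
      rewrite <- (RInt_Chasles (V := R_CompleteNormedModule) _ u v a0) by auto.
      assert (0 <= RInt (fun y => Cmod (f (X, y))) (- a0) u) by (apply RInt_ge_0; auto; intros; apply Cmod_ge_0).
      assert (0 <= RInt (fun y => Cmod (f (X, y))) v a0) by (apply RInt_ge_0; auto; intros; apply Cmod_ge_0).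
      change (RInt (fun y => Cmod (f (X, y))) u v <= RInt (fun y => Cmod (f (X, y))) (- a0) u +
        (RInt (fun y => Cmod (f (X, y))) u v + RInt (fun y => Cmod (f (X, y))) v a0)). lra. }
  destruct (Rle_dec 0 t) as [T|T].
  - rewrite Rabs_pos_eq in Ht by lra. apply Half; try lra. intros y Hy. nra.
  - rewrite Rabs_left in Ht by lra.
    rewrite <- (opp_RInt_swap (V := C_R_CompleteNormedModule)).
    + change (Cmod (Copp (cint (fun y => Cmult (f (X, y)) (g y)) t 0)) <= colmass X).
      rewrite Cmod_opp. apply Half; try lra. intros y Hy. nra.
    + apply ex_cint_cont; [lra|auto].
Qed.

Lemma exponent_nonpos (xi t y : R) : Rabs t = a0 -> xi * t <= 0 -> 0 <= y * t -> 2 * PI * xi * y <= 0.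
Proof.
  intros Ht Hxi Hy. pose proof PI_RGT_0.
  assert (0 < t * t). { rewrite <- (Rabs_pos_eq (t * t)) by nra. rewrite Rabs_mult, Ht. nra. }
  assert (xi * y <= 0). { apply Rnot_lt_le. intros B.
    assert (0 <= (xi * y) * (t * t)) by nra.
    assert ((xi * t) * (y * t) <= 0) by nra. nra. }
  replace (2 * PI * xi * y) with (2 * PI * (xi * y)) by ring. nra.
Qed.

Lemma colint_le (xi t X : R) : Rabs t = a0 -> xi * t <= 0 -> clear_of_poles X ->
  Cmod (colint xi t X) <= colmass X.
Proof.
  intros Ht Hxi CX. unfold colint, modulated.
  apply (weighted_col_le t X (fun y => cexp (Cmult (freq xi) (X, y)))); auto.
  - intros y. exact (RCcont_col _ X y (cexp_freq_cont xi (X, y))).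
  - intros y Hy _. rewrite Cmod_cexp_freq. simpl. apply exp_le_1. apply exponent_nonpos with t; auto.
Qed.

Lemma ends_le (xi t X Y : R) : Rabs t = a0 -> xi * t <= 0 -> clear_of_poles X -> clear_of_poles Y ->
  Cmod (ends xi t X Y) <= colmass X + colmass Y.
Proof.
  intros Ht Hxi CX CY. unfold ends. rewrite Cmod_mult, Cmod_Ci, Rmult_1_l.
  unfold Cminus. eapply Rle_trans; [apply Cmod_triangle|]. rewrite Cmod_opp.
  pose proof (colint_le xi t X Ht Hxi CX). pose proof (colint_le xi t Y Ht Hxi CY). lra.
Qed.

Definition rowmass (t X Y : R) : R := RInt (fun x => Cmod (f (x, t))) X Y.

Lemma row_notin (t x : R) : Rabs t = a0 -> ~ In (x, t) zs.
Proof. intros Ht I. apply zs_strip in I. simpl in I. lra. Qed.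

Lemma Cmod_row_continuous (t : R) : Rabs t = a0 -> forall x, continuous (fun x => Cmod (f (x, t))) x.
Proof. intros Ht x. apply (RCcont_Cmod (fun x => f (x, t))), RCcont_row, f_cont, row_notin, Ht. Qed.

Lemma ex_rowmass (t X Y : R) : Rabs t = a0 -> ex_RInt (fun x => Cmod (f (x, t))) X Y.
Proof.
  intros Ht. apply (ex_RInt_continuous (V := R_CompleteNormedModule)).
  intros x _. apply Cmod_row_continuous, Ht.
Qed.

Lemma ex_row (xi t X Y : R) : Rabs t = a0 -> X <= Y -> ex_cint (fun x => modulated xi (x, t)) X Y.
Proof.
  intros Ht L. apply ex_cint_cont; auto. intros x _. apply RCcont_row, modulated_cont, row_notin, Ht.
Qed.

Lemma rowint_le (xi t X Y : R) : Rabs t = a0 -> X <= Y ->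
  Cmod (rowint xi t X Y) <= exp (2 * PI * xi * t) * rowmass t X Y.
Proof.
  intros Ht L. unfold rowint, rowmass.
  rewrite <- (RInt_scal (V := R_CompleteNormedModule) (fun x => Cmod (f (x, t)))) by (apply ex_rowmass, Ht).
  apply Cmod_cint_le; auto.
  - apply ex_row; auto.
  - apply (ex_RInt_scal (V := R_NormedModule)), ex_rowmass, Ht.
  - intros x _. unfold modulated. rewrite Cmod_mult, Cmod_cexp_freq. simpl.
    rewrite Rmult_comm. apply Rle_refl.
Qed.

Hypothesis f_fourier : forall xi, ex_RInt_line (V := C_R_CompleteNormedModule) (fourier_integrand f xi).
Notation F := (fourier f).

Lemma F_spec : forall xi, is_RInt_line (V := C_R_CompleteNormedModule) (fourier_integrand f xi) (F xi).
Proof. intros xi. apply RInt_gen_correct, f_fourier. Qed.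

Variable B : R -> R.
Hypothesis B_spec : forall t, Rabs t = a0 ->
  is_RInt_line (V := R_CompleteNormedModule) (fun x => Cmod (f (x, t))) (B t).
Hypothesis col_p : is_lim colmass p_infty 0.
Hypothesis col_m : is_lim colmass m_infty 0.

Lemma rowmass_le (t X Y : R) : Rabs t = a0 -> X <= Y -> rowmass t X Y <= B t.
Proof.
  intros Ht L. apply RInt_line_ge; auto.
  - apply Cmod_row_continuous, Ht.
  - intros x. apply Cmod_ge_0.
Qed.

Lemma far_out (xi e : R) : 0 < e -> exists M, 0 < M /\ forall X Y, X < - M -> M < Y ->
  clear_of_poles X /\ clear_of_poles Y /\ colmass X < e /\ colmass Y < e /\
  Cmod (Cminus (rowint xi 0 X Y) (F xi)) < e.
Proof.
  intros He.
  destruct (Re_bounded zs) as (M1 & P1 & H1).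
  destruct (RInt_line_lim _ _ (F_spec xi) e He) as [M2 H2].
  apply is_lim_spec in col_p. destruct (col_p (mkposreal e He)) as [M3 H3].
  apply is_lim_spec in col_m. destruct (col_m (mkposreal e He)) as [M4 H4].
  simpl in H3, H4.
  exists (M1 + Rabs M2 + Rabs M3 + Rabs M4).
  pose proof (Rabs_pos M2). pose proof (Rabs_pos M3). pose proof (Rabs_pos M4).
  pose proof (Rle_abs M2). pose proof (Rle_abs M3). pose proof (Rle_abs M4).
  pose proof (Rcomplements.Rabs_maj2 M2). pose proof (Rcomplements.Rabs_maj2 M4).
  split; [lra|]. intros X Y HX HY.
  repeat split.
  - intros z I. specialize (H1 z I). rewrite (Rabs_left X); lra.
  - intros z I. specialize (H1 z I). rewrite (Rabs_pos_eq Y); lra.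
  - specialize (H4 X ltac:(lra)). rewrite Rminus_0_r in H4. apply Rabs_def2 in H4. lra.
  - specialize (H3 Y ltac:(lra)). rewrite Rminus_0_r in H3. apply Rabs_def2 in H3. lra.
  - destruct (H2 X Y ltac:(lra) ltac:(lra)) as [_ D].
    eapply Rle_lt_trans; [|exact D]. right.
    etransitivity; [|apply Cmod_norm].
    unfold rowint. f_equal.
    change (minus (cint (fourier_integrand f xi) X Y) (F xi)) with (Cminus (cint (fourier_integrand f xi) X Y) (F xi)).
    f_equal. apply cint_ext; [lra|]. intros x _. apply modulated_real.
Qed.

(** The window of [shift_identity] grows to the whole line and its vertical
    sides vanish. *)
Lemma fourier_minus_residues (xi t : R) : Rabs t = a0 -> xi * t <= 0 ->
  Cmod (Cminus (F xi) (side_residues t xi)) <= exp (2 * PI * xi * t) * B t.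
Proof.
  intros Ht Hxi. apply le_epsilon. intros e He.
  destruct (far_out xi (e / 3) ltac:(lra)) as (M & HM & K).
  destruct (K (- M - 1) (M + 1) ltac:(lra) ltac:(lra)) as (CX & CY & VX & VY & D).
  set (X := - M - 1) in *. set (Y := M + 1) in *.
  pose proof (shift_identity xi t X Y Ht ltac:(unfold X, Y; lra) CX CY) as E.
  pose proof (ends_le xi t X Y Ht Hxi CX CY) as HE.
  pose proof (rowint_le xi t X Y Ht ltac:(unfold X, Y; lra)) as HR.
  pose proof (rowmass_le t X Y Ht ltac:(unfold X, Y; lra)) as HB.
  replace (Cminus (F xi) (side_residues t xi)) with
   (Cplus (Cplus (Cminus (F xi) (rowint xi 0 X Y)) (Copp (ends xi t X Y))) (rowint xi t X Y)).
  2: { replace (side_residues t xi) with (Cminus (Cplus (rowint xi t X Y) (side_residues t xi)) (rowint xi t X Y)) by ring.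
       rewrite <- E. ring. }
  eapply Rle_trans; [apply Cmod_triangle3|]. rewrite Cmod_opp, Cmod_sub_comm.
  assert (exp (2 * PI * xi * t) * rowmass t X Y <= exp (2 * PI * xi * t) * B t).
  { apply Rmult_le_compat_l; [left; apply exp_pos|exact HB]. }
  lra.
Qed.

(** Compare [shift_identity] for the given window and for a much larger one: the
    residues cancel, and what remains lives on the part of the boundary line
    outside the given window. *)
Lemma fourier_window (xi t X Y : R) : Rabs t = a0 -> xi * t <= 0 -> X < 0 < Y ->
  clear_of_poles X -> clear_of_poles Y ->
  Cmod (Cminus (Cminus (F xi) (rowint xi 0 X Y)) (ends xi t X Y)) <=
  exp (2 * PI * xi * t) * (B t - rowmass t X Y).
Proof.
  intros Ht Hxi HXY CX CY. apply le_epsilon. intros e He.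
  destruct (far_out xi (e / 3) ltac:(lra)) as (M & HM & K).
  set (X' := Rmin X (- M) - 1). set (Y' := Rmax Y M + 1).
  pose proof (Rmin_l X (- M)). pose proof (Rmin_r X (- M)). pose proof (Rmax_l Y M). pose proof (Rmax_r Y M).
  destruct (K X' Y' ltac:(unfold X'; lra) ltac:(unfold Y'; lra)) as (CX' & CY' & VX & VY & D).
  assert (LX : X' <= X) by (unfold X'; lra). assert (LY : Y <= Y') by (unfold Y'; lra).
  pose proof (shift_identity xi t X Y Ht HXY CX CY) as E.
  pose proof (shift_identity xi t X' Y' Ht ltac:(lra) CX' CY') as E'.
  pose proof (ends_le xi t X' Y' Ht Hxi CX' CY') as HE.
  pose proof (rowint_le xi t X' X Ht LX) as HR1. pose proof (rowint_le xi t Y Y' Ht LY) as HR2.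
  pose proof (rowmass_le t X' Y' Ht ltac:(lra)) as HB.
  assert (S : Cplus (rowint xi t X' X) (Cplus (rowint xi t X Y) (rowint xi t Y Y')) = rowint xi t X' Y').
  { unfold rowint. rewrite !cint_Chasles; auto; try (apply ex_row; auto; lra). }
  assert (SM : rowmass t X' X + (rowmass t X Y + rowmass t Y Y') = rowmass t X' Y').
  { unfold rowmass.
    rewrite <- (RInt_Chasles (V := R_CompleteNormedModule) (fun x => Cmod (f (x, t))) X' X Y') by (apply ex_rowmass, Ht).
    rewrite <- (RInt_Chasles (V := R_CompleteNormedModule) (fun x => Cmod (f (x, t))) X Y Y') by (apply ex_rowmass, Ht).
    reflexivity. }
  replace (Cminus (Cminus (F xi) (rowint xi 0 X Y)) (ends xi t X Y)) with
   (Cplus (Cplus (Cminus (F xi) (rowint xi 0 X' Y')) (Copp (ends xi t X' Y'))) (Cplus (rowint xi t X' X) (rowint xi t Y Y'))).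
  2: { replace (Cminus (Cminus (F xi) (rowint xi 0 X Y)) (ends xi t X Y)) with
         (Cminus (F xi) (Cplus (rowint xi 0 X Y) (ends xi t X Y))) by ring.
       replace (Cplus (Cplus (Cminus (F xi) (rowint xi 0 X' Y')) (Copp (ends xi t X' Y'))) (Cplus (rowint xi t X' X) (rowint xi t Y Y')))
       with (Cminus (Cplus (F xi) (Cplus (rowint xi t X' X) (rowint xi t Y Y'))) (Cplus (rowint xi 0 X' Y') (ends xi t X' Y'))) by ring.
       rewrite E, E', <- S. ring. }
  eapply Rle_trans; [apply Cmod_triangle3|]. rewrite Cmod_opp, Cmod_sub_comm.
  pose proof (Cmod_triangle (rowint xi t X' X) (rowint xi t Y Y')).
  pose proof (exp_pos (2 * PI * xi * t)).
  assert (exp (2 * PI * xi * t) * (rowmass t X' X + rowmass t Y Y') <= exp (2 * PI * xi * t) * (B t - rowmass t X Y)).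
  { apply Rmult_le_compat_l; lra. }
  lra.
Qed.

(** * Poisson summation *)

Lemma colint_sum (xis : nat -> R) (t X : R) (n : nat) : clear_of_poles X ->
  Csum_n (fun k => colint (xis k) t X) n =
  cint (fun y => Cmult (f (X, y)) (Csum_n (fun k => cexp (Cmult (freq (xis k)) (X, y))) n)) 0 t :> C.
Proof.
  intros CX.
  assert (E : forall xi, ex_cint (fun y => modulated xi (X, y)) 0 t).
  { intros xi. apply (ex_RInt_continuous (V := C_R_CompleteNormedModule)). intros y _.
    exact (RCcont_col _ X y (modulated_cont xi (X, y) (clear_notin X y CX))). }
  assert (Main : ex_cint (fun y => Cmult (f (X, y)) (Csum_n (fun k => cexp (Cmult (freq (xis k)) (X, y))) n)) 0 t /\
   Csum_n (fun k => colint (xis k) t X) n =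
   cint (fun y => Cmult (f (X, y)) (Csum_n (fun k => cexp (Cmult (freq (xis k)) (X, y))) n)) 0 t :> C).
  { induction n as [|n [IE IH]].
    - assert (Ex : forall y, modulated (xis 0%nat) (X, y) = Cmult (f (X, y)) (Csum_n (fun k => cexp (Cmult (freq (xis k)) (X, y))) 0)).
      { intros y. rewrite Csum_n_0. reflexivity. }
      split.
      + apply (ex_RInt_ext (V := C_R_NormedModule) (fun y => modulated (xis 0%nat) (X, y))); [intros; apply Ex|apply E].
      + rewrite Csum_n_0. apply (RInt_ext (V := C_R_CompleteNormedModule)). intros y _. apply Ex.
    - assert (Ex : forall y, Cplus (Cmult (f (X, y)) (Csum_n (fun k => cexp (Cmult (freq (xis k)) (X, y))) n)) (modulated (xis (S n)) (X, y)) =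
         Cmult (f (X, y)) (Csum_n (fun k => cexp (Cmult (freq (xis k)) (X, y))) (S n))).
      { intros y. rewrite Csum_n_S. unfold modulated. ring. }
      split.
      + eapply (ex_RInt_ext (V := C_R_NormedModule)); [intros y _; apply Ex|].
        apply ex_cint_plus; [exact IE|apply E].
      + rewrite Csum_n_S, IH. unfold colint. rewrite <- cint_plus by auto.
        apply (RInt_ext (V := C_R_CompleteNormedModule)). intros y _. apply Ex. }
  apply Main.
Qed.

Lemma freq_mult (x y : R) : freq (x * y) = Cmult (RtoC y) (freq x).
Proof. unfold freq, Cmult, RtoC, Ci; simpl. f_equal; ring. Qed.

(** At the ends of a window the exponentials are powers of -r with r = exp(2 pi
    xi y). Their alternation is essential: near y = 0 the sum of their
    absolute values is unbounded in [n]. *)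
Lemma colint_sum_le (xi t X : R) (m n : nat) : Rabs t = a0 -> xi * t <= 0 -> clear_of_poles X ->
  expi (- (2 * PI * X * xi)) = RtoC (-1) ->
  Cmod (Csum_n (fun k => colint (xi * INR (m + k)) t X) n) <= colmass X.
Proof.
  intros Ht Hxi CX HX. rewrite colint_sum by exact CX.
  apply (weighted_col_le t X (fun y => Csum_n (fun k => cexp (Cmult (freq (xi * INR (m + k))) (X, y))) n)); auto.
  - intros y. clear HX. induction n as [|n IH].
    + apply (continuous_ext (U := C_UniformSpace) (fun y => cexp (Cmult (freq (xi * INR (m + 0))) (X, y)))).
      { intros u. symmetry. apply Csum_n_0. }
      exact (RCcont_col _ X y (cexp_freq_cont _ (X, y))).
    + apply (continuous_ext (U := C_UniformSpace) (fun y => Cplus (Csum_n (fun k => cexp (Cmult (freq (xi * INR (m + k))) (X, y))) n) (cexp (Cmult (freq (xi * INR (m + S n))) (X, y))))).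
      { intros u. symmetry. apply Csum_n_S. }
      apply (filterlim_Cplus (locally y)); [exact IH|exact (RCcont_col _ X y (cexp_freq_cont _ (X, y)))].
  - intros y Hy _. set (r := exp (2 * PI * xi * y)).
    assert (Hr : 0 <= r <= 1).
    { split; [left; apply exp_pos|]. apply exp_le_1. apply exponent_nonpos with t; auto. }
    rewrite (sum_n_ext (G := C_AbelianMonoid) _ (fun k => Cpow (RtoC (- r)) (m + k))).
    + apply alternating_sum_le, Hr.
    + intros k. rewrite freq_mult, <- Cmult_assoc, cexp_INR_mult. f_equal.
      rewrite cexp_freq, HX. unfold Cmult, RtoC; simpl. fold r. f_equal; ring.
Qed.

(** The cases [xi = 1/h], [m = 0] and [xi = -1/h], [m = 1] give the two halves
    of the Poisson series. *)
Lemma half_sum (xi t X Y : R) (m n : nat) : Rabs t = a0 -> xi * t < 0 -> X < 0 < Y ->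
  clear_of_poles X -> clear_of_poles Y ->
  expi (- (2 * PI * X * xi)) = RtoC (-1) -> expi (- (2 * PI * Y * xi)) = RtoC (-1) ->
  Cmod (Csum_n (fun k => Cminus (F (xi * INR (m + k))) (rowint (xi * INR (m + k)) 0 X Y)) n)
  <= (B t - rowmass t X Y) / (1 - exp (2 * PI * xi * t)) + (colmass X + colmass Y).
Proof.
  intros Ht Hxi HXY CX CY EX EY.
  assert (Hk : forall k, xi * INR k * t <= 0).
  { intros k. pose proof (pos_INR k). replace (xi * INR k * t) with (INR k * (xi * t)) by ring. nra. }
  pose proof PI_RGT_0 as HPI.
  assert (Hq : 0 <= exp (2 * PI * xi * t) < 1).
  { split; [left; apply exp_pos|]. rewrite <- exp_0. apply exp_increasing.
    replace (2 * PI * xi * t) with (2 * PI * (xi * t)) by ring. nra. }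
  pose proof (rowmass_le t X Y Ht ltac:(lra)) as HT.
  set (T := B t - rowmass t X Y). assert (T0 : 0 <= T) by (unfold T; lra).
  set (e := fun k => ends (xi * INR (m + k)) t X Y).
  replace (Csum_n (fun k => Cminus (F (xi * INR (m + k))) (rowint (xi * INR (m + k)) 0 X Y)) n)
   with (Cplus (Csum_n (fun k => Cminus (Cminus (F (xi * INR (m + k))) (rowint (xi * INR (m + k)) 0 X Y)) (e k)) n)
          (Csum_n e n)).
  2: { rewrite Csum_n_minus. ring. }
  eapply Rle_trans; [apply Cmod_triangle|]. apply Rplus_le_compat.
  - apply geometric_sum_le; auto. intros k. unfold e.
    eapply Rle_trans; [apply (fourier_window _ t); auto|].
    apply Rmult_le_compat_r; [exact T0|].
    replace (2 * PI * (xi * INR (m + k)) * t) with (2 * PI * xi * t * INR (m + k)) by ring.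
    rewrite exp_INR_mult, pow_add. rewrite <- (Rmult_1_l (exp _ ^ k)) at 2.
    apply Rmult_le_compat_r; [apply pow_le; lra|]. rewrite <- (pow1 m). apply pow_incr; lra.
  - assert (E : Csum_n e n = Cmult Ci (Cminus
       (Csum_n (fun k => colint (xi * INR (m + k)) t Y) n)
       (Csum_n (fun k => colint (xi * INR (m + k)) t X) n)) :> C).
    { rewrite <- Csum_n_minus. clear. induction n as [|n IH].
      - rewrite !Csum_n_0. reflexivity.
      - rewrite !Csum_n_S, IH. unfold e, ends. ring. }
    rewrite E, Cmod_mult, Cmod_Ci, Rmult_1_l. unfold Cminus.
    eapply Rle_trans; [apply Cmod_triangle|]. rewrite Cmod_opp.
    pose proof (colint_sum_le xi t X m n Ht (Rlt_le _ _ Hxi) CX EX).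
    pose proof (colint_sum_le xi t Y m n Ht (Rlt_le _ _ Hxi) CY EY). lra.
Qed.

Lemma f_cont_real (x : R) : Ccont f (x, 0).
Proof. apply f_cont. intros I. apply (zs_nonreal _ I). reflexivity. Qed.

Lemma f_diff_real (x : R) : Cdiffable f (x, 0).
Proof.
  apply f_diff; [simpl; rewrite Rabs_R0; exact a0_pos|].
  intros I. apply (zs_nonreal _ I). reflexivity.
Qed.

Section Spacing.
Variable h : R.
Hypothesis h_pos : 0 < h.

Lemma expi_half_odd (k : Z) : expi (PI * IZR (2 * k + 1)) = RtoC (-1).
Proof.
  rewrite plus_IZR, mult_IZR. replace (PI * (2 * IZR k + 1)) with (2 * PI * IZR k + PI) by ring.
  rewrite expi_plus, expi_period, expi_PI. ring.
Qed.

Lemma expi_win_left (m : nat) (s : Z) : (s = 1 \/ s = -1)%Z ->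
  expi (- (2 * PI * win_left h m * (IZR s / h))) = RtoC (-1).
Proof.
  (* - 2 win_left / h is the odd number 2 m + 3 *)
  intros Hs. set (k := if Z.eq_dec s 1 then (Z.of_nat m + 1)%Z else (- Z.of_nat m - 2)%Z).
  rewrite <- (expi_half_odd k). f_equal. rewrite plus_IZR, mult_IZR. unfold win_left, k.
  destruct Hs as [-> | ->]; simpl; rewrite ?plus_IZR, ?minus_IZR, ?opp_IZR, <- INR_IZR_INZ; field; lra.
Qed.

Lemma expi_win_right (n : nat) (s : Z) : (s = 1 \/ s = -1)%Z ->
  expi (- (2 * PI * win_right h n * (IZR s / h))) = RtoC (-1).
Proof.
  (* 2 win_right / h is the odd number 2 n + 1 *)
  intros Hs. set (k := if Z.eq_dec s 1 then (- Z.of_nat n - 1)%Z else (Z.of_nat n)%Z).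
  rewrite <- (expi_half_odd k). f_equal. rewrite plus_IZR, mult_IZR. unfold win_right, k.
  destruct Hs as [-> | ->]; simpl; rewrite ?plus_IZR, ?minus_IZR, ?opp_IZR, <- INR_IZR_INZ; field; lra.
Qed.

Lemma win_bounds (m n : nat) : win_left h m < 0 < win_right h n.
Proof. unfold win_left, win_right. pose proof (pos_INR m). pose proof (pos_INR n). nra. Qed.

(** Bounds the error of replacing the line by the window in the Poisson sums,
    uniformly in the number of frequencies. *)
Definition window_defect (X Y : R) : R :=
  (B (- a0) - rowmass (- a0) X Y + (B a0 - rowmass a0 X Y)) / (1 - exp (- (2 * PI * a0 / h)))
  + 2 * (colmass X + colmass Y).

Lemma window_sum_le (m n K : nat) : clear_of_poles (win_left h m) -> clear_of_poles (win_right h n) ->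
  Cmod (Cminus (Zpartial (fun k => F (IZR k / h)) K K)
    (Zpartial (fun k => coef f h k (win_left h m) (win_right h n)) K K))
  <= window_defect (win_left h m) (win_right h n).
Proof.
  set (X := win_left h m). set (Y := win_right h n). intros CX CY.
  pose proof (win_bounds m n) as HXY. fold X Y in HXY.
  assert (Hh : 0 < / h) by (apply Rinv_0_lt_compat, h_pos).
  assert (Ec : forall k, coef f h k X Y = rowint (IZR k / h) 0 X Y).
  { intros k. unfold coef, rowint. apply cint_ext; [lra|]. intros x _. symmetry. apply modulated_real. }
  rewrite <- Zpartial_minus. unfold Zpartial.
  assert (A0 : Rabs a0 = a0) by (apply Rabs_pos_eq; lra).
  assert (A1 : Rabs (- a0) = a0) by (rewrite Rabs_Ropp; exact A0).
  pose proof (half_sum (IZR 1 / h) (- a0) X Y 0 K A1 ltac:(unfold Rdiv; nra) HXY CX CY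
     (expi_win_left m 1 ltac:(auto)) (expi_win_right n 1 ltac:(auto))) as HP.
  pose proof (half_sum (IZR (-1) / h) a0 X Y 1 K A0 ltac:(unfold Rdiv; nra) HXY CX CY
     (expi_win_left m (-1) ltac:(auto)) (expi_win_right n (-1) ltac:(auto))) as HN.
  replace (2 * PI * (1 / h) * - a0) with (- (2 * PI * a0 / h)) in HP by (field; lra).
  replace (2 * PI * (-1 / h) * a0) with (- (2 * PI * a0 / h)) in HN by (field; lra).
  eapply Rle_trans; [apply Cmod_triangle|].
  rewrite (sum_n_ext (G := C_AbelianMonoid) _ (fun k => Cminus (F (1 / h * INR (0 + k))) (rowint (1 / h * INR (0 + k)) 0 X Y)) K).
  2: { intros k. rewrite Ec. replace (IZR (Z.of_nat k) / h) with (1 / h * INR (0 + k)); [reflexivity|].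
       rewrite <- INR_IZR_INZ. simpl. field. lra. }
  rewrite (sum_n_ext (G := C_AbelianMonoid) (fun k => Cminus (F (IZR (- Z.of_nat (S k)) / h)) _) (fun k => Cminus (F (-1 / h * INR (1 + k))) (rowint (-1 / h * INR (1 + k)) 0 X Y)) K).
  2: { intros k. rewrite Ec. replace (IZR (- Z.of_nat (S k)) / h) with (-1 / h * INR (1 + k)); [reflexivity|].
       rewrite opp_IZR, <- INR_IZR_INZ. change (1 + k)%nat with (S k). field. lra. }
  unfold window_defect. unfold Rdiv in *. rewrite Rmult_plus_distr_r. lra.
Qed.

Lemma window_defect_small (e : R) : 0 < e -> exists N0 : nat, forall m n, (N0 <= m)%nat -> (N0 <= n)%nat ->
  clear_of_poles (win_left h m) /\ clear_of_poles (win_right h n) /\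
  window_defect (win_left h m) (win_right h n) < e.
Proof.
  intros He. pose proof PI_RGT_0 as HPI.
  assert (A0 : Rabs a0 = a0) by (apply Rabs_pos_eq; lra).
  assert (A1 : Rabs (- a0) = a0) by (rewrite Rabs_Ropp; exact A0).
  set (q := exp (- (2 * PI * a0 / h))).
  assert (Hq : q < 1).
  { unfold q. rewrite <- exp_0. apply exp_increasing.
    assert (0 < 2 * PI * a0 / h) by (apply Rdiv_lt_0_compat; nra). lra. }
  set (d := Rmin (e / 16) (e * (1 - q) / 8)).
  assert (Hd : 0 < d) by (apply Rmin_pos; nra).
  assert (d1 : d <= e / 16) by apply Rmin_l.
  assert (d2 : d <= e * (1 - q) / 8) by apply Rmin_r.
  destruct (far_out 0 d Hd) as (M0 & HM0 & K0).
  destruct (RInt_line_lim _ _ (B_spec (- a0) A1) d Hd) as [M1 K1].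
  destruct (RInt_line_lim _ _ (B_spec a0 A0) d Hd) as [M2 K2].
  destruct (nfloor_ex ((M0 + Rabs M1 + Rabs M2) / h)) as [N0 [_ HN0]].
  { apply Rdiv_le_0_compat; [|exact h_pos]. pose proof (Rabs_pos M1). pose proof (Rabs_pos M2). lra. }
  apply Rlt_div_l in HN0; [|exact h_pos].
  exists (S N0). intros m n Hm Hn. apply le_INR in Hm. apply le_INR in Hn. rewrite S_INR in Hm, Hn.
  pose proof (win_bounds m n) as HXY.
  pose proof (Rcomplements.Rabs_maj2 M1). pose proof (Rcomplements.Rabs_maj2 M2).
  pose proof (Rle_abs M1). pose proof (Rle_abs M2). pose proof (Rabs_pos M1). pose proof (Rabs_pos M2).
  set (X := win_left h m) in *. set (Y := win_right h n) in *.
  assert (HX : X < - (M0 + Rabs M1 + Rabs M2)) by (unfold X, win_left; nra).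
  assert (HY : M0 + Rabs M1 + Rabs M2 < Y) by (unfold Y, win_right; nra).
  destruct (K0 X Y ltac:(lra) ltac:(lra)) as (CX & CY & VX & VY & _).
  destruct (K1 X Y ltac:(lra) ltac:(lra)) as [_ D1]. destruct (K2 X Y ltac:(lra) ltac:(lra)) as [_ D2].
  split; [exact CX|]. split; [exact CY|].
  change (Rabs (rowmass (- a0) X Y - B (- a0)) < d) in D1. change (Rabs (rowmass a0 X Y - B a0) < d) in D2.
  apply Rabs_def2 in D1. apply Rabs_def2 in D2.
  unfold window_defect. fold q.
  assert ((B (- a0) - rowmass (- a0) X Y + (B a0 - rowmass a0 X Y)) / (1 - q) <= e / 4).
  { apply Rle_div_l; lra. }
  lra.
Qed.

(** The bound of [window_sum_le] survives the limit in the number of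
    frequencies; then the two ends of the window move independently. *)
Theorem Poisson_summation (L : C) :
  is_Zseries (V := C_R_CompleteNormedModule) (fun k => F (IZR k / h)) L ->
  is_Zseries (V := C_R_CompleteNormedModule) (sample f h) (Cdiv L (RtoC h)).
Proof.
  intros HL. apply is_Zseries_of_joint_limit. intros e He.
  destruct (window_defect_small (e * h) ltac:(nra)) as [N0 HN0].
  exists N0. intros m n Hm Hn. destruct (HN0 m n Hm Hn) as (CX & CY & W).
  assert (Nh : RtoC h <> RtoC 0) by (apply RtoC_neq_0; lra).
  assert (Bd : Cmod (Cminus L (Cmult (RtoC h) (Zpartial (sample f h) m n))) <= window_defect (win_left h m) (win_right h n)).
  { apply (Cmod_lim_le (fun K => Cminus (Zpartial (fun k => F (IZR k / h)) K K)
      (Zpartial (fun k => coef f h k (win_left h m) (win_right h n)) K K))).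
    - apply (filterlim_Cplus eventually); [apply Zpartial_lim, HL|].
      apply (filterlim_comp _ _ _ (fun K => Zpartial (fun k => coef f h k (win_left h m) (win_right h n)) K K) Copp _ _ _
        (coef_sums_window f h h_pos f_cont_real f_diff_real m n)).
      exact (filterlim_opp (V := C_R_NormedModule) _).
    - intros K. apply window_sum_le; assumption. }
  replace (Cminus (Zpartial (sample f h) m n) (Cdiv L (RtoC h))) with
    (Copp (Cdiv (Cminus L (Cmult (RtoC h) (Zpartial (sample f h) m n))) (RtoC h))) by (field; exact Nh).
  rewrite Cmod_opp, Cmod_div, Cmod_R, (Rabs_pos_eq h) by (auto; lra).
  apply Rlt_div_l; lra.
Qed.
End Spacing.

Lemma decay_constant_nonneg (a C0 : R) : fourier_decay f a C0 -> 0 <= C0.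
Proof.
  intros D. specialize (D 0). pose proof (Cmod_ge_0 (F 0)). rewrite Rabs_R0, Rmult_0_r, Ropp_0, exp_0 in D. lra.
Qed.

(** By [Poisson_summation] the error is the modulus of the Poisson series
    without its term of index 0, which is the integral of [f]. *)
Theorem trapezoidal_bound_of_decay (a C0 : R) : 0 < a -> fourier_decay f a C0 -> trapezoidal_bound f a C0.
Proof.
  intros Ha D h Hh. pose proof PI_RGT_0 as HPI. pose proof (decay_constant_nonneg a C0 D) as HC.
  set (q := exp (- (2 * a * PI / h))).
  assert (Hpos : 0 < 2 * a * PI / h) by (apply Rdiv_lt_0_compat; [nra|lra]).
  assert (Hq : 0 < q < 1).
  { split; [apply exp_pos|]. unfold q. rewrite <- exp_0. apply exp_increasing. lra. }
  assert (Dk : forall (s : R) (n : nat), Rabs s = / h -> Cmod (F (s * INR n)) <= C0 * q ^ n).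
  { intros s n Hs. eapply Rle_trans; [apply D|]. right. f_equal.
    unfold q. rewrite <- exp_INR_mult. f_equal. rewrite Rabs_mult, Hs, (Rabs_pos_eq (INR n)) by apply pos_INR.
    field. lra. }
  assert (Hih : Rabs (/ h) = / h) by (apply Rabs_pos_eq; left; apply Rinv_0_lt_compat, Hh).
  assert (Bp : forall n, Cmod (F (IZR (Z.of_nat n) / h)) <= C0 * q ^ n).
  { intros n. rewrite <- INR_IZR_INZ. replace (INR n / h) with (/ h * INR n) by (field; lra). apply Dk, Hih. }
  assert (Bn : forall n, Cmod (F (IZR (- Z.of_nat n) / h)) <= C0 * q ^ n).
  { intros n. rewrite opp_IZR, <- INR_IZR_INZ. replace (- INR n / h) with (- / h * INR n) by (field; lra).
    apply Dk. rewrite Rabs_Ropp. exact Hih. }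
  assert (Geo : is_series (fun n => C0 * q ^ S n) (C0 * (q / (1 - q)))).
  { apply (is_series_ext (fun n => scal (C0 * q) (q ^ n))).
    - intros n. change (C0 * q * q ^ n = C0 * (q * q ^ n)). ring.
    - replace (C0 * (q / (1 - q))) with (scal (C0 * q) (/ (1 - q))).
      + apply (is_series_scal_l (V := R_NormedModule)). apply is_series_geom. rewrite Rabs_pos_eq; lra.
      + change (C0 * q * / (1 - q) = C0 * (q / (1 - q))). field. lra. }
  assert (Geo0 : ex_series (fun n => C0 * q ^ n)).
  { apply (ex_series_scal_l (V := R_NormedModule)). exists (/ (1 - q)). apply is_series_geom. rewrite Rabs_pos_eq; lra. }
  destruct (ex_Cseries_le (fun n => F (IZR (Z.of_nat n) / h)) _ Bp Geo0) as [Lp HLp].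
  destruct (ex_Cseries_le (fun n => F (IZR (- Z.of_nat (S n)) / h)) (fun n => C0 * q ^ S n) (fun n => Bn (S n)) (ex_intro _ _ Geo)) as [Ln HLn].
  set (L := Cplus Lp Ln).
  assert (HL : is_Zseries (V := C_R_CompleteNormedModule) (fun k => F (IZR k / h)) L).
  { exists Lp, Ln. auto. }
  pose proof (Poisson_summation h Hh L HL) as HS.
  assert (Half : forall u : nat -> R, (forall n, 0 <= u n <= C0 * q ^ S n) ->
     is_series u (Series u) /\ Series u <= C0 * (q / (1 - q))).
  { intros u Hu. assert (E : ex_series u).
    { apply (ex_series_le (V := R_CompleteNormedModule) u (fun n => C0 * q ^ S n)); [|exists (C0 * (q / (1 - q))); exact Geo].
      intros n. change (Rabs (u n) <= C0 * q ^ S n). rewrite Rabs_pos_eq; apply Hu. }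
    split; [apply Series_correct, E|].
    rewrite <- (is_series_unique _ _ Geo). apply Series_le; [exact Hu|eexists; exact Geo]. }
  destruct (Half (fun n => fourier_sample f h (Z.of_nat (S n)))) as [Sp Bsp].
  { intros n. unfold fourier_sample. destruct (Z.eq_dec _ 0) as [E|_]; [lia|]. split; [apply Cmod_ge_0|apply Bp]. }
  destruct (Half (fun n => fourier_sample f h (- Z.of_nat (S n)))) as [Sn Bsn].
  { intros n. unfold fourier_sample. destruct (Z.eq_dec _ 0) as [E|_]; [lia|]. split; [apply Cmod_ge_0|apply Bn]. }
  set (sp := Series (fun n => fourier_sample f h (Z.of_nat (S n)))) in *.
  set (sn := Series (fun n => fourier_sample f h (- Z.of_nat (S n)))) in *.
  assert (HF : is_Zseries (V := R_CompleteNormedModule) (fourier_sample f h) (sp + sn)).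
  { exists sp, sn. split; [|split; [exact Sn|reflexivity]].
    apply (is_series_prepend (V := R_NormedModule) (fun n => fourier_sample f h (Z.of_nat n)) sp); [exact Sp|].
    unfold fourier_sample. simpl. change (sp = sp + 0). ring. }
  split; [eexists; exact HS|]. split; [eexists; exact HF|].
  rewrite (Zseries_eq _ _ HF). split.
  - unfold trapezoidal_error. rewrite (Zseries_eq _ _ HS).
    assert (E0 : RInt_line (V := C_R_CompleteNormedModule) (fun x => f (RtoC x)) = F 0).
    { unfold fourier. apply RInt_gen_ext_eq.
      - intros x. unfold fourier_integrand. rewrite Rmult_0_r, Ropp_0, expi_0. symmetry. apply Cmult_1_r.
      - apply (ex_RInt_gen_ext_eq (fourier_integrand f 0)); [|apply f_fourier].
        intros x. unfold fourier_integrand. rewrite Rmult_0_r, Ropp_0, expi_0. apply Cmult_1_r. }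
    rewrite E0.
    assert (Nh : RtoC h <> RtoC 0) by (apply RtoC_neq_0; lra).
    replace (Cmult (RtoC h) (Cdiv L (RtoC h))) with L by (field; exact Nh).
    rewrite Cmod_sub_comm.
    set (G := fun k : Z => if Z.eq_dec k 0 then RtoC 0 else F (IZR k / h)).
    apply (Cmod_Zseries_le G (fourier_sample f h)); [| |exact HF].
    + intros k. unfold G, fourier_sample. destruct (Z.eq_dec k 0); [rewrite Cmod_0; lra|lra].
    + exists (Cminus Lp (F 0)), Ln. split; [|split].
      * apply (is_series_prepend (V := C_R_NormedModule) (fun n => G (Z.of_nat n)) (Cminus Lp (F 0))).
        2: { unfold G. simpl. change (Cminus Lp (F 0) = Cplus (Cminus Lp (F 0)) (RtoC 0)). ring. }
        apply (is_series_ext (V := C_R_NormedModule) (fun n => F (IZR (Z.of_nat (S n)) / h))).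
        { intros n. unfold G. destruct (Z.eq_dec _ 0); [lia|reflexivity]. }
        apply (is_series_incr_1 (V := C_R_NormedModule) (fun n => F (IZR (Z.of_nat n) / h))).
        assert (EL : Lp = plus (G := C_R_NormedModule) (Cminus Lp (F 0)) (F (IZR (Z.of_nat 0) / h))).
        { simpl. replace (0 / h) with 0 by (field; lra). exact (Csub_add Lp (F 0)). }
        exact (eq_ind Lp (is_series (V := C_R_NormedModule) (fun n => F (IZR (Z.of_nat n) / h))) HLp _ EL).
      * apply (is_series_ext (V := C_R_NormedModule) (fun n => F (IZR (- Z.of_nat (S n)) / h))); [|exact HLn].
        intros n. unfold G. destruct (Z.eq_dec _ 0); [lia|reflexivity].
      * unfold L. change (Cminus (Cplus Lp Ln) (F 0) = Cplus (Cminus Lp (F 0)) Ln). ring.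
  - replace (2 * C0 / (exp (2 * a * PI / h) - 1)) with (C0 * (q / (1 - q)) + C0 * (q / (1 - q))); [lra|].
    replace (exp (2 * a * PI / h)) with (/ q) by (unfold q; rewrite exp_Ropp, Rinv_inv; reflexivity).
    field. repeat split; lra.
Qed.

(** * Decay of the Fourier transform *)

(** Whichever side [t] lies on, the poles crossed satisfy [xi * Im z <= 0], so
    that the exponential is small at them. *)
Lemma side_residues_le (xi t a : R) (beta : C -> R) : Rabs t = a0 -> xi * t <= 0 ->
  (forall z, In z zs -> 0 <= beta z) ->
  (forall z, In z zs -> xi * Im z <= 0 ->
     Cmod (model_residue (freq xi) z (N z) (c z)) <= beta z * exp (- (2 * PI * a * Rabs xi))) ->
  Cmod (side_residues t xi) <= sum_list (map beta zs) * exp (- (2 * PI * a * Rabs xi)).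
Proof.
  intros Ht Hxi Hb Hm. set (w := exp (- (2 * PI * a * Rabs xi))) in *.
  assert (Hw : 0 < w) by apply exp_pos.
  assert (R0 : forall y0 y1, (forall z, In z zs -> y0 < Im z < y1 -> xi * Im z <= 0) ->
    Cmod (residue_sum xi y0 y1) <= sum_list (map beta zs) * w).
  { intros y0 y1 Hs. unfold residue_sum. eapply Rle_trans; [apply Cmod_Csum_le|].
    clear zs_nodup f_cont f_diff f_ppart zs_strip zs_nonreal.
    induction zs as [|z l IH]; simpl; [lra|].
    assert (Hl : sum_list (map Cmod (map (fun z => model_residue (freq xi) z (N z) (c z)) (filter (between y0 y1) l)))
       <= sum_list (map beta l) * w).
    { apply IH; [intros; apply Hb|intros; apply Hm|intros; eapply Hs]; simpl; eauto. }
    pose proof (Hb z (or_introl eq_refl)) as Hz.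
    destruct (between y0 y1 z) eqn:Bz; simpl.
    - apply between_spec in Bz. pose proof (Hm z (or_introl eq_refl) (Hs z (or_introl eq_refl) Bz)).
      rewrite Rmult_plus_distr_r. apply Rplus_le_compat; assumption.
    - assert (0 <= beta z * w) by nra. lra. }
  unfold side_residues. destruct (Rlt_dec 0 t) as [T|T].
  - apply R0. intros z _ Hz. assert (xi <= 0) by nra. nra.
  - rewrite Cmod_opp. apply R0. intros z _ Hz.
    assert (t < 0) by (destruct (Req_dec t 0) as [->|]; [rewrite Rabs_R0 in Ht; lra|lra]).
    assert (0 <= xi) by nra. nra.
Qed.

(** [beta z] bounds the contribution of the pole [z], relative to the decay
    aimed at. *)
Theorem decay_of_residue_bounds (a : R) (beta : C -> R) : 0 <= a <= a0 ->
  (forall z, In z zs -> 0 <= beta z) ->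
  (forall z xi, In z zs -> xi * Im z <= 0 ->
     Cmod (model_residue (freq xi) z (N z) (c z)) <= beta z * exp (- (2 * PI * a * Rabs xi))) ->
  fourier_decay f a (Rmax (B (- a0)) (B a0) + sum_list (map beta zs)).
Proof.
  intros Ha Hb Hm xi. pose proof PI_RGT_0 as HPI.
  assert (A0 : Rabs a0 = a0) by (apply Rabs_pos_eq; lra).
  assert (A1 : Rabs (- a0) = a0) by (rewrite Rabs_Ropp; exact A0).
  set (t := if Rle_dec 0 xi then - a0 else a0).
  assert (Ht : Rabs t = a0) by (unfold t; destruct (Rle_dec 0 xi); assumption).
  assert (Et : xi * t = - (a0 * Rabs xi)).
  { unfold t. destruct (Rle_dec 0 xi); [rewrite Rabs_pos_eq by lra|rewrite Rabs_left by lra]; ring. }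
  pose proof (Rabs_pos xi) as Px.
  assert (Hxi : xi * t <= 0) by (rewrite Et; nra).
  assert (HBm : B t <= Rmax (B (- a0)) (B a0)).
  { unfold t. destruct (Rle_dec 0 xi); [apply Rmax_l|apply Rmax_r]. }
  assert (HB0 : 0 <= B t).
  { pose proof (rowmass_le t 0 0 Ht (Rle_refl 0)) as E. unfold rowmass in E.
    rewrite RInt_point in E. exact E. }
  pose proof (fourier_minus_residues xi t Ht Hxi) as D.
  pose proof (side_residues_le xi t a beta Ht Hxi Hb (fun z I => Hm z xi I)) as S.
  set (w := exp (- (2 * PI * a * Rabs xi))) in *.
  assert (Hw : exp (2 * PI * xi * t) <= w).
  { unfold w. replace (2 * PI * xi * t) with (2 * PI * (xi * t)) by ring. rewrite Et.
    destruct (Req_dec (a * Rabs xi) (a0 * Rabs xi)) as [E|E].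
    - right. f_equal. replace (2 * PI * a * Rabs xi) with (2 * PI * (a * Rabs xi)) by ring. rewrite E. ring.
    - left. apply exp_increasing. assert (a * Rabs xi <= a0 * Rabs xi) by nra. nra. }
  replace (F xi) with (Cplus (Cminus (F xi) (side_residues t xi)) (side_residues t xi)) by ring.
  eapply Rle_trans; [apply Cmod_triangle|]. rewrite Rmult_plus_distr_r. apply Rplus_le_compat; [|exact S].
  eapply Rle_trans; [exact D|]. rewrite Rmult_comm.
  pose proof (exp_pos (2 * PI * xi * t)). apply Rmult_le_compat; lra.
Qed.

End Shift.

(** * Growth of the residues with the frequency *)

(** For m > 0 the function e^(d x) is the m-th power of e^(d x / m), which is at
    least d x / m. *)
Lemma pow_le_exp (m : nat) (d : R) : 0 < d ->
  exists C0, 0 <= C0 /\ forall x, 0 <= x -> x ^ m <= C0 * exp (d * x).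
Proof.
  intros Hd. destruct m as [|m].
  - exists 1. split; [lra|]. intros x Hx. simpl.
    pose proof (exp_ineq1_le (d * x)). nra.
  - set (k := INR (S m)). assert (Hk : 0 < k) by (apply lt_0_INR; lia).
    exists ((k / d) ^ S m). split; [apply pow_le, Rdiv_le_0_compat; lra|]. intros x Hx.
    replace (d * x) with (d * x / k * k) by (field; lra). unfold k at 3.
    rewrite exp_INR_mult, <- Rpow_mult_distr. apply pow_incr. split; [exact Hx|].
    pose proof (exp_ineq1_le (d * x / k)).
    assert (0 < k / d) by (apply Rdiv_lt_0_compat; lra).
    apply Rle_trans with (k / d * (d * x / k)); [right; field; lra|].
    apply Rmult_le_compat_l; lra.
Qed.

Lemma Cmod_freq (xi : R) : Cmod (freq xi) = 2 * PI * Rabs xi.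
Proof.
  unfold freq. rewrite Cmod_mult, Cmod_Ci, Cmod_R, Rabs_Ropp, !Rabs_mult, (Rabs_pos_eq 2), (Rabs_pos_eq PI); try ring; try lra.
  left. apply PI_RGT_0.
Qed.

Lemma Cmod_pow (z : C) (n : nat) : Cmod (Cpow z n) = Cmod z ^ n.
Proof. induction n as [|n IH]; simpl; [apply Cmod_1|]. rewrite Cmod_mult, IH. reflexivity. Qed.

Lemma Cmod_cexp_freq_le (xi b : R) (z : C) : xi * Im z <= 0 -> b <= Rabs (Im z) ->
  Cmod (cexp (Cmult (freq xi) z)) <= exp (- (2 * PI * b * Rabs xi)).
Proof.
  intros Hz Hb. rewrite Cmod_cexp_freq.
  assert (E : xi * Im z = - (Rabs xi * Rabs (Im z))) by (rewrite <- Rabs_mult, Rabs_left1 by exact Hz; ring).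
  replace (2 * PI * xi * Im z) with (2 * PI * (xi * Im z)) by ring. rewrite E.
  pose proof PI_RGT_0. pose proof (Rabs_pos xi).
  assert (b * Rabs xi <= Rabs xi * Rabs (Im z)) by nra.
  destruct (Rle_lt_or_eq_dec (2 * PI * - (Rabs xi * Rabs (Im z))) (- (2 * PI * b * Rabs xi)) ltac:(nra)) as [L|L].
  - left. apply exp_increasing, L.
  - right. f_equal. exact L.
Qed.

Lemma model_residue_simple (al z : C) (c : nat -> C) :
  model_residue al z 1 c = Cmult (c 1%nat) (Cmult (Cmult (RtoC (2 * PI)) Ci) (cexp (Cmult al z))).
Proof.
  unfold model_residue. rewrite sum_n_n. simpl. field.
Qed.

Lemma simple_residue_bound (xi a : R) (z : C) (c : nat -> C) : xi * Im z <= 0 -> a <= Rabs (Im z) ->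
  Cmod (model_residue (freq xi) z 1 c) <= 2 * PI * Cmod (c 1%nat) * exp (- (2 * PI * a * Rabs xi)).
Proof.
  intros Hz Ha. rewrite model_residue_simple, !Cmod_mult, Cmod_Ci, Cmod_R.
  pose proof PI_RGT_0. rewrite Rabs_pos_eq by lra.
  replace (Cmod (c 1%nat) * (2 * PI * 1 * Cmod (cexp (Cmult (freq xi) z)))) with
   (2 * PI * Cmod (c 1%nat) * Cmod (cexp (Cmult (freq xi) z))) by ring.
  apply Rmult_le_compat_l; [pose proof (Cmod_ge_0 (c 1%nat)); nra|].
  apply Cmod_cexp_freq_le; assumption.
Qed.

(** Each term is a power of [xi] times exp(-2 pi |Im z| |xi|); the gap between
    |Im z| and [a] absorbs the power. *)
Lemma higher_residue_bound (a : R) (z : C) (n : nat) (c : nat -> C) : a < Rabs (Im z) ->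
  exists b, 0 <= b /\ forall xi, xi * Im z <= 0 ->
    Cmod (model_residue (freq xi) z n c) <= b * exp (- (2 * PI * a * Rabs xi)).
Proof.
  intros Ha. pose proof PI_RGT_0 as HPI. induction n as [|n (b & Hb & IH)].
  - exists 0. split; [lra|]. intros xi _. unfold model_residue. rewrite sum_n_m_zero by lia.
    change (Cmod (RtoC 0) <= 0 * exp (- (2 * PI * a * Rabs xi))). rewrite Cmod_0. lra.
  - set (d := Rabs (Im z) - a). assert (Hd : 0 < d) by (unfold d; lra).
    destruct (pow_le_exp n d Hd) as (K & HK & P).
    assert (Hf : 0 < INR (fact n)) by apply INR_fact_lt_0.
    set (b' := Cmod (c (S n)) * (2 * PI) * (K / INR (fact n))).
    assert (Hb' : 0 <= b').
    { unfold b'. apply Rmult_le_pos; [|apply Rdiv_le_0_compat; lra].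
      pose proof (Cmod_ge_0 (c (S n))). nra. }
    exists (b + b'). split; [lra|]. intros xi Hxi.
    unfold model_residue. rewrite sum_n_Sm by lia. fold (model_residue (freq xi) z n c).
    eapply Rle_trans; [apply Cmod_triangle|]. rewrite Rmult_plus_distr_r.
    apply Rplus_le_compat; [apply IH, Hxi|]. simpl pred.
    assert (Nf : RtoC (INR (fact n)) <> RtoC 0) by (apply RtoC_neq_0; lra).
    rewrite !Cmod_mult, Cmod_div, Cmod_Ci, !Cmod_R, Cmod_pow, Cmod_freq by exact Nf.
    rewrite (Rabs_pos_eq (2 * PI)), (Rabs_pos_eq (INR (fact n))) by lra.
    pose proof (Rabs_pos xi) as Px.
    assert (E1 : Cmod (cexp (Cmult (freq xi) z)) * (2 * PI * Rabs xi) ^ n <= K * exp (- (2 * PI * a * Rabs xi))).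
    { pose proof (Cmod_cexp_freq_le xi (Rabs (Im z)) z Hxi (Rle_refl _)) as E.
      specialize (P (2 * PI * Rabs xi) ltac:(nra)).
      apply Rle_trans with (exp (- (2 * PI * Rabs (Im z) * Rabs xi)) * (K * exp (d * (2 * PI * Rabs xi)))).
      - apply Rmult_le_compat; auto; [apply Cmod_ge_0|apply pow_le; nra].
      - right. rewrite (Rmult_comm K), <- Rmult_assoc, <- exp_plus, Rmult_comm. f_equal. f_equal. unfold d. ring. }
    unfold b'. apply Rle_trans with (Cmod (c (S n)) * (2 * PI) / INR (fact n) * (Cmod (cexp (Cmult (freq xi) z)) * (2 * PI * Rabs xi) ^ n)).
    + right. field. lra.
    + replace (Cmod (c (S n)) * (2 * PI) * (K / INR (fact n)) * exp (- (2 * PI * a * Rabs xi))) with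
       (Cmod (c (S n)) * (2 * PI) / INR (fact n) * (K * exp (- (2 * PI * a * Rabs xi)))) by (field; lra).
      apply Rmult_le_compat_l; [|exact E1]. apply Rdiv_le_0_compat; [|exact Hf].
      pose proof (Cmod_ge_0 (c (S n))). nra.
Qed.

Lemma pointwise_choice {A T : Type} (t0 : T) (P : A -> T -> Prop) (Q : A -> Prop) :
  (forall x, Q x -> exists t, P x t) -> exists phi, forall x, Q x -> P x (phi x).
Proof.
  intros H. exists (fun x => epsilon (inhabits t0) (P x)). intros x Hx. apply epsilon_spec, H, Hx.
Qed.

(** * Extension beyond the strip *)

(** Composing [f] with [clamp a0] keeps its values on the closed strip and turns
    relative continuity up to the boundary lines into continuity at every
    point that is not a pole, as the contour integrals require. *)
Definition clamp (a0 : R) (z : C) : C := (Re z, Rmax (- a0) (Rmin a0 (Im z))).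

Lemma clamp_id (a0 : R) (z : C) : Rabs (Im z) <= a0 -> clamp a0 z = z.
Proof.
  intros H. apply Rabs_le_between in H. unfold clamp. rewrite Rmin_right, Rmax_right by lra.
  symmetry. apply surjective_pairing.
Qed.

Lemma clamp_strip (a0 : R) (z : C) : 0 < a0 -> Rabs (Im (clamp a0 z)) <= a0.
Proof.
  intros H. simpl. apply Rabs_le. split; [apply Rmax_l|]. apply Rmax_lub; [lra|apply Rmin_l].
Qed.

Lemma clamp_inner (a0 : R) (z : C) : 0 < a0 -> Rabs (Im (clamp a0 z)) < a0 -> clamp a0 z = z.
Proof.
  intros Ha H. apply clamp_id. simpl in H. apply Rabs_def2 in H. destruct H as [H1 H2]. apply Rabs_le.
  split; apply Rnot_lt_le; intros L.
  - rewrite Rmin_right in H2 by lra. rewrite Rmax_left in H2 by lra. lra.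
  - rewrite Rmin_left in H1 by lra. rewrite Rmax_right in H1 by lra. lra.
Qed.

Lemma clamp_cont (a0 : R) (z : C) : Ccont (clamp a0) z.
Proof.
  apply Ccont_eps. intros e He. exists e. split; [exact He|]. intros [u v] Hw. destruct z as [x y].
  eapply Rle_lt_trans; [|exact Hw]. unfold clamp; simpl.
  change (Cminus (u, v) (x, y)) with ((u - x, v - y) : C).
  match goal with |- Cmod (Cminus (_, ?s) (_, ?t)) <= _ =>
    change (Cmod (u - x, s - t) <= Cmod (u - x, v - y)); assert (L : Rabs (s - t) <= Rabs (v - y)) end.
  { unfold Rmax, Rmin. repeat destruct (Rle_dec _ _); unfold Rabs; repeat destruct (Rcase_abs _); lra. }
  unfold Cmod; simpl. apply sqrt_le_1_alt. apply Rplus_le_compat_l.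
  apply Rsqr_le_abs_1 in L. unfold Rsqr in L. lra.
Qed.

Lemma locally_notin (zs : list C) (z : C) : ~ In z zs ->
  Clocally z (fun w => ~ In w zs).
Proof.
  induction zs as [|p zs IH]; intros Nz; simpl in *.
  - apply filter_forall. auto.
  - generalize (filter_and (F := Clocally z) _ _ (locally_neq z p ltac:(intros ->; auto)) (IH ltac:(auto))).
    apply filter_imp. intros w [H1 H2] [->|I]; auto.
Qed.

Section Clamped.
Variables (f : C -> C) (a0 : R) (zs : list C).
Hypothesis a0_pos : 0 < a0.
Hypothesis zs_strip : forall z, In z zs -> Rabs (Im z) < a0.
Hypothesis f_cont : continuous_on (T := C_UniformSpace) (U := C_UniformSpace)
  (fun z : C => Rabs (Im z) <= a0 /\ ~ In z zs) f.

Definition clamped (z : C) : C := f (clamp a0 z).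

Lemma clamped_eq (z : C) : Rabs (Im z) <= a0 -> clamped z = f z.
Proof. intros H. unfold clamped. rewrite clamp_id; auto. Qed.

Lemma clamped_cont (z : C) : ~ In z zs -> Ccont clamped z.
Proof.
  intros Nz.
  assert (NC : forall w, ~ In w zs -> ~ In (clamp a0 w) zs).
  { intros w Nw I. pose proof (zs_strip _ I) as H. apply clamp_inner in H; [|exact a0_pos]. rewrite H in I. auto. }
  apply (filterlim_comp _ _ _ (clamp a0) f _ (within (fun z => Rabs (Im z) <= a0 /\ ~ In z zs) (Clocally (clamp a0 z)))).
  - intros P HP. unfold filtermap. unfold within in HP.
    generalize (filter_and (F := Clocally z) _ _ (clamp_cont a0 z _ HP) (locally_notin zs z Nz)). apply filter_imp.
    intros w [Pw Nw]. apply Pw. split; [apply clamp_strip, a0_pos|apply NC, Nw].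
  - apply f_cont. split; [apply clamp_strip, a0_pos|apply NC, Nz].
Qed.

Lemma clamped_loc (z : C) : Rabs (Im z) < a0 -> Clocally z (fun w => f w = clamped w).
Proof.
  intros Hz. apply C_locally_Cmod. exists (a0 - Rabs (Im z)). split; [lra|]. intros w Hw.
  symmetry. apply clamped_eq.
  assert (Rabs (Im w) <= Rabs (Im z) + Cmod (Cminus w z)); [|lra].
  replace (Im w) with (Im z + Im (Cminus w z)) by (destruct w, z; simpl; ring).
  eapply Rle_trans; [apply Rabs_triang|]. apply Rplus_le_compat_l.
  eapply Rle_trans; [apply Rmax_r|apply Rmax_Cmod].
Qed.

Lemma clamped_diff (z : C) : Rabs (Im z) < a0 -> Cdiffable f z -> Cdiffable clamped z.
Proof. intros Hz [l D]. exists l. exact (Cderiv_ext_loc _ _ _ _ (clamped_loc z Hz) D). Qed.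

Lemma clamped_ppart (z : C) (n : nat) (c : nat -> C) : Rabs (Im z) < a0 ->
  has_principal_part f z n c -> has_principal_part clamped z n c.
Proof.
  intros Hz (g & Hg & Hf). exists g. split; [exact Hg|].
  assert (L : Clocally' z (fun w => f w = clamped w)).
  { unfold locally', within. generalize (clamped_loc z Hz). apply filter_imp. auto. }
  generalize (filter_and (F := Clocally' z) _ _ Hf L). apply filter_imp.
  intros w [E1 E2]. rewrite <- E2. exact E1.
Qed.

Lemma clamped_real : (fun x : R => clamped (RtoC x)) = (fun x : R => f (RtoC x)).
Proof. apply functional_extensionality. intros x. apply clamped_eq. simpl. rewrite Rabs_R0. lra. Qed.

Lemma clamped_integrand (xi : R) : fourier_integrand clamped xi = fourier_integrand f xi.
Proof.
  apply functional_extensionality. intros x. unfold fourier_integrand.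
  change (clamped (RtoC x)) with ((fun x => clamped (RtoC x)) x). rewrite clamped_real. reflexivity.
Qed.

Lemma clamped_fourier : fourier clamped = fourier f.
Proof. apply functional_extensionality. intros xi. unfold fourier. rewrite clamped_integrand. reflexivity. Qed.

Lemma clamped_sample (h : R) : sample clamped h = sample f h.
Proof.
  apply functional_extensionality. intros n. unfold sample.
  exact (f_equal (fun g : R -> C => g (IZR n * h)) clamped_real).
Qed.

Lemma clamped_decay (a C0 : R) : fourier_decay clamped a C0 -> fourier_decay f a C0.
Proof. unfold fourier_decay. rewrite clamped_fourier. auto. Qed.

Lemma clamped_trapezoidal (a C0 : R) : trapezoidal_bound clamped a C0 -> trapezoidal_bound f a C0.
Proof.
  intros T h Hh. specialize (T h Hh). revert T. unfold trapezoidal_error, fourier_sample.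
  rewrite clamped_sample, clamped_real, clamped_fourier. auto.
Qed.
End Clamped.

(** * The trapezoidal rule *)

(** Leaving [beta] free gives both parts of the final theorem: some [beta]
    exists as soon as the poles nearest to the axis are simple, and [beta z]
    is 2 pi times the modulus of the residue when all of them are. *)
Theorem decay_and_trapezoidal
  (f : C -> C) (a0 a : R) (zs : list C) (N : C -> nat) (c : C -> nat -> C) (beta : C -> R) :
  0 < a < a0 -> NoDup zs ->
  (forall xi, ex_RInt_line (V := C_R_CompleteNormedModule) (fourier_integrand f xi)) ->
  (forall z, In z zs -> a <= Rabs (Im z) < a0) ->
  (forall z : C, Rabs (Im z) < a0 -> ~ In z zs -> Cdiffable f z) ->
  continuous_on (T := C_UniformSpace) (U := C_UniformSpace)
    (fun z : C => Rabs (Im z) <= a0 /\ ~ In z zs) f ->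
  is_lim (fun x : R => RInt (fun eta : R => Cmod (f (x, eta))) (- a0) a0) p_infty 0 ->
  is_lim (fun x : R => RInt (fun eta : R => Cmod (f (x, eta))) (- a0) a0) m_infty 0 ->
  ex_RInt_line (V := R_CompleteNormedModule) (fun x : R => Cmod (f (x, a0))) ->
  ex_RInt_line (V := R_CompleteNormedModule) (fun x : R => Cmod (f (x, - a0))) ->
  (forall z, In z zs -> has_principal_part f z (N z) (c z)) ->
  (forall z, In z zs -> 0 <= beta z) ->
  (forall z xi, In z zs -> xi * Im z <= 0 ->
     Cmod (model_residue (freq xi) z (N z) (c z)) <= beta z * exp (- (2 * PI * a * Rabs xi))) ->
  let B := Rmax (RInt_line (V := R_CompleteNormedModule) (fun x : R => Cmod (f (x, - a0))))
                (RInt_line (V := R_CompleteNormedModule) (fun x : R => Cmod (f (x, a0))))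
           + sum_list (map beta zs) in
  fourier_decay f a B /\ trapezoidal_bound f a B.
Proof.
  intros Ha ND HF Hz HD HC Lp Lm Rp Rm HP Hb Hm B0.
  assert (a0_pos : 0 < a0) by lra.
  assert (zs_strip : forall z, In z zs -> Rabs (Im z) < a0) by (intros z I; apply Hz, I).
  assert (zs_nonreal : forall z, In z zs -> Im z <> 0).
  { intros z I E. specialize (Hz z I). rewrite E, Rabs_R0 in Hz. lra. }
  set (g := clamped f a0).
  assert (g_cont : forall z, ~ In z zs -> Ccont g z) by (apply clamped_cont; auto).
  assert (g_diff : forall z, Rabs (Im z) < a0 -> ~ In z zs -> Cdiffable g z).
  { intros z H1 H2. apply clamped_diff; auto. }
  assert (g_ppart : forall z, In z zs -> has_principal_part g z (N z) (c z)).
  { intros z I. apply clamped_ppart; auto. }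
  assert (g_fourier : forall xi, ex_RInt_line (V := C_R_CompleteNormedModule) (fourier_integrand g xi)).
  { intros xi. unfold g. rewrite clamped_integrand by exact a0_pos. apply HF. }
  assert (g_col : forall x, RInt (fun eta => Cmod (f (x, eta))) (- a0) a0 = colmass g a0 x).
  { intros x. unfold colmass. apply RInt_ext. intros y Hy. rewrite Rmin_left, Rmax_right in Hy by lra.
    unfold g. rewrite clamped_eq; [reflexivity|]. simpl. apply Rabs_le. lra. }
  assert (g_row : forall t, Rabs t = a0 -> (fun x => Cmod (g (x, t))) = (fun x => Cmod (f (x, t)))).
  { intros t Ht. apply functional_extensionality. intros x. unfold g. rewrite clamped_eq; [reflexivity|]. simpl. lra. }
  set (B := fun t => RInt_line (V := R_CompleteNormedModule) (fun x : R => Cmod (f (x, t)))).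
  assert (B_spec : forall t, Rabs t = a0 -> is_RInt_line (V := R_CompleteNormedModule) (fun x => Cmod (g (x, t))) (B t)).
  { intros t Ht. rewrite (g_row t Ht). apply RInt_gen_correct.
    destruct (Rle_dec 0 t) as [T|T].
    - rewrite Rabs_pos_eq in Ht by exact T. rewrite Ht. exact Rp.
    - rewrite Rabs_left in Ht by lra. replace t with (- a0) by lra. exact Rm. }
  assert (col_p : is_lim (colmass g a0) p_infty 0) by exact (is_lim_ext _ _ _ _ g_col Lp).
  assert (col_m : is_lim (colmass g a0) m_infty 0) by exact (is_lim_ext _ _ _ _ g_col Lm).
  assert (D : fourier_decay g a B0).
  { apply (decay_of_residue_bounds g a0 zs N c a0_pos ND zs_strip zs_nonreal g_cont g_diff g_ppart g_fourier B B_spec col_p col_m); auto. lra. }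
  split.
  - apply (clamped_decay f a0); auto.
  - apply (clamped_trapezoidal f a0); auto.
    apply (trapezoidal_bound_of_decay g a0 zs N c a0_pos ND zs_strip zs_nonreal g_cont g_diff g_ppart g_fourier B B_spec col_p col_m); [lra|exact D].
Qed.

Lemma sum_list_scal (k : R) (g : C -> R) (l : list C) :
  sum_list (map (fun z => k * g z) l) = k * sum_list (map g l).
Proof. unfold sum_list. induction l as [|z l IH]; simpl; [ring|]. rewrite IH. ring. Qed.

Theorem corollary4p4 :
  forall (f : C -> C) (a0 a : R) (zs : list C),
    0 < a < a0 ->
    (* F[f] exists on R, and Fourier inversion is valid *)
    (forall xi : R,
       ex_RInt_line (V := C_R_CompleteNormedModule) (fourier_integrand f xi)) ->
    fourier_inversion f ->
    (* zs lists the poles of f in the open strip, without repetition *)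
    NoDup zs ->
    (forall z : C, In z zs -> Rabs (Im z) < a0 /\ is_pole f z) ->
    (forall z : C, Rabs (Im z) < a0 -> ~ In z zs ->
       ex_derive (K := C_AbsRing) (V := C_NormedModule) f z) ->
    (* the values on the lines |Im z| = a0 are boundary values of f *)
    continuous_on (T := C_UniformSpace) (U := C_UniformSpace)
      (fun z : C => Rabs (Im z) <= a0 /\ ~ In z zs) f ->
    (* a is the minimum of |Im z| over the poles *)
    (exists z : C, In z zs /\ Rabs (Im z) = a) ->
    (forall z : C, In z zs -> a <= Rabs (Im z)) ->
    (forall z : C, In z zs -> Rabs (Im z) = a -> simple_pole f z) ->
    is_lim (fun x : R => RInt (fun eta : R => Cmod (f (x, eta))) (- a0) a0)
      p_infty 0 ->
    is_lim (fun x : R => RInt (fun eta : R => Cmod (f (x, eta))) (- a0) a0)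
      m_infty 0 ->
    ex_RInt_line (V := R_CompleteNormedModule) (fun x : R => Cmod (f (x, a0))) ->
    ex_RInt_line (V := R_CompleteNormedModule) (fun x : R => Cmod (f (x, - a0))) ->
    (exists B : R, fourier_decay f a B /\ trapezoidal_bound f a B) /\
    ((forall z : C, In z zs -> simple_pole f z) ->
     forall res : C -> C,
       (forall z : C, In z zs -> is_residue f z (res z)) ->
       let B0p := RInt_line (V := R_CompleteNormedModule)
                    (fun x : R => Cmod (f (x, a0))) in
       let B0m := RInt_line (V := R_CompleteNormedModule)
                    (fun x : R => Cmod (f (x, - a0))) in
       let B := Rmax B0m B0p
                + 2 * PI * sum_list (map (fun z => Cmod (res z)) zs) in
       fourier_decay f a B /\ trapezoidal_bound f a B).
Proof.
  intros f a0 a zs Ha HF _ ND Hpole HD HC [z0 [I0 E0]] Hmin Hsimple Lp Lm Rp Rm.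
  assert (Hz : forall z, In z zs -> a <= Rabs (Im z) < a0).
  { intros z I. split; [apply Hmin, I|apply Hpole, I]. }
  split.
  - destruct (pointwise_choice (0%nat, fun _ : nat => RtoC 0)
      (fun z d => has_principal_part f z (fst d) (snd d) /\ (Rabs (Im z) = a -> fst d = 1%nat)) (fun z => In z zs))
      as [d Hd].
    { intros z I. destruct (Req_dec (Rabs (Im z)) a) as [E|E].
      - destruct (Hsimple z I E) as (_ & c & Hc & _). exists (1%nat, c). auto.
      - destruct (proj2 (Hpole z I)) as (n & _ & c & Hc & _). exists (n, c). split; [exact Hc|]. intros E'. contradiction. }
    destruct (pointwise_choice 0 (fun z b => 0 <= b /\ forall xi, xi * Im z <= 0 ->
       Cmod (model_residue (freq xi) z (fst (d z)) (snd (d z))) <= b * exp (- (2 * PI * a * Rabs xi))) (fun z => In z zs))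
      as [beta Hbeta].
    { intros z I. destruct (Req_dec (Rabs (Im z)) a) as [E|E].
      - exists (2 * PI * Cmod (snd (d z) 1%nat)). split.
        + pose proof PI_RGT_0. pose proof (Cmod_ge_0 (snd (d z) 1%nat)). nra.
        + intros xi Hxi. rewrite (proj2 (Hd z I) E). apply simple_residue_bound; [exact Hxi|lra].
      - apply higher_residue_bound. specialize (Hz z I). lra. }
    eexists. apply (decay_and_trapezoidal f a0 a zs (fun z => fst (d z)) (fun z => snd (d z)) beta); auto.
    + intros z I. apply Hd, I.
    + intros z I. apply Hbeta, I.
    + intros z xi I. apply Hbeta, I.
  - intros Hs res Hres B0p B0m B.
    destruct (pointwise_choice (fun _ : nat => RtoC 0)
      (fun z c => has_principal_part f z 1 c /\ c 1%nat = res z) (fun z => In z zs)) as [c Hc].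
    { intros z I. destruct (Hs z I) as (_ & c & Hc & _). exists c. split; [exact Hc|].
      destruct (Hres z I) as (n & c' & Hn & Hc' & ->).
      exact (principal_part_residue_unique f z 1 n c c' (le_n 1) Hn Hc Hc'). }
    unfold B. rewrite <- (sum_list_scal (2 * PI) (fun z => Cmod (res z))).
    apply (decay_and_trapezoidal f a0 a zs (fun _ => 1%nat) c (fun z => 2 * PI * Cmod (res z))); auto.
    + intros z I. apply Hc, I.
    + intros z I. pose proof PI_RGT_0. pose proof (Cmod_ge_0 (res z)). nra.
    + intros z xi I Hxi. rewrite <- (proj2 (Hc z I)). apply simple_residue_bound; [exact Hxi|apply Hz, I].
Qed.
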